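(* Let $\lambda\in\mathbb{C}$, $y_1,y_2\in\mathbb{C}$. The solution $y(\lambda,x)$ of the Cauchy problem $$iy'''(x)+q(x)y(x)=\lambda^3y(x),\qquad y(\lambda,0)=0,\ y'(\lambda,0)=y_1,\ y''(\lambda,0)=y_2$$ on $[0,l]$ is expressed via the solution $y_0(\lambda,x)=y_1\frac{s_1(i\lambda x)}{i\lambda}+y_2\frac{s_2(i\lambda x)}{(i\lambda)^2}$ of the same Cauchy problem with $q\equiv0$ by the formula $$y(\lambda,x)=(I+T_\lambda)y_0(\lambda,x),$$ where $T_\lambda$ is the family of Volterra operators in $L^2(0,l)$ $$(T_\lambda f)(x)=\int_0^xT(\lambda,x,t)f(t)\,dt,\qquad T(\lambda,x,t)=N(\lambda,x,t)q(t),\qquad T(\lambda\zeta_2,x,t)=T(\lambda,x,t)\qquad(f\in L^2(0,l)).$$ The operators $K_\lambda$ and $T_\lambda$ satisfy the identities $$T_\lambda=(I-iK_\lambda)^{-1}iK_\lambda=(I-iK_\lambda)^{-1}-I,\qquad I+T_\lambda=(I-iK_\lambda)^{-1}.$$ The kernel $T(\lambda,x,t)$ is the solution of the integral equation $$T(\lambda,x,t)-i\int_t^xK_1(\lambda,x,s)q(s)T(\lambda,s,t)\,ds=iK_1(\lambda,x,t)q(t),$$ and $$\lim_{t\to x}\frac{T(\lambda,x,t)}{(x-t)^2}=\frac i2q(x).$$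
   Context: Let $\zeta_1=1$, $\zeta_2=\frac12(-1+i\sqrt3)$, $\zeta_3=\frac12(-1-i\sqrt3)$ and $s_p(z)=\frac13\sum_{k=1}^3\zeta_k^{-p}e^{z\zeta_k}$ ($p=0,1,2$). Let $0<l<\infty$ and let $q\in L^2(0,l)$ be real. For $0\le t\le x\le l$ put $$K_1(\lambda,x,t)=\frac{s_2(i\lambda(x-t))}{(i\lambda)^2},\qquad K_{n+1}(\lambda,x,t)=\int_t^xK_1(\lambda,x,s)q(s)K_n(\lambda,s,t)\,ds\quad(n\in\mathbb{N}),$$ $$N(\lambda,x,t)=\sum_{n=1}^\infty i^nK_n(\lambda,x,t),\qquad (K_\lambda f)(x)=\int_0^xK_1(\lambda,x,t)q(t)f(t)\,dt\quad(f\in L^2(0,l)).$$ The series for $N$ converges. Quotients are understood by continuity at $\lambda=0$ (e.g. $K_1(0,x,t)=(x-t)^2/2$).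
   Formalization: The final limit of T/(x-t)^2 is false for general q in L^2; it is proved at each x where q is left-continuous (exactly where it holds), together with N/(x-t)^2 -> i/2 at every x>0 and, for all q and a.e. x, the limit in the averaged Lebesgue-point sense. *)

(* Defs.v *)
From HB Require Import structures.
From mathcomp Require Import all_boot all_order all_algebra.
From mathcomp Require Import all_classical all_reals all_analysis.
From mathcomp Require Import complex.

Set Implicit Arguments.
Unset Strict Implicit.
Unset Printing Implicit Defensive.

Import Order.TTheory GRing.Theory Num.Theory.
Import numFieldNormedType.Exports.

Local Open Scope classical_set_scope.
Local Open Scope ring_scope.
Local Open Scope complex_scope.

Section Defs.
Variable R : realType.

(* [C^o] is [R[i]] with its usual topology. *)
Local Notation C := R[i].
Local Notation Re := complex.Re.
Local Notation Im := complex.Im.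
Local Notation mu := (@lebesgue_measure R).

Definition cmod (z : C) : R := Re `|z|.

Definition cexp (z : C) : C :=
  (expR (Re z))%:C * (cos (Im z) +i* sin (Im z)).

(* Only k = 1, 2, 3 are meaningful. *)
Definition zeta (k : nat) : C :=
  match k with
  | 1 => 1
  | 2 => 2^-1 * (-1 + 'i%C * (Num.sqrt 3)%:C)
  | _ => 2^-1 * (-1 - 'i%C * (Num.sqrt 3)%:C)
  end.

Definition s_ (p : nat) (z : C) : C :=
  3^-1 * \sum_(1 <= k < 4) zeta k ^- p * cexp (z * zeta k).

(* s_p(w x) / w^p for p = 0, 1, 2, extended by continuity to w = 0: since
   s_p(z) = z^p/p! + z^(p+3)/(p+3)! + ..., the value there is x^p/p!. *)
Definition s_quot (p : nat) (w : C) (x : R) : C :=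
  if w == 0 then (x ^+ p / p`!%:R)%:C else s_ p (w * x%:C) / w ^+ p.

Definition cintegral (D : set R) (f : R -> C) : C :=
  Rintegral mu D (fun x => Re (f x)) +i* Rintegral mu D (fun x => Im (f x)).

(* The complex space L^2(a,b): its elements are represented by functions, and
   equality in it is [ae_equal]. *)
Definition L2 (a b : R) (f : R -> C) : Prop :=
  [/\ measurable_fun `]a, b[ (fun x => Re (f x)),
      measurable_fun `]a, b[ (fun x => Im (f x)) &
      (\int[mu]_(x in `]a, b[) (cmod (f x) ^+ 2)%:E < +oo)%E].

Definition L2norm (a b : R) (f : R -> C) : R :=
  Num.sqrt (Rintegral mu `]a, b[ (fun x => cmod (f x) ^+ 2)).

Definition ae_equal (a b : R) (f g : R -> C) : Prop :=
  {ae mu, forall x, x \in `]a, b[ -> f x = g x}.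

Definition operator := (R -> C) -> (R -> C).

Definition L2_bounded_operator (l : R) (A : operator) : Prop :=
  [/\ forall f, L2 0 l f -> L2 0 l (A f),
      forall (a : C) f g, L2 0 l f -> L2 0 l g ->
        ae_equal 0 l (A (fun x => a * f x + g x))
                     (fun x => a * A f x + A g x) &
      exists M : R, forall f, L2 0 l f -> L2norm 0 l (A f) <= M * L2norm 0 l f].

Definition L2_invertible (l : R) (A : operator) : Prop :=
  exists B : operator,
    [/\ L2_bounded_operator l B,
        forall f, L2 0 l f -> ae_equal 0 l (A (B f)) f &
        forall f, L2 0 l f -> ae_equal 0 l (B (A f)) f].

(* The inverse operator: [L2_inv l A f] is a representative of the solution g
   in L^2(0,l) of A g = f (meaningful when [L2_invertible l A]). *)
Definition L2_inv (l : R) (A : operator) : operator := fun f =>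
  xget (fun=> 0) [set g | L2 0 l g /\ ae_equal 0 l (A g) f].

(* Square-summable (Hilbert-Schmidt) kernels on the triangle 0 < t < x < l. *)
Definition L2_Volterra_kernel (l : R) (k : R -> R -> C) : Prop :=
  [/\ measurable_fun [set p : R * R | 0 < p.2 < p.1 /\ p.1 < l]
        (fun p => Re (k p.1 p.2)),
      measurable_fun [set p : R * R | 0 < p.2 < p.1 /\ p.1 < l]
        (fun p => Im (k p.1 p.2)) &
      (\int[mu]_(x in `]0%R, l[) \int[mu]_(t in `]0%R, x[)
         (cmod (k x t) ^+ 2)%:E < +oo)%E].

Definition Volterra_op (k : R -> R -> C) : operator := fun f x =>
  cintegral `[0, x] (fun t => k x t * f t).

Definition K1 (lam : C) (x t : R) : C := s_quot 2 ('i%C * lam) (x - t).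

(* [Kn q lam n] is K_n for n >= 1; the value at n = 0 is a dummy. *)
Fixpoint Kn (q : R -> R) (lam : C) (n : nat) : R -> R -> C :=
  match n with
  | 0 => fun _ _ => 0
  | 1 => K1 lam
  | m.+1 => fun x t =>
      cintegral `[t, x] (fun s => K1 lam x s * (q s)%:C * Kn q lam m s t)
  end.

Definition Nseries (q : R -> R) (lam : C) (x t : R) : nat -> C^o :=
  fun m => \sum_(1 <= n < m.+1) 'i%C ^+ n * Kn q lam n x t.

Definition Nker (q : R -> R) (lam : C) (x t : R) : C :=
  limn (Nseries q lam x t).

Definition Tker (q : R -> R) (lam : C) (x t : R) : C :=
  Nker q lam x t * (q t)%:C.

Definition Kop (q : R -> R) (lam : C) : operator :=
  Volterra_op (fun x t => K1 lam x t * (q t)%:C).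

Definition Top (q : R -> R) (lam : C) : operator := Volterra_op (Tker q lam).

Definition iKop (q : R -> R) (lam : C) : operator :=
  fun f x => 'i%C * Kop q lam f x.

Definition ImiKop (q : R -> R) (lam : C) : operator :=
  fun f x => f x - iKop q lam f x.

(* Derivative at x of a function on [0,l]; one-sided at the endpoints. *)
Definition has_deriv (l : R) (f : R -> C) (x : R) (d : C) : Prop :=
  ((fun u : R => (f u - f x) / (u - x)%:C : C^o) @ within `[0, l] x^')
    --> (d : C^o).

Definition abs_cont (a b : R) (f : R -> C) : Prop :=
  forall e : R, 0 < e -> exists2 d : R, 0 < d &
    forall (n : nat) (u v : nat -> R),
      (forall i, (i < n)%N -> a <= u i /\ u i <= v i /\ v i <= b) ->
      trivIset `I_n (fun i => [set` `]u i, v i[]) ->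
      \sum_(i < n) (v i - u i) < d ->
      \sum_(i < n) cmod (f (v i) - f (u i)) < e.

(* Solutions are understood in the Caratheodory sense: y, y', y'' exist
   everywhere on [0,l], y'' is absolutely continuous, and the equation holds
   almost everywhere. *)
Definition Cauchy_solution (l : R) (q : R -> R) (lam y1 y2 : C) (y : R -> C)
    : Prop :=
  exists dy ddy : R -> C,
    [/\ forall x, x \in `[0, l] -> has_deriv l y x (dy x),
        forall x, x \in `[0, l] -> has_deriv l dy x (ddy x),
        abs_cont 0 l ddy,
        {ae mu, forall x, x \in `]0, l[ ->
           exists2 d3 : C, has_deriv l ddy x d3 &
             'i%C * d3 + (q x)%:C * y x = lam ^+ 3 * y x} &
        [/\ y 0 = 0, dy 0 = y1 & ddy 0 = y2]].

Definition y0_sol (lam y1 y2 : C) (x : R) : C :=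
  y1 * s_quot 1 ('i%C * lam) x + y2 * s_quot 2 ('i%C * lam) x.

End Defs.

(* Main.v *)
(* Every kernel is extended by zero off the triangle 0 <= t <= x <= l, and q by
   zero off (0, l). From |K_1(x,t)| <= C (x-t)^2 one gets by induction
   |K_n(x,t)| <= C (C |q|_1)^(n-1) (x-t)^(2n) / (n!)^2, so the series for N
   converges uniformly, N = i K_1 + i K_1 q N, and by Fubini
   T = iK + iK T. The same iteration shows that a bounded u with
   |u| <= c |K_1 q u| vanishes, so I - iK is injective and I + T is its inverse.

   For the Cauchy problem put w = i lam, so that the equation reads
   y''' = w^3 y + i q y, and k_p(x) = s_p(w x)/w^p, so that k_2' = k_1,
   k_1' = k_0 and k_0' = w^3 k_2. The function z = y0 + k_2 * (i q f) = y0 + iK f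
   has the required initial values and z''' = w^3 z + i q f; hence a solution of
   y = y0 + iK y, that is y = y0 + T y0, solves the problem.
   Conversely, integrating the equation three times shows that the difference
   d of a solution y and of y0 + iK y satisfies |d(x)| <= |w|^3 times the integral
   of (x-s)^2/2 |d(s)| over [0, x], hence vanishes. Integrating y''' uses that an
   absolutely continuous function whose derivative vanishes a.e. is constant.

   On the diagonal |N - i K_1| = O((x-t)^4) and K_1 = (x-t)^2/2 + O((x-t)^3); the
   a.e. statement is then Lebesgue's differentiation theorem for q. *)
Require Import Defs.
From HB Require Import structures.
From mathcomp Require Import all_boot all_order all_algebra.
From mathcomp Require Import all_classical all_reals all_analysis.
From mathcomp Require Import measurable_realfun complex ring lra.

Set Implicit Arguments.
Unset Strict Implicit.
Unset Printing Implicit Defensive.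

Import Order.TTheory GRing.Theory Num.Theory.
Import numFieldNormedType.Exports.

Local Open Scope classical_set_scope.
Local Open Scope complex_scope.
Local Open Scope ring_scope.

(** * The complex modulus *)

(** Since q is only square integrable, the iterated kernel integrals cannot be evaluated. Each step
    bounds (x-s)^2 (s-t)^(2n) pointwise by (x-t)^(2n+2)/(n+1)^2 and leaves |q| alone under the
    integral; this is the origin of (n!)^2. An element f of L^2 enters the operators only through
    the integrable product q f, so all operators are bounded kernels acting on L^1. Extension by
    zero turns integrals over moving intervals into integrals over the line, where Fubini and
    measurability in a parameter apply directly. K maps a.e. equal functions to equal functions,
    which turns a.e. statements into pointwise ones on [0,l]. Representing solutions with the
    kernels of w = 0 makes d a solution of a Volterra equation of the same type with q = 1, so one
    uniqueness argument serves both the operators and the Cauchy problem. For q in L^2 a limit of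
    T/(x-t)^2 at every point cannot be expected; the diagonal statement is therefore given for N at
    every point, for T where q is left continuous, and for T in mean at almost every point. *)

Section ComplexModulus.
Variable R : realType.
Implicit Types (x y z : R[i]) (r : R).
Local Notation Re := complex.Re.
Local Notation Im := complex.Im.

Lemma complex_ext x y : Re x = Re y -> Im x = Im y -> x = y.
Proof. by case: x => a b; case: y => c d /= -> ->. Qed.

Lemma ReD x y : Re (x + y) = Re x + Re y.
Proof. by case: x; case: y. Qed.
Lemma ImD x y : Im (x + y) = Im x + Im y.
Proof. by case: x; case: y. Qed.
Lemma ReN x : Re (- x) = - Re x.
Proof. by case: x. Qed.
Lemma ImN x : Im (- x) = - Im x.
Proof. by case: x. Qed.
Lemma ReM x y : Re (x * y) = Re x * Re y - Im x * Im y.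
Proof. by case: x; case: y. Qed.
Lemma ImM x y : Im (x * y) = Re x * Im y + Im x * Re y.
Proof. by case: x; case: y. Qed.
Lemma ReC r : Re r%:C = r. Proof. by []. Qed.
Lemma ImC r : Im r%:C = 0. Proof. by []. Qed.

Definition ReImE := (ReD, ImD, ReN, ImN, ReM, ImM, ReC, ImC).

Lemma normc_cmod x : `|x| = (cmod x)%:C.
Proof. by rewrite /cmod normc_def. Qed.

Lemma cmodE x : cmod x = Num.sqrt (Re x ^+ 2 + Im x ^+ 2).
Proof. by rewrite /cmod normc_def. Qed.

Lemma cmod_ge0 x : 0 <= cmod x.
Proof. by rewrite cmodE sqrtr_ge0. Qed.

Lemma cmod_sqr x : cmod x ^+ 2 = Re x ^+ 2 + Im x ^+ 2.
Proof. by rewrite cmodE sqr_sqrtr// addr_ge0// sqr_ge0. Qed.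

Lemma cmodM x y : cmod (x * y) = cmod x * cmod y.
Proof.
by apply: (@complexI R); rewrite rmorphM/= -!normc_cmod normrM.
Qed.

Lemma cmodD x y : cmod (x + y) <= cmod x + cmod y.
Proof. by rewrite -lecR rmorphD/= -!normc_cmod ler_normD. Qed.

Lemma cmodN x : cmod (- x) = cmod x.
Proof. by rewrite /cmod normrN. Qed.

Lemma cmodB x y : cmod (x - y) <= cmod x + cmod y.
Proof. by rewrite (le_trans (cmodD _ _))// cmodN. Qed.

Lemma cmod_distC x y : cmod (x - y) = cmod (y - x).
Proof. by rewrite -cmodN opprB. Qed.

Lemma cmod_triangle z x y : cmod (x - y) <= cmod (x - z) + cmod (z - y).
Proof. by rewrite -[x - y](subrKA z) cmodD. Qed.

Lemma cmodC r : cmod r%:C = `|r|.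
Proof. by rewrite cmodE/= expr0n/= addr0 sqrtr_sqr. Qed.

Lemma cmod0 : cmod (0 : R[i]) = 0.
Proof. by rewrite -[0]/(0%:C) cmodC normr0. Qed.

Lemma cmod1 : cmod (1 : R[i]) = 1.
Proof. by rewrite -[1]/(1%:C) cmodC normr1. Qed.

Lemma cmod_i : cmod ('i%C : R[i]) = 1.
Proof. by rewrite cmodE/= expr0n/= add0r expr1n sqrtr1. Qed.

Lemma cmodX x n : cmod (x ^+ n) = cmod x ^+ n.
Proof. by elim: n => [|n IH]; rewrite ?expr0 ?cmod1// !exprS cmodM IH. Qed.

Lemma cmod_eq0 x : (cmod x == 0) = (x == 0).
Proof. by rewrite -(inj_eq (@complexI R)) -normc_cmod normr_eq0. Qed.

Lemma cmod_le0 x : (cmod x <= 0) = (x == 0).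
Proof. by rewrite -cmod_eq0 eq_le cmod_ge0 andbT. Qed.

Lemma cmodV x : cmod x^-1 = (cmod x)^-1.
Proof.
by apply: (@complexI R); rewrite fmorphV/= -!normc_cmod normfV.
Qed.

Lemma cmod_ge_Re x : `|Re x| <= cmod x.
Proof. by rewrite cmodE -sqrtr_sqr ler_wsqrtr// lerDl sqr_ge0. Qed.

Lemma cmod_ge_Im x : `|Im x| <= cmod x.
Proof. by rewrite cmodE -sqrtr_sqr ler_wsqrtr// lerDr sqr_ge0. Qed.

Lemma cmod_le_ReIm x : cmod x <= `|Re x| + `|Im x|.
Proof.
rewrite {1}(complexE x) (le_trans (cmodD _ _))// cmodM cmod_i mul1r.
by rewrite !cmodC.
Qed.

Lemma cmod_sum (I : Type) (s : seq I) (P : pred I) (F : I -> R[i]) :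
  cmod (\sum_(i <- s | P i) F i) <= \sum_(i <- s | P i) cmod (F i).
Proof.
elim/big_rec2 : _ => [|i a b _ ab]; first by rewrite cmod0.
by rewrite (le_trans (cmodD _ _))// lerD2l.
Qed.

Lemma cmod_lt0P x e : 0 < e -> (`|x| < e%:C) = (cmod x < e).
Proof. by move=> e0; rewrite normc_cmod ltcR. Qed.

(** A positive element of [R[i]] is a positive real number, so the complex radii of the norm
    topology reduce to real ones. *)
Lemma cvg_cmodP {T : Type} (F : set_system T) {FF : Filter F}
    (f : T -> R[i]^o) (z : R[i]^o) :
  f @ F --> z <-> forall e : R, 0 < e -> \forall t \near F, cmod (f t - z) < e.
Proof.
split=> [/cvgrPdist_lt fz e e0|fz].
  have e0' : (0 : R[i]) < e%:C by rewrite ltcR.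
  near=> t; rewrite cmod_distC -cmod_lt0P//.
  by near: t; exact: fz.
apply/cvgrPdist_lt => e e0.
have eR : e = (Re e)%:C by rewrite RRe_real// gtr0_real.
move: e0; rewrite eR ltcR => e0.
near=> t; rewrite (_ : `| z - f t| = (cmod (f t - z))%:C); last first.
  by rewrite cmod_distC -normc_cmod.
by rewrite ltcR; near: t; exact: fz.
Unshelve. all: by end_near. Qed.

Lemma cvg_ReIm {T : Type} (F : set_system T) {FF : Filter F}
    (f : T -> R[i]^o) (a b : R) :
  (fun t => Re (f t)) @ F --> a -> (fun t => Im (f t)) @ F --> b ->
  f @ F --> (a +i* b : R[i]^o).
Proof.
move=> /cvgrPdist_lt fa /cvgrPdist_lt fb; apply/cvg_cmodP => e e0.
have e2 : 0 < e / 2 by rewrite divr_gt0.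
near=> t.
rewrite (le_lt_trans (cmod_le_ReIm _))// (splitr e) ltrD//.
  by rewrite ReD ReN distrC; near: t; exact: fa.
by rewrite ImD ImN distrC; near: t; exact: fb.
Unshelve. all: by end_near. Qed.

Lemma cvg_unique_C {T : Type} (F : set_system T) {FF : ProperFilter F}
    (f : T -> R[i]^o) (a b : R[i]^o) :
  f @ F --> a -> f @ F --> b -> a = b.
Proof.
move=> /cvg_cmodP fa /cvg_cmodP fb; apply/eqP; rewrite -subr_eq0 -cmod_le0.
apply/ler_addgt0Pl => e e0; rewrite addr0.
have e2 : 0 < e / 2 by rewrite divr_gt0.
near F => t.
rewrite (le_trans (cmod_triangle (f t) _ _))// (splitr e) lerD//.
  by rewrite cmod_distC ltW//; near: t; exact: fa.
by rewrite ltW//; near: t; exact: fb.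
Unshelve. all: by end_near. Qed.

End ComplexModulus.

(** * Measurability and integration of complex functions *)

Section ComplexMeasurable.
Context d (T : measurableType d) (R : realType).
Implicit Types (D : set T) (f g : T -> R[i]).
Local Notation Re := complex.Re.
Local Notation Im := complex.Im.

Definition cmeas D f :=
  measurable_fun D (fun x => Re (f x)) /\ measurable_fun D (fun x => Im (f x)).

Lemma cmeas_cst D (c : R[i]) : cmeas D (fun=> c).
Proof. by split; exact: measurable_cst. Qed.

Lemma cmeas_real D (f : T -> R) : measurable_fun D f -> cmeas D (fun x => (f x)%:C).
Proof. by move=> mf; split => //=; exact: measurable_cst. Qed.

Lemma cmeasD D f g : cmeas D f -> cmeas D g -> cmeas D (fun x => f x + g x).
Proof.
move=> [f1 f2] [g1 g2]; split.
  by under eq_fun do rewrite ReD; exact: measurable_funD.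
by under eq_fun do rewrite ImD; exact: measurable_funD.
Qed.

Lemma cmeasM D f g : cmeas D f -> cmeas D g -> cmeas D (fun x => f x * g x).
Proof.
move=> [f1 f2] [g1 g2]; split.
  by under eq_fun do rewrite ReM; apply: measurable_funB; exact: measurable_funM.
by under eq_fun do rewrite ImM; apply: measurable_funD; exact: measurable_funM.
Qed.

Lemma cmeasZ D (c : R[i]) f : cmeas D f -> cmeas D (fun x => c * f x).
Proof. by move=> mf; apply: cmeasM => //; exact: cmeas_cst. Qed.

Lemma cmeasB D f g : cmeas D f -> cmeas D g -> cmeas D (fun x => f x - g x).
Proof.
move=> mf mg; apply: cmeasD => //; under eq_fun do rewrite -mulN1r.
exact: cmeasZ.
Qed.

Lemma eq_cmeas D f g : {in D, f =1 g} -> cmeas D f -> cmeas D g.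
Proof.
move=> fg [m1 m2]; split.
  by apply: eq_measurable_fun m1 => x xD; rewrite fg.
by apply: eq_measurable_fun m2 => x xD; rewrite fg.
Qed.

Lemma cmeasS E D f : measurable E -> D `<=` E -> cmeas E f -> cmeas D f.
Proof. move=> mE DE [m1 m2].
by split; [exact: (measurable_funS mE DE m1)|exact: (measurable_funS mE DE m2)]. Qed.

Lemma cmeas_if (b : T -> bool) f g : measurable [set x | b x] ->
  cmeas setT f -> cmeas setT g -> cmeas setT (fun x => if b x then f x else g x).
Proof.
move=> mb [f1 f2] [g1 g2].
have mbb : measurable_fun setT b.
  by apply: (@measurable_fun_bool _ _ _ _ true) => //; rewrite setTI.
split.
  rewrite (_ : (fun x => _) = (fun x => if b x then Re (f x) else Re (g x))).
    by apply: measurable_fun_ifT.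
  by apply/funext => x; case: ifP.
rewrite (_ : (fun x => _) = (fun x => if b x then Im (f x) else Im (g x))).
  by apply: measurable_fun_ifT.
by apply/funext => x; case: ifP.
Qed.

Lemma measurable_cmod D f : cmeas D f -> measurable_fun D (fun x => cmod (f x)).
Proof.
move=> [f1 f2]; under eq_fun do rewrite cmodE.
apply: (@measurableT_comp _ _ _ _ _ _ (@Num.sqrt R)).
  exact: (continuous_measurable_fun (@sqrt_continuous R)).
by apply: measurable_funD; exact: measurable_funX.
Qed.

Lemma cmeas_cvg D (h : nat -> T -> R[i]) f : measurable D ->
  (forall n, cmeas D (h n)) ->
  (forall x, D x -> (h ^~ x : nat -> R[i]^o) @ \oo --> (f x : R[i]^o)) ->
  cmeas D f.
Proof.
move=> mD mh hf; split.
- apply: (@measurable_fun_cvg _ _ _ _ (fun n x => Re (h n x))).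
    by move=> n; exact: (mh n).1.
  move=> x Dx; apply/cvgrPdist_lt => e e0; have /cvg_cmodP/(_ _ e0) := hf _ Dx.
  apply: filterS => n; rewrite cmod_distC; apply: le_lt_trans.
  by rewrite -ReN -ReD cmod_ge_Re.
- apply: (@measurable_fun_cvg _ _ _ _ (fun n x => Im (h n x))).
    by move=> n; exact: (mh n).2.
  move=> x Dx; apply/cvgrPdist_lt => e e0; have /cvg_cmodP/(_ _ e0) := hf _ Dx.
  apply: filterS => n; rewrite cmod_distC; apply: le_lt_trans.
  by rewrite -ImN -ImD cmod_ge_Im.
Qed.

End ComplexMeasurable.

Lemma cmeas_comp d1 d2 (T1 : measurableType d1) (T2 : measurableType d2)
    (R : realType) (f : T2 -> R[i]) (h : T1 -> T2) :
  cmeas setT f -> measurable_fun setT h -> cmeas setT (fun x => f (h x)).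
Proof. move=> [m1 m2] mh.
by split; [exact: (measurableT_comp m1 mh)|exact: (measurableT_comp m2 mh)]. Qed.

Section ComplexIntegral.
Variable R : realType.
Local Notation mu := (@lebesgue_measure R).
Local Notation TR := (measurableTypeR R).
Implicit Types (D E : set TR) (f g : TR -> R[i]).
Local Notation Re := complex.Re.
Local Notation Im := complex.Im.

Definition cint D f :=
  mu.-integrable D (EFin \o (fun x => Re (f x))) /\
  mu.-integrable D (EFin \o (fun x => Im (f x))).

Lemma cint_meas D f : cint D f -> cmeas D f.
Proof.
by move=> [/integrableP[m1 _] /integrableP[m2 _]]; split; exact/measurable_EFinP.
Qed.

Lemma cint_le D f (g : TR -> R) : measurable D -> cmeas D f ->
  mu.-integrable D (EFin \o g) -> (forall x, D x -> cmod (f x) <= g x) ->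
  cint D f.
Proof.
move=> mD [m1 m2] ig fg; split.
  apply: (le_integrable mD _ _ ig); first exact/measurable_EFinP.
  move=> x Dx /=; rewrite lee_fin (le_trans (cmod_ge_Re _))//.
  by rewrite (le_trans (fg _ Dx))// ler_norm.
apply: (le_integrable mD _ _ ig); first exact/measurable_EFinP.
move=> x Dx /=; rewrite lee_fin (le_trans (cmod_ge_Im _))//.
by rewrite (le_trans (fg _ Dx))// ler_norm.
Qed.

Lemma cint_cmod D f : measurable D -> cint D f ->
  mu.-integrable D (EFin \o (fun x => cmod (f x))).
Proof.
move=> mD fi; have [i1 i2] := fi.
have i12 := integrableD mD (integrable_abse i1) (integrable_abse i2).
apply: (le_integrable mD _ _ i12).
  exact/measurable_EFinP/measurable_cmod/cint_meas.
move=> x Dx /=; rewrite lee_fin ger0_norm ?cmod_ge0//.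
by rewrite ger0_norm ?addr_ge0// cmod_le_ReIm.
Qed.

Lemma eq_cint D f g : measurable D -> {in D, f =1 g} -> cint D f -> cint D g.
Proof.
move=> mD fg [i1 i2]; split.
  by apply: eq_integrable i1 => // x xD /=; rewrite fg.
by apply: eq_integrable i2 => // x xD /=; rewrite fg.
Qed.

Lemma cintD D f g : measurable D -> cint D f -> cint D g ->
  cint D (fun x => f x + g x).
Proof.
move=> mD [f1 f2] [g1 g2]; split.
  have := integrableD mD f1 g1; apply: eq_integrable => // x _ /=.
  by rewrite ReD EFinD.
have := integrableD mD f2 g2; apply: eq_integrable => // x _ /=.
by rewrite ImD EFinD.
Qed.

Lemma cintZ D (c : R[i]) f : measurable D -> cint D f ->
  cint D (fun x => c * f x).
Proof.
move=> mD fi.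
apply: (@cint_le _ _ (fun x => cmod c * cmod (f x))) => //.
- by apply: cmeasZ; exact: cint_meas.
- have := integrableZl mD (cmod c) (cint_cmod mD fi).
  by apply: eq_integrable => // x _ /=; rewrite EFinM.
- by move=> x _; rewrite cmodM.
Qed.

Lemma cintB D f g : measurable D -> cint D f -> cint D g ->
  cint D (fun x => f x - g x).
Proof.
move=> mD fi gi; apply: cintD => //; under eq_fun do rewrite -mulN1r.
exact: cintZ.
Qed.

Lemma eq_cintegral D f g : {in D, f =1 g} -> cintegral D f = cintegral D g.
Proof. by move=> fg; congr (_ +i* _); apply: eq_Rintegral => x /fg ->. Qed.

Lemma cintegralD D f g : measurable D -> cint D f -> cint D g ->
  cintegral D (fun x => f x + g x) = cintegral D f + cintegral D g.
Proof.
move=> mD [f1 f2] [g1 g2]; rewrite /cintegral; apply: complex_ext => /=.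
  by rewrite -RintegralD//; apply: eq_Rintegral => x _; rewrite ReD.
by rewrite -RintegralD//; apply: eq_Rintegral => x _; rewrite ImD.
Qed.

Lemma cintegralZ D (c : R[i]) f : measurable D -> cint D f ->
  cintegral D (fun x => c * f x) = c * cintegral D f.
Proof.
move=> mD [f1 f2].
have iZ (r : R) (h : TR -> R) : mu.-integrable D (EFin \o h) ->
    mu.-integrable D (EFin \o (fun x => r * h x)).
  move=> ih; have := integrableZl mD r ih.
  by apply: eq_integrable => // x _ /=; rewrite EFinM.
rewrite /cintegral; apply: complex_ext; rewrite [RHS](ReM, ImM)/= -!RintegralZl//.
  by rewrite -RintegralB//; [|exact: iZ..]; apply: eq_Rintegral => x _; rewrite ReM.
by rewrite -RintegralD//; [|exact: iZ..]; apply: eq_Rintegral => x _; rewrite ImM.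
Qed.

Lemma cintegralB D f g : measurable D -> cint D f -> cint D g ->
  cintegral D (fun x => f x - g x) = cintegral D f - cintegral D g.
Proof.
move=> mD fi gi; rewrite -mulN1r -cintegralZ// -cintegralD//; last exact: cintZ.
by apply: eq_cintegral => x _; rewrite mulN1r.
Qed.

Lemma cintegral0 D f : {in D, forall x, f x = 0} -> cintegral D f = 0.
Proof.
move=> f0; apply: complex_ext => /=.
  transitivity (Rintegral mu D (fun=> 0)); last by rewrite /Rintegral integral0.
  by apply: eq_Rintegral => x /f0 ->.
transitivity (Rintegral mu D (fun=> 0)); last by rewrite /Rintegral integral0.
by apply: eq_Rintegral => x /f0 ->.
Qed.

(** With w the conjugate of the integral z, |z|^2 = Re(w z) is the integral of Re(w f), which is at
    most |z| times the integral of |f|. Componentwise bounds would cost a constant factor. *)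
Lemma cmod_cintegral D f : measurable D -> cint D f ->
  cmod (cintegral D f) <= Rintegral mu D (fun x => cmod (f x)).
Proof.
move=> mD fi; set z := cintegral D f.
have [->|z0] := eqVneq z 0.
  by rewrite cmod0; apply: Rintegral_ge0 => x _; exact: cmod_ge0.
have zp : 0 < cmod z by rewrite lt_neqAle eq_sym cmod_eq0 z0 cmod_ge0.
rewrite -(ler_pM2l zp) -expr2 cmod_sqr.
pose w : R[i] := Re z -i* Im z.
have wz : cmod w = cmod z by rewrite !cmodE/= sqrrN.
have -> : Re z ^+ 2 + Im z ^+ 2 = Re (w * z) by rewrite ReM/=; ring.
rewrite -cintegralZ// -RintegralZl//; last exact: cint_cmod.
rewrite /cintegral/=; apply: le_Rintegral => //.
- by have [] := cintZ w mD fi.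
- have := integrableZl mD (cmod z) (cint_cmod mD fi).
  by apply: eq_integrable => // x _ /=; rewrite EFinM.
- by move=> x _; rewrite -wz -cmodM (le_trans (ler_norm _))// cmod_ge_Re.
Qed.

Lemma cmod_cintegral_le D f (g : TR -> R) : measurable D -> cmeas D f ->
  mu.-integrable D (EFin \o g) -> (forall x, D x -> cmod (f x) <= g x) ->
  cmod (cintegral D f) <= Rintegral mu D g.
Proof.
move=> mD mf ig fg; have fi := cint_le mD mf ig fg.
rewrite (le_trans (cmod_cintegral mD fi))// le_Rintegral//.
exact: cint_cmod.
Qed.

Lemma cintegral_mkcond D f : cintegral D f =
  cintegral setT (fun x => if x \in D then f x else 0).
Proof.
apply: complex_ext => /=; rewrite Rintegral_mkcond.
  by apply: eq_Rintegral => x _; rewrite patchE; case: ifP.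
by apply: eq_Rintegral => x _; rewrite patchE; case: ifP.
Qed.

Lemma cmeas_mkcond D f : measurable D ->
  cmeas D f <-> cmeas setT (fun x => if x \in D then f x else 0).
Proof.
move=> mD; rewrite /cmeas !(measurable_restrictT _ mD).
rewrite (_ : (_ \_ D) = (fun x => Re (if x \in D then f x else 0))); last first.
  by apply/funext => x/=; rewrite patchE; case: ifP.
rewrite (_ : (_ \_ D) = (fun x => Im (if x \in D then f x else 0)))//.
by apply/funext => x/=; rewrite patchE; case: ifP.
Qed.

Lemma cintegral_itv_cc_oo (a b : R) f : cmeas `]a, b[ f ->
  cintegral `[a, b] f = cintegral `]a, b[ f.
Proof.
move=> [m1 m2]; rewrite /cintegral /Rintegral.
by congr (fine _ +i* fine _); rewrite (@integral_itv_bndoo _ _ _ _ true false)//;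
  exact/measurable_EFinP.
Qed.

Lemma eq_ae_cintegral D f g : measurable D -> cmeas D f -> cmeas D g ->
  {ae mu, forall x, D x -> f x = g x} -> cintegral D f = cintegral D g.
Proof.
move=> mD [f1 f2] [g1 g2] fg; rewrite /cintegral /Rintegral.
by congr (fine _ +i* fine _); apply: ae_eq_integral => //;
  (try exact/measurable_EFinP); move: fg; apply: filterS => x fg Dx; rewrite /= fg.
Qed.

End ComplexIntegral.

(** * Integrals depending on a parameter, and Fubini's theorem for complex functions *)

Section ComplexFubini.
Variable R : realType.
Local Notation mu := (@lebesgue_measure R).
Local Notation TR := (measurableTypeR R).
Local Notation Re := complex.Re.
Local Notation Im := complex.Im.

(** No integrability is assumed: by Tonelli the integrals of the positive and negative parts are
    measurable in x, hence so are their difference and its [fine] value. *)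
Lemma measurable_Rintegral_param d (T : measurableType d) (f : T * TR -> R) :
  measurable_fun setT f ->
  measurable_fun setT (fun x => Rintegral mu setT (fun y => f (x, y))).
Proof.
move=> mf.
suff : measurable_fun setT (fun x => \int[mu]_y (f (x, y))%:E)%E.
  by move=> H; apply: (@measurableT_comp _ _ _ _ _ _ (@fine R)).
under eq_fun do rewrite integralE.
apply: emeasurable_funB.
- pose h := (EFin \o f)^\+%E.
  have mh : measurable_fun setT h by apply: measurable_funepos; exact/measurable_EFinP.
  have h0 z : (0 <= h z)%E by exact: funepos_ge0.
  have H := @measurable_fun_fubini_tonelli_F _ _ T TR R mu h mh h0.
  rewrite (_ : (fun x : T => _) = fubini_F mu h); first exact: H.
  by apply/funext => x; apply: eq_integral => y _; rewrite /h !(funeposE,funenegE).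
- pose h := (EFin \o f)^\-%E.
  have mh : measurable_fun setT h by apply: measurable_funeneg; exact/measurable_EFinP.
  have h0 z : (0 <= h z)%E by exact: funeneg_ge0.
  have H := @measurable_fun_fubini_tonelli_F _ _ T TR R mu h mh h0.
  rewrite (_ : (fun x : T => _) = fubini_F mu h); first exact: H.
  by apply/funext => x; apply: eq_integral => y _; rewrite /h !(funeposE,funenegE).
Qed.

Lemma cmeas_cintegral_param d (T : measurableType d) (f : T * TR -> R[i]) :
  cmeas setT f -> cmeas setT (fun x => cintegral setT (fun y => f (x, y))).
Proof.
move=> [m1 m2]; split.
  exact: (measurable_Rintegral_param m1).
exact: (measurable_Rintegral_param m2).
Qed.

Lemma integrable_prod_bound (f : TR * TR -> R) (a b : TR -> R) :
  measurable_fun setT f ->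
  mu.-integrable setT (EFin \o a) -> mu.-integrable setT (EFin \o b) ->
  (forall x y, `|f (x, y)| <= a x * b y) ->
  (mu \x mu)%E.-integrable setT (EFin \o f).
Proof.
move=> mf ia ib fab; apply/integrable12ltyP; first exact/measurable_EFinP.
have ma : measurable_fun setT a by apply/measurable_EFinP; exact: (measurable_int _ ia).
have mb : measurable_fun setT b by apply/measurable_EFinP; exact: (measurable_int _ ib).
have mm : measurable_fun setT (fun z : TR * TR => `|a z.1| * `|b z.2|).
  by apply: measurable_funM; apply: measurableT_comp => //; exact: measurableT_comp.
apply: (@le_lt_trans _ _ (\int[mu]_x \int[mu]_y (`|a x| * `|b y|)%:E)%E).
  apply: ge0_le_integral => //.
  - by move=> x _; apply: integral_ge0 => y _.
  - apply: (measurable_fun_fubini_tonelli_F (fun z => `|(f z)%:E|%E)) => //.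
    by apply: measurableT_comp => //; exact/measurable_EFinP.
  - apply: (measurable_fun_fubini_tonelli_F (fun z => (`|a z.1| * `|b z.2|)%:E)) => //.
    exact/measurable_EFinP.
  move=> x _; apply: ge0_le_integral => //.
  - apply/measurable_EFinP; apply: measurableT_comp => //.
    by apply: (@measurableT_comp _ _ _ _ _ _ f) => //; exact: measurable_pair1.
  - apply/measurable_EFinP; apply: measurable_funM => //.
    exact: measurableT_comp.
  - by move=> y _ /=; rewrite lee_fin (le_trans (fab _ _))// -normrM ler_norm.
move: ia ib => /integrableP[_ ia] /integrableP[_ ib].
rewrite (_ : (\int[mu]_x _)%E = (\int[mu]_x `|a x|%:E * \int[mu]_y `|b y|%:E)%E).
  by apply: lte_mul_pinfty => //; [exact: integral_ge0|
     rewrite ge0_fin_numE//; exact: integral_ge0].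
have I x : (\int[mu]_y (`|a x| * `|b y|)%:E = `|a x|%:E * \int[mu]_y `|b y|%:E)%E.
  under eq_integral do rewrite EFinM.
  rewrite ge0_integralZl//.
  by apply/measurable_EFinP; exact: measurableT_comp.
under eq_integral do rewrite I.
rewrite ge0_integralZr//; first by apply/measurable_EFinP; exact: measurableT_comp.
exact: integral_ge0.
Qed.

(** The product majorant gives more than integrability on the plane: every section, not only almost
    every one, is integrable, so that the real-valued inner integrals agree with the extended
    ones. *)
Lemma cFubini (f : TR * TR -> R[i]) (a b : TR -> R) : cmeas setT f ->
  mu.-integrable setT (EFin \o a) -> mu.-integrable setT (EFin \o b) ->
  (forall x y, cmod (f (x, y)) <= a x * b y) ->
  cintegral setT (fun x => cintegral setT (fun y => f (x, y))) =
  cintegral setT (fun y => cintegral setT (fun x => f (x, y))).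
Proof.
move=> [m1 m2] ia ib fab.
have F (g : TR * TR -> R) : measurable_fun setT g ->
    (forall x y, `|g (x, y)| <= cmod (f (x, y))) ->
    Rintegral mu setT (fun x => Rintegral mu setT (fun y => g (x, y))) =
    Rintegral mu setT (fun y => Rintegral mu setT (fun x => g (x, y))).
  move=> mg gf.
  have ig : (mu \x mu)%E.-integrable setT (EFin \o g).
    by apply: integrable_prod_bound mg ia ib _ => x y; rewrite (le_trans (gf _ _)).
  have gab x y : `|g (x, y)| <= a x * b y by rewrite (le_trans (gf _ _)).
  rewrite /Rintegral; congr fine.
  transitivity (\int[mu]_x \int[mu]_y (EFin \o g) (x, y))%E.
    apply: eq_integral => x _; rewrite fineK//.
    apply: integrable_fin_num => //=.
    apply: (le_integrable _ _ _ (integrableZl _ (a x) ib)) => //=.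
      apply/measurable_EFinP.
      by apply: (@measurableT_comp _ _ _ _ _ _ g) => //; exact: measurable_pair1.
    by move=> y _; rewrite lee_fin (le_trans (gab _ _))// ler_norm.
  rewrite Fubini//.
  apply: eq_integral => y _; rewrite fineK//.
  apply: integrable_fin_num => //=.
  apply: (le_integrable _ _ _ (integrableZl _ (b y) ia)) => //=.
    apply/measurable_EFinP.
    by apply: (@measurableT_comp _ _ _ _ _ _ g) => //; exact: measurable_pair2.
  by move=> x _; rewrite lee_fin (le_trans (gab _ _))// mulrC ler_norm.
rewrite /cintegral; apply: complex_ext => /=.
  by apply: (F (fun z => Re (f z))) => // x y; exact: cmod_ge_Re.
by apply: (F (fun z => Im (f z))) => // x y; exact: cmod_ge_Im.
Qed.

End ComplexFubini.

(** * The functions s_p *)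

Section ComplexDerivative.
Variable R : realType.
Implicit Types (f g : R -> R[i]) (z c : R[i]).
Local Notation Re := complex.Re.
Local Notation Im := complex.Im.

Definition cderive f f' := forall x : R,
  is_derive x 1 (fun y => Re (f y)) (Re (f' x)) /\
  is_derive x 1 (fun y => Im (f y)) (Im (f' x)).

Lemma cderive_cst c : cderive (fun=> c) (fun=> 0).
Proof. by move=> x; split => /=; exact: is_derive_cst. Qed.

Lemma cderive_real (f f' : R -> R) : (forall x : R, is_derive x 1 f (f' x)) ->
  cderive (fun x => (f x)%:C) (fun x => (f' x)%:C).
Proof. by move=> df x; split => /=; [exact: df|exact: is_derive_cst]. Qed.

Lemma cderiveD f f' g g' : cderive f f' -> cderive g g' ->
  cderive (fun x => f x + g x) (fun x => f' x + g' x).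
Proof.
move=> df dg x; have [f1 f2] := df x; have [g1 g2] := dg x.
rewrite ReD ImD; split.
  by under eq_fun do rewrite ReD; exact: is_deriveD.
by under eq_fun do rewrite ImD; exact: is_deriveD.
Qed.

Lemma cderiveZ c f f' : cderive f f' ->
  cderive (fun x => c * f x) (fun x => c * f' x).
Proof.
move=> df x; have [f1 f2] := df x.
rewrite ReM ImM; split.
  under eq_fun do rewrite ReM.
  by apply: is_deriveB; exact: is_deriveZ.
under eq_fun do rewrite ImM.
by apply: is_deriveD; exact: is_deriveZ.
Qed.

Lemma eq_cderive f f' g g' : f =1 g -> f' =1 g' -> cderive f f' -> cderive g g'.
Proof. by move=> /funext <- /funext <-. Qed.

Lemma cderiveB f f' g g' : cderive f f' -> cderive g g' ->
  cderive (fun x => f x - g x) (fun x => f' x - g' x).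
Proof.
move=> df dg; have := cderiveD df (cderiveZ (-1) dg).
by apply: eq_cderive => x; rewrite mulN1r.
Qed.

Lemma cderive_cexp z :
  cderive (fun x => cexp (z * x%:C)) (fun x => z * cexp (z * x%:C)).
Proof.
case: z => a b x.
have E y : cexp ((a +i* b) * y%:C) =
    (expR (a * y) * cos (b * y)) +i* (expR (a * y) * sin (b * y)).
  by apply: complex_ext; rewrite /cexp !ReImE/= ?ReImE/= !(mulr0, subr0, add0r, mul0r, addr0).
split; under eq_fun do rewrite E/=.
  rewrite ReM E [Re (a +i* b)]/= [Im (a +i* b)]/=.
  rewrite [Re (_ +i* _)]/= [Im (_ +i* _)]/=.
  by apply: is_derive_eq; rewrite /GRing.scale/=; ring.
rewrite ImM E [Re (a +i* b)]/= [Im (a +i* b)]/=.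
rewrite [Re (_ +i* _)]/= [Im (_ +i* _)]/=.
by apply: is_derive_eq; rewrite /GRing.scale/=; ring.
Qed.

(** The mean value theorem holds for real functions only; it is applied to the two components
    separately, hence the factor 2. *)
Lemma cderive_le f f' (a b C : R) : cderive f f' ->
  (forall y, Num.min a b <= y <= Num.max a b -> cmod (f' y) <= C) ->
  cmod (f b - f a) <= 2 * C * `|b - a|.
Proof.
move=> df fC.
have M (h h' : R -> R) : (forall x : R, is_derive x 1 h (h' x)) ->
    (forall y, Num.min a b <= y <= Num.max a b -> `|h' y| <= C) ->
    `|h b - h a| <= C * `|b - a|.
  move=> dh hC.
  have ct x y : {within `[x, y], continuous h}.
    by apply: derivable_within_continuous => u _; case: (dh u).
  have [ab|ba] := leP a b.
    have [c cab ->] := MVT_segment ab (fun x _ => dh x) (ct a b).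
    rewrite normrM ler_wpM2r// hC// (min_idPl ab) (max_idPr ab).
    by rewrite in_itv/= in cab.
  have [c cab] := MVT_segment (ltW ba) (fun x _ => dh x) (ct b a).
  rewrite distrC [`|b - a|]distrC => ->.
  rewrite normrM ler_wpM2r// hC// (min_idPr (ltW ba)) (max_idPl (ltW ba)).
  by rewrite in_itv/= in cab.
have h1 := M _ _ (fun x => (df x).1) (fun y yab => le_trans (cmod_ge_Re _) (fC y yab)).
have h2 := M _ _ (fun x => (df x).2) (fun y yab => le_trans (cmod_ge_Im _) (fC y yab)).
rewrite (le_trans (cmod_le_ReIm _))// ReD ImD ReN ImN.
by rewrite (le_trans (lerD h1 h2))// -mulrA mulr_natl mulr2n.
Qed.

(** [cderive_le] is applied to f minus the linear function of slope f'(a), whose derivative is in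
    turn estimated by [cderive_le]; hence 4 = 2 * 2. *)
Lemma cderive_taylor f f' f'' (a b C : R) : cderive f f' -> cderive f' f'' ->
  (forall y, Num.min a b <= y <= Num.max a b -> cmod (f'' y) <= C) ->
  cmod (f b - f a - (b - a)%:C * f' a) <= 4 * C * `|b - a| ^+ 2.
Proof.
move=> df df' fC.
have d : cderive (fun y => f y - f' a * y%:C) (fun y => f' y - f' a * 1%:C).
  apply: cderiveB => //; apply: cderiveZ; exact: (@cderive_real id (fun=> 1)).
have C0 : 0 <= C.
  by rewrite (le_trans (cmod_ge0 (f'' a)))// fC// ge_min lexx le_max lexx.
rewrite (_ : f b - _ - _ = (f b - f' a * b%:C) - (f a - f' a * a%:C)); last first.
  by rewrite rmorphB/=; ring.
rewrite (le_trans (@cderive_le _ _ a b (2 * C * `|b - a|) d _))//; last first.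
  by rewrite le_eqVlt; apply/orP; left; apply/eqP; ring.
move=> y yab; rewrite mulr1.
rewrite (le_trans (@cderive_le _ _ a y C df' _))//.
  move=> t ty; apply: fC.
  by move: yab ty; rewrite !(ge_min, le_max, le_min, ge_max); lra.
rewrite ler_wpM2l ?mulr_ge0//.
move: yab; have [ab|ba] := leP a b => /andP[ay yb].
  by rewrite !ger0_norm ?subr_ge0// lerD2r.
by rewrite !ler0_norm ?subr_le0 ?(ltW ba)// lerN2 lerD2r.
Qed.

Lemma cderive_bounded f f' (L : R) : 0 <= L -> cderive f f' ->
  exists2 C, 0 <= C & forall y, `|y| <= L -> cmod (f y) <= C.
Proof.
move=> L0 df.
have M (h h' : R -> R) : (forall x : R, is_derive x 1 h (h' x)) ->
    exists C, forall y, `|y| <= L -> `|h y| <= C.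
  move=> dh.
  have ct : {within `[-L, L], continuous (fun x => `|h x|)}.
    apply: continuous_subspaceT => x.
    apply: continuous_comp; last exact: norm_continuous.
    apply: differentiable_continuous; apply/derivable1_diffP.
    by case: (dh x).
  have [|c _ hc] := EVT_max _ ct; first by lra.
  by exists `|h c| => y yL; apply: hc; rewrite in_itv/= -ler_norml.
have [C1 h1] := M _ _ (fun x => (df x).1).
have [C2 h2] := M _ _ (fun x => (df x).2).
exists (`|C1| + `|C2|); first by rewrite addr_ge0.
move=> y yL; rewrite (le_trans (cmod_le_ReIm _))// lerD//.
  by rewrite (le_trans (h1 _ yL))// ler_norm.
by rewrite (le_trans (h2 _ yL))// ler_norm.
Qed.

Lemma cderive_cmeas f f' : cderive f f' -> cmeas setT f.
Proof.
have M (h h' : R -> R) : (forall x : R, is_derive x 1 h (h' x)) ->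
    measurable_fun setT h.
  move=> dh; apply: continuous_measurable_fun => x.
  apply: differentiable_continuous; apply/derivable1_diffP.
  by case: (dh x).
by move=> df; split; [apply: M => x; exact: (df x).1|apply: M => x; exact: (df x).2].
Qed.

End ComplexDerivative.

(** * The functions s_p(w x)/w^p: derivatives, values at 0, bounds on [-l,l] *)

Section CubicKernels.
Variable R : realType.
Variable w : R[i].

Lemma zeta_mul (k : nat) : (1 <= k < 4)%N -> zeta R k ^+ 3 = 1.
Proof.
have s3 : (Num.sqrt (3 : R)) ^+ 2 = 3 by rewrite sqr_sqrtr.
have c3 : (Num.sqrt (3 : R))%:C ^+ 2 = 3 :> R[i] by rewrite -rmorphXn/= s3 rmorph_nat.
have i2 := sqr_i R.
case: k => [|[|[|[|//]]]]//= _; first by rewrite expr1n.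
- set s := (Num.sqrt 3)%:C in c3 *.
  have -> : (2^-1 * (-1 + 'i%C * s)) ^+ 3 = (2^-1) ^+ 3 * (-1 + 3 * ('i%C * s) - 3 * ('i%C ^+ 2 * s ^+ 2) + 'i%C ^+ 2 * s ^+ 2 * ('i%C * s)) by ring.
  by rewrite c3 i2; field.
- set s := (Num.sqrt 3)%:C in c3 *.
  have -> : (2^-1 * (-1 - 'i%C * s)) ^+ 3 = (2^-1) ^+ 3 * (-1 - 3 * ('i%C * s) - 3 * ('i%C ^+ 2 * s ^+ 2) - 'i%C ^+ 2 * s ^+ 2 * ('i%C * s)) by ring.
  by rewrite c3 i2; field.
Qed.

Lemma zeta_sum : zeta R 1 + zeta R 2 + zeta R 3 = 0.
Proof. by rewrite /zeta; field. Qed.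

Lemma zeta2_sqr : zeta R 2 ^+ 2 = zeta R 3.
Proof.
have c3 : (Num.sqrt (3 : R))%:C ^+ 2 = 3 :> R[i].
  by rewrite -rmorphXn/= sqr_sqrtr// rmorph_nat.
have i2 := sqr_i R; rewrite /zeta.
set s := (Num.sqrt 3)%:C in c3 *.
have -> : (2^-1 * (-1 + 'i%C * s)) ^+ 2 = (2^-1) ^+ 2 * (1 - 2 * ('i%C * s) + 'i%C ^+ 2 * s ^+ 2) by ring.
by rewrite c3 i2; field.
Qed.

Lemma zeta_neq0 (k : nat) : (1 <= k < 4)%N -> zeta R k != 0.
Proof.
move=> /zeta_mul z3; apply/eqP => z0; move: z3; rewrite z0 expr0n/= => /eqP.
by rewrite eq_sym oner_eq0.
Qed.

Lemma s_E (p : nat) (z : R[i]) : s_ p z = 3^-1 * (cexp z +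
  zeta R 2 ^- p * cexp (z * zeta R 2) + zeta R 3 ^- p * cexp (z * zeta R 3)).
Proof.
have z1 : zeta R 1 = 1 by [].
rewrite /s_ (@big_ltn _ _ _ 1 4 _ isT) (@big_ltn _ _ _ 2 4 _ isT).
rewrite (@big_ltn _ _ _ 3 4 _ isT) (@big_geq _ _ _ 4 4 _ _ isT).
by rewrite z1 expr1n invr1 mul1r mulr1 addr0 addrA.
Qed.

Lemma s_quotE (p : nat) (r : R) : w != 0 -> s_quot p w r =
  3^-1 * w ^- p * (cexp (w * r%:C) + zeta R 2 ^- p * cexp (w * zeta R 2 * r%:C)
   + zeta R 3 ^- p * cexp (w * zeta R 3 * r%:C)).
Proof.
move=> w0; rewrite /s_quot (negbTE w0) s_E.
have e z : w * r%:C * z = w * z * r%:C by rewrite mulrAC.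
by rewrite !e mulrAC.
Qed.

Lemma cexp0 : cexp (0 : R[i]) = 1.
Proof.
apply: complex_ext; rewrite /cexp !ReImE/= expR0 cos0 sin0; lra.
Qed.

Let s_quot_derive_gen (p : nat) (c1 c2 c3 : R[i]) : w != 0 ->
  cderive (fun r => 3^-1 * w ^- p * (c1 * cexp (w * r%:C)
     + c2 * cexp (w * zeta R 2 * r%:C) + c3 * cexp (w * zeta R 3 * r%:C)))
   (fun r => 3^-1 * w ^- p * (c1 * (w * cexp (w * r%:C))
     + c2 * (w * zeta R 2 * cexp (w * zeta R 2 * r%:C))
     + c3 * (w * zeta R 3 * cexp (w * zeta R 3 * r%:C)))).
Proof.
move=> w0; apply: cderiveZ.
by apply: cderiveD; [apply: cderiveD|]; apply: cderiveZ; exact: cderive_cexp.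
Qed.

(** Differentiation multiplies the k-th exponential by w zeta_k, which cancels one factor of the
    denominators w^(p+1) and zeta_k^(p+1). *)
Lemma s_quot_deriveS (p : nat) : cderive (s_quot p.+1 w) (s_quot p w).
Proof.
have [w0|w0] := eqVneq w 0.
  rewrite w0.
  suff : cderive (fun r : R => (r ^+ p.+1 / (p.+1)`!%:R)%:C) (fun r : R => (r ^+ p / (p)`!%:R)%:C).
    by rewrite /s_quot eqxx.
  apply: cderive_real => x.
  have H := is_deriveZ ((p.+1)`!%:R^-1) (is_deriveX p.+1 (is_derive_id x (1 : R))).
  rewrite (_ : (fun r => _) = (p.+1)`!%:R^-1 \*: (id ^+ p.+1)); last first.
    by apply/funext => r; rewrite mulrC/= exprfctE.
  apply: (is_derive_eq H).
  rewrite /GRing.scale/= factS natrM invfM mulr1.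
  by rewrite mulrACA mulVf ?pnatr_eq0// mul1r mulrC.
have := s_quot_derive_gen p.+1 1 (zeta R 2 ^- p.+1) (zeta R 3 ^- p.+1) w0.
have z2 : zeta R 2 != 0 by exact: zeta_neq0.
have z3 : zeta R 3 != 0 by exact: zeta_neq0.
apply: eq_cderive => r; rewrite s_quotE// !mul1r//.
by rewrite !exprS; field; rewrite ?expf_neq0// w0 z2 z3.
Qed.

(** The cycle closes because zeta_k^3 = 1: the factor zeta_k produced by differentiation equals
    zeta_k^-2, the coefficient belonging to p = 2. *)
Lemma s_quot_derive0 : cderive (s_quot 0 w) (fun r => w ^+ 3 * s_quot 2 w r).
Proof.
have [w0|w0] := eqVneq w 0.
  rewrite w0 expr0n/= /s_quot eqxx.
  have := cderive_cst (1%:C : R[i]); apply: eq_cderive => r.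
    by rewrite expr0 fact0 divr1.
  by rewrite mul0r.
have := s_quot_derive_gen 0 1 1 1 w0.
have z2 : zeta R 2 != 0 by exact: zeta_neq0.
have z3 : zeta R 3 != 0 by exact: zeta_neq0.
have z23 := @zeta_mul 2 isT.
have z33 := @zeta_mul 3 isT.
have e2 : zeta R 2 ^- 2 = zeta R 2.
  by apply: (mulfI (expf_neq0 2 z2)); rewrite mulfV ?expf_neq0// -exprSr z23.
have e3 : zeta R 3 ^- 2 = zeta R 3.
  by apply: (mulfI (expf_neq0 2 z3)); rewrite mulfV ?expf_neq0// -exprSr z33.
apply: eq_cderive => r; rewrite s_quotE// ?expr0 ?invr1 ?mul1r//.
by rewrite e2 e3; field; rewrite w0.
Qed.

(** For p = 1, 2 the sum of zeta_k^-p over the three cube roots of unity vanishes. *)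
Lemma s_quot0 (p : nat) : (p < 3)%N -> s_quot p w 0 = (p == 0%N)%:R.
Proof.
have [w0|w0] := eqVneq w 0.
  by rewrite /s_quot w0 eqxx; case: p => [|p] _; rewrite ?expr0 ?fact0 ?divr1// exprS !mul0r.
have z23 := @zeta_mul 2 isT.
have z2 : zeta R 2 != 0 by exact: zeta_neq0.
have z3 : zeta R 3 != 0 by exact: zeta_neq0.
have zi : 1 + zeta R 2 ^- 1 + zeta R 3 ^- 1 = 0.
  have -> : zeta R 2 ^- 1 = zeta R 3.
    by apply: (mulfI z2); rewrite mulfV// -zeta2_sqr -exprS.
  have -> : zeta R 3 ^- 1 = zeta R 2.
    by apply: (mulfI z3); rewrite mulfV// -zeta2_sqr -exprSr.
  by rewrite addrAC -zeta_sum {4}/zeta.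
have zi2 : 1 + zeta R 2 ^- 2 + zeta R 3 ^- 2 = 0.
  have -> : zeta R 2 ^- 2 = zeta R 2.
    by apply: (mulfI (expf_neq0 2 z2)); rewrite mulfV ?expf_neq0// -exprSr z23.
  have -> : zeta R 3 ^- 2 = zeta R 3.
    by apply: (mulfI (expf_neq0 2 z3)); rewrite mulfV ?expf_neq0// -exprSr zeta_mul.
  by rewrite -zeta_sum {4}/zeta.
case: p => [|[|[|//]]] _; rewrite s_quotE// !mulr0 cexp0 !mulr1 /=.
- by rewrite !expr0 invr1; field.
- by rewrite !expr1 zi mulr0.
- by rewrite zi2 mulr0.
Qed.

Definition s_quot_deriv (p : nat) (r : R) : R[i] :=
  if p is p'.+1 then s_quot p' w r else w ^+ 3 * s_quot 2 w r.

Lemma s_quot_derive (p : nat) : cderive (s_quot p w) (s_quot_deriv p).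
Proof. by case: p => [|p]; [exact: s_quot_derive0|exact: s_quot_deriveS]. Qed.

Lemma s_quot_cmeas (p : nat) : cmeas setT (s_quot p w).
Proof. exact: cderive_cmeas (s_quot_derive p). Qed.

End CubicKernels.

Section CubicKernelBounds.
Variables (R : realType) (w : R[i]) (l : R).
Hypothesis l0 : 0 <= l.

(** One constant serves all later estimates. The last one compares k_2 with its form r^2/2 at w = 0:
    the difference of the two functions for p = 0 has derivative w^3 k_2, and the differences for p
    = 0, 1, 2 all vanish at 0, so three mean value estimates give a cubic bound. *)
Lemma s_quot_bounds : exists2 C : R, 0 <= C & [/\
  forall p r, (p < 3)%N -> `|r| <= l -> cmod (s_quot p w r) <= C,
  forall p r, (p < 3)%N -> `|r| <= l -> cmod (s_quot_deriv w p r) <= C,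
  forall p a b, (p < 3)%N -> `|a| <= l -> `|b| <= l ->
    cmod (s_quot p w b - s_quot p w a - (b - a)%:C * s_quot_deriv w p a)
      <= C * `|b - a| ^+ 2 &
  forall r, `|r| <= l ->
    cmod (s_quot 2 w r - (r ^+ 2 / 2)%:C) <= C * `|r| ^+ 3].
Proof.
have [B0 B00 hB0] := cderive_bounded l0 (s_quot_derive w 0).
have [B1 B10 hB1] := cderive_bounded l0 (s_quot_derive w 1).
have [B2 B20 hB2] := cderive_bounded l0 (s_quot_derive w 2).
pose W := cmod (w ^+ 3).
have W0 : 0 <= W by exact: cmod_ge0.
(* The factor 1 + |w|^3 makes B a bound for the functions as well as for their multiples by w^3. *)
pose B := (1 + W) * (B0 + B1 + B2).
have hB p r : (p < 3)%N -> `|r| <= l -> (1 + W) * cmod (s_quot p w r) <= B.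
  move=> p3 rl; rewrite ler_wpM2l ?addr_ge0//.
  case: p p3 => [|[|[|//]]] _.
  - by rewrite (le_trans (hB0 _ rl))// -addrA lerDl addr_ge0.
  - by rewrite (le_trans (hB1 _ rl))// addrAC lerDr addr_ge0.
  - by rewrite (le_trans (hB2 _ rl))// lerDr addr_ge0.
have hB1' p r : (p < 3)%N -> `|r| <= l -> cmod (s_quot p w r) <= B.
  move=> p3 rl; apply: le_trans (hB p r p3 rl).
  by rewrite ler_peMl ?cmod_ge0// lerDl.
have hBW p r : (p < 3)%N -> `|r| <= l -> cmod (w ^+ 3 * s_quot p w r) <= B.
  move=> p3 rl; apply: le_trans (hB p r p3 rl).
  by rewrite cmodM ler_wpM2r ?cmod_ge0// lerDr.
have hBd p r : (p < 3)%N -> `|r| <= l -> cmod (s_quot_deriv w p r) <= B.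
  by case: p => [|p] p3 rl /=; [exact: hBW|apply: hB1' => //; exact: ltnW].
have B0' : 0 <= B.
  by rewrite (le_trans _ (hB1' 0%N 0 isT _)) ?cmod_ge0 ?normr0.
clearbody B.
have btw (a b y : R) : `|a| <= l -> `|b| <= l ->
    Num.min a b <= y <= Num.max a b -> `|y| <= l.
  rewrite !ler_norml => /andP[a1 a2] /andP[b1 b2] /andP[].
  by rewrite !(ge_min, le_max) => /orP[?|?] /orP[?|?]; apply/andP; split; lra.
(* 8 = 2^3: one factor 2 for each of the three mean value estimates behind the last claim. *)
exists (8 * B); first by rewrite mulr_ge0.
have B8 : B <= 8 * B by rewrite ler_peMl//; lra.
have B48 : 4 * B <= 8 * B by rewrite ler_wpM2r//; lra.
split.
- by move=> p r p3 rl; rewrite (le_trans (hB1' p r p3 rl)).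
- by move=> p r p3 rl; rewrite (le_trans (hBd p r p3 rl)).
- move=> p a b p3 al bl.
  apply: (@le_trans _ _ (4 * B * `|b - a| ^+ 2)); last by rewrite ler_wpM2r// exprn_ge0.
  case: p p3 => [|[|[|//]]] _.
  + apply: cderive_taylor; [exact: s_quot_derive|
      exact: (cderiveZ (w ^+ 3) (s_quot_derive w 2))|].
    by move=> y /(btw _ _ _ al bl) yl; exact: hBW.
  + apply: cderive_taylor; [exact: s_quot_derive|exact: (s_quot_derive w 0)|].
    by move=> y /(btw _ _ _ al bl) yl; exact: hBW.
  + apply: cderive_taylor; [exact: s_quot_derive|exact: (s_quot_derive w 1)|].
    by move=> y /(btw _ _ _ al bl) yl; exact: hB1'.
- have z0 : `|0 : R| <= l by rewrite normr0.
  have btw0 (r y : R) : Num.min 0 r <= y <= Num.max 0 r -> `|y| <= `|r|.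
    have [r0|r0] := leP 0 r => /andP[? ?].
      by rewrite !ger0_norm.
    by rewrite !ler0_norm// ?lerN2// ltW.
  have m0 p : (p < 3)%N -> s_quot p w 0 - s_quot p 0 0 = 0.
    by move=> p3; rewrite !s_quot0// subrr.
  have d0 : cderive (fun r => s_quot 0 w r - s_quot 0 0 r)
      (fun r => w ^+ 3 * s_quot 2 w r - 0 ^+ 3 * s_quot 2 0 r).
    by apply: cderiveB; exact: s_quot_derive0.
  have d1 : cderive (fun r => s_quot 1 w r - s_quot 1 0 r)
      (fun r => s_quot 0 w r - s_quot 0 0 r).
    by apply: cderiveB; exact: s_quot_deriveS.
  have d2 : cderive (fun r => s_quot 2 w r - s_quot 2 0 r)
      (fun r => s_quot 1 w r - s_quot 1 0 r).
    by apply: cderiveB; exact: s_quot_deriveS.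
  move=> r rl.
  have h0 y : `|y| <= `|r| -> cmod (s_quot 0 w y - s_quot 0 0 y) <= 2 * B * `|r|.
    move=> yr; have yl : `|y| <= l by rewrite (le_trans yr).
    have := cderive_le (a := 0) (b := y) (C := B) d0; rewrite m0// !subr0.
    move=> /(_ _)/le_trans-> //.
      by move=> t ty; rewrite expr0n/= mul0r subr0 hBW//; exact: btw ty.
    by rewrite ler_wpM2l// mulr_ge0.
  have h1 y : `|y| <= `|r| -> cmod (s_quot 1 w y - s_quot 1 0 y) <= 4 * B * `|r| ^+ 2.
    move=> yr; have := cderive_le (a := 0) (b := y) (C := 2 * B * `|r|) d1.
    rewrite m0// !subr0 => /(_ _)/le_trans-> //.
      by move=> t /btw0 ty; apply: h0; rewrite (le_trans ty).
    rewrite (_ : 4 * B * _ = 2 * (2 * B * `|r|) * `|r|); last by ring.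
    by rewrite ler_wpM2l// !mulr_ge0.
  have := cderive_le (a := 0) (b := r) (C := 4 * B * `|r| ^+ 2) d2.
  rewrite m0// !subr0 (_ : s_quot 2 0 r = (r ^+ 2 / 2)%:C); last first.
    by rewrite /s_quot eqxx.
  move=> /(_ _)/le_trans-> //; first by move=> t /btw0 ty; exact: h1.
  by rewrite le_eqVlt; apply/orP; left; apply/eqP; ring.
Qed.

End CubicKernelBounds.

(** * Volterra kernels *)

(** One term of the binomial expansion supplies the factor n+1; the term b^(n+1) is added to make
    the induction close. It is used squared, with a = x-s and b = s-t. *)
Lemma mul_exprn_le (R : realDomainType) (a b : R) n : 0 <= a -> 0 <= b ->
  n.+1%:R * (a * b ^+ n) <= (a + b) ^+ n.+1.
Proof.
move=> a0 b0; suff : n.+1%:R * (a * b ^+ n) + b ^+ n.+1 <= (a + b) ^+ n.+1.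
  by apply: le_trans; rewrite lerDl exprn_ge0.
elim: n => [|n IH]; first by rewrite expr0 !mulr1 mul1r !expr1.
rewrite [leRHS]exprS (le_trans _ (ler_wpM2l (addr_ge0 a0 b0) IH))//.
have bn : 0 <= a * (a * b ^+ n) by rewrite !mulr_ge0// exprn_ge0.
have : 0 <= n.+1%:R * (a * (a * b ^+ n)) by rewrite mulr_ge0.
rewrite -[n.+2%:R]natr1 !exprS; nra.
Qed.

(** * Complex series dominated by an exponential series *)

Section ComplexSeries.
Variables (R : realType) (u : nat -> R[i]) (A M : R).
Hypotheses (A0 : 0 <= A) (M0 : 0 <= M).
Hypothesis uM : forall n, cmod (u n) <= A * exp_coeff M n.
Local Notation S := (fun m => \sum_(0 <= n < m) u n).
Local Notation Re := complex.Re.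
Local Notation Im := complex.Im.

Lemma series_exp_le m : series (exp_coeff M) m <= expR M.
Proof.
rewrite /expR; apply: nondecreasing_cvgn_le; last exact: is_cvg_series_exp_coeff.
apply: nondecreasing_series => n _ _; exact: exp_coeff_ge0.
Qed.

Let cmod_tail m p : (m <= p)%N ->
  cmod (S p - S m) <= A * (expR M - series (exp_coeff M) m).
Proof.
move=> mp /=; rewrite (@big_cat_nat _ _ _ m 0 p)//= addrAC subrr add0r.
apply: (le_trans (cmod_sum _ _ _)).
apply: (@le_trans _ _ (\sum_(m <= n < p) A * exp_coeff M n)).
  by apply: ler_sum => n _; exact: uM.
rewrite -mulr_sumr ler_wpM2l// lerBrDl.
apply: le_trans (series_exp_le p).
by rewrite /series/= [leRHS](@big_cat_nat _ _ _ m 0 p).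
Qed.

Let real_series_cvg (v : nat -> R) : (forall n, `|v n| <= cmod (u n)) ->
  cvgn (series v).
Proof.
move=> vu; apply: normed_cvg.
apply: (@series_le_cvg _ _ (A *: exp_coeff M)) => [n|n|n|].
- exact: normr_ge0.
- by rewrite /= mulr_ge0// exp_coeff_ge0.
- by rewrite /= (le_trans (vu n)).
- by apply: is_cvg_seriesZ; exact: is_cvg_series_exp_coeff.
Qed.

(** Measuring the remainder against that of the exponential series makes the convergence of N
    uniform on the triangle and lets the integral equation pass to the limit. *)
Lemma cseries_cvg : exists2 z : R[i]^o,
  (S : nat -> R[i]^o) @ \oo --> z &
  forall m, cmod (z - S m) <= A * (expR M - series (exp_coeff M) m).
Proof.
have cr := real_series_cvg (fun n => cmod_ge_Re (u n)).
have ci := real_series_cvg (fun n => cmod_ge_Im (u n)).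
pose z : R[i]^o := limn (series (fun n => Re (u n))) +i* limn (series (fun n => Im (u n))).
have Sz : (S : nat -> R[i]^o) @ \oo --> z.
  apply: cvg_ReIm.
    rewrite (_ : (fun t => _) = series (fun n => Re (u n)))//.
    by apply/funext => m; rewrite /series/=; apply: (big_morph _ (@ReD R)).
  rewrite (_ : (fun t => _) = series (fun n => Im (u n)))//.
  by apply/funext => m; rewrite /series/=; apply: (big_morph _ (@ImD R)).
exists z => // m; apply/ler_addgt0Pl => e e0.
have /cvg_cmodP/(_ _ e0) Sze := Sz.
near \oo => p.
rewrite (le_trans (cmod_triangle (S p) _ _))// lerD//.
  by rewrite cmod_distC ltW//; near: p; exact: Sze.
by apply: cmod_tail; near: p; exact: nbhs_infty_ge.
Unshelve. all: by end_near. Qed.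

End ComplexSeries.

(** * The kernels K_n and N extended by zero, and their integral equation *)

Section VolterraKernels.
Variables (R : realType) (l : R) (q : R -> R) (lam : R[i]).
Local Notation mu := (@lebesgue_measure R).
Local Notation TR := (measurableTypeR R).
Hypothesis l0 : 0 < l.

(** Cut at the open interval, endpoints excluded, because square integrability of q concerns that
    interval alone. *)
Definition qcut (x : R) : R := if (0 < x) && (x < l) then q x else 0.
Definition in_tri (x t : R) : bool := [&& 0 <= t, t <= x & x <= l].
Definition Ktri n (x t : R) : R[i] := if in_tri x t then Kn q lam n x t else 0.
Definition Ntri (x t : R) : R[i] := if in_tri x t then Nker q lam x t else 0.

Hypothesis qcut_int : mu.-integrable setT (EFin \o (qcut : TR -> R)).
Variable C : R.
Hypothesis C0 : 0 <= C.
Hypothesis Ktri1_le : forall x t, cmod (Ktri 1 x t) <= C * (x - t) ^+ 2.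

Local Notation Q := (Rintegral mu setT (fun s : TR => `|qcut s|)).
Local Notation M := (C * Q * l ^+ 2).

Lemma Q_ge0 : 0 <= Q.
Proof. exact: Rintegral_ge0. Qed.

Lemma M_ge0 : 0 <= M.
Proof. by rewrite mulr_ge0 ?sqr_ge0// mulr_ge0// Q_ge0. Qed.

Lemma qcut_abs_int (A : R) :
  mu.-integrable setT (EFin \o (fun s : TR => A * `|qcut s|)).
Proof.
have := integrableZl measurableT A (integrable_norm qcut_int).
by apply: eq_integrable => // x _ /=; rewrite EFinM.
Qed.

Lemma Rintegral_qcut_abs (A : R) :
  Rintegral mu setT (fun s : TR => A * `|qcut s|) = A * Q.
Proof. by rewrite RintegralZl//; exact: integrable_norm. Qed.

Lemma qcut_cmeas : cmeas setT (fun s : TR => (qcut s)%:C).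
Proof.
by apply: cmeas_real; apply/measurable_EFinP; exact: (measurable_int _ qcut_int).
Qed.

Lemma in_triP x t : in_tri x t -> [/\ 0 <= t, t <= x, x <= l & 0 <= x - t <= l].
Proof. by move=> /and3P[t0 tx xl]; split=> //; rewrite subr_ge0 tx; lra. Qed.

Lemma in_tri_meas : measurable [set p : TR * TR | in_tri p.1 p.2].
Proof.
rewrite (_ : [set p | _] = (fun p : TR * TR => in_tri p.1 p.2) @^-1` [set true])//.
suff mt : measurable_fun setT (fun p : TR * TR => in_tri p.1 p.2).
  by rewrite -[X in measurable X]setTI; exact: mt.
have m1 : measurable_fun setT (fun p : TR * TR => p.1 : R) by exact: measurable_fst.
have m2 : measurable_fun setT (fun p : TR * TR => p.2 : R) by exact: measurable_snd.
apply: measurable_and; first exact: measurable_fun_ler.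
by apply: measurable_and; exact: measurable_fun_ler.
Qed.

Lemma Ktri1_cmeas : cmeas setT (fun p : TR * TR => Ktri 1 p.1 p.2).
Proof.
apply: cmeas_if; [exact: in_tri_meas| |exact: cmeas_cst].
apply: (cmeas_comp (f := s_quot 2 ('i%C * lam)) (h := fun p : TR * TR => p.1 - p.2)).
  exact: s_quot_cmeas.
by apply: measurable_funB; [exact: measurable_fst|exact: measurable_snd].
Qed.

(** One step of the iteration; u is a function of the first argument only, such as K_n with its
    second argument frozen. *)
Definition vstep (u : R -> R[i]) (x : R) : R[i] :=
  cintegral setT (fun s : TR => Ktri 1 x s * (qcut s)%:C * u s).

Lemma Ktri_support n x t : ~~ in_tri x t -> Ktri n x t = 0.
Proof. by rewrite /Ktri => /negbTE->. Qed.

Lemma Ktri1_diag x : Ktri 1 x x = 0.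
Proof. by apply/eqP; rewrite -cmod_le0 (le_trans (Ktri1_le _ _))// subrr expr0n/= mulr0. Qed.

Lemma Ktri1_sec_cmeas x : cmeas setT (fun s : TR => Ktri 1 x s).
Proof. by apply: (cmeas_comp (h := pair x) Ktri1_cmeas); exact: measurable_pair1. Qed.

Lemma vstep_cmeas x u : cmeas setT (u : TR -> _) ->
  cmeas setT (fun s : TR => Ktri 1 x s * (qcut s)%:C * u s).
Proof.
move=> mu_; apply: cmeasM => //; apply: cmeasM; last exact: qcut_cmeas.
exact: Ktri1_sec_cmeas.
Qed.

Lemma vstep_pt (x t s A : R) n u : 0 <= A ->
  (forall s, s < t -> u s = 0) ->
  (forall s, t <= s -> s <= l -> cmod (u s) <= A * (s - t) ^+ n.*2) ->
  cmod (Ktri 1 x s * (qcut s)%:C * u s) <=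
  C * A * (x - t) ^+ n.+1.*2 / n.+1%:R ^+ 2 * `|qcut s|.
Proof.
move=> A0 u0 uA.
have rhs0 : 0 <= C * A * (x - t) ^+ n.+1.*2 / n.+1%:R ^+ 2.
  apply: mulr_ge0; last by rewrite invr_ge0 sqr_ge0.
  apply: mulr_ge0; first exact: mulr_ge0.
  by rewrite -mul2n exprM exprn_ge0// sqr_ge0.
have [st|ts] := ltP s t; first by rewrite u0// mulr0 cmod0 mulr_ge0.
case: (boolP (in_tri x s)) => [/in_triP[s0 sx xl _]|/Ktri_support ->]; last first.
  by rewrite !mul0r cmod0 mulr_ge0.
rewrite cmodM cmodM cmodC mulrAC ler_wpM2r//.
have sl := le_trans sx xl.
apply: (le_trans (ler_pM (cmod_ge0 _) (cmod_ge0 _) (Ktri1_le _ _) (uA _ ts sl))).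
rewrite [leLHS](_ : _ = C * A * ((x - s) ^+ 2 * (s - t) ^+ n.*2)); last by ring.
rewrite -[leRHS]mulrA ler_wpM2l ?mulr_ge0//.
rewrite ler_pdivlMr ?exprn_gt0//.
have xs0 : 0 <= x - s by rewrite subr_ge0.
have st0 : 0 <= s - t by rewrite subr_ge0.
have := mul_exprn_le n xs0 st0; rewrite subrKA => h.
(* Both exponents are even, so the claim is the square of [mul_exprn_le]. *)
rewrite -!mul2n mulnC [(2 * n.+1)%N]mulnC !exprM -!exprMn.
rewrite ler_pXn2r ?nnegrE//; last 2 first.
- by rewrite !mulr_ge0// exprn_ge0.
- by rewrite exprn_ge0//; lra.
by rewrite mulrC.
Qed.

Lemma vstep_le (x t A : R) n u : 0 <= A -> cmeas setT (u : TR -> _) ->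
  (forall s, s < t -> u s = 0) ->
  (forall s, t <= s -> s <= l -> cmod (u s) <= A * (s - t) ^+ n.*2) ->
  cmod (vstep u x) <= C * Q * A * (x - t) ^+ n.+1.*2 / n.+1%:R ^+ 2.
Proof.
move=> A0 mu_ u0 uA.
have -> : C * Q * A * (x - t) ^+ n.+1.*2 / n.+1%:R ^+ 2 =
    C * A * (x - t) ^+ n.+1.*2 / n.+1%:R ^+ 2 * Q by ring.
rewrite -Rintegral_qcut_abs; apply: cmod_cintegral_le => //.
- exact: vstep_cmeas.
- exact: qcut_abs_int.
- by move=> s _; exact: vstep_pt.
Qed.

Lemma vstep_cint_bnd (x A : R) u : 0 <= A -> cmeas setT (u : TR -> _) ->
  (forall s, cmod (u s) <= A) ->
  cint setT (fun s : TR => Ktri 1 x s * (qcut s)%:C * u s).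
Proof.
move=> A0 mu_ uA.
apply: (cint_le _ (vstep_cmeas x mu_) (qcut_abs_int (C * l ^+ 2 * A))) => // s _.
rewrite cmodM cmodM cmodC mulrAC ler_wpM2r// ler_pM ?cmod_ge0//.
case: (boolP (in_tri x s)) => [/in_triP[s0 sx xl /andP[xs0 xsl]]|/Ktri_support ->]; last first.
  by rewrite cmod0 mulr_ge0// exprn_ge0// ltW.
rewrite (le_trans (Ktri1_le _ _))// ler_wpM2l// ler_pXn2r ?nnegrE//.
exact: ltW.
Qed.

Lemma qcutE s : 0 < s -> s < l -> qcut s = q s.
Proof. by rewrite /qcut => -> ->. Qed.

(* On the closed triangle the endpoints s = 0 and s = l, where [qcut] and [q]
   may differ, are harmless because K_1 and K_n vanish on the diagonal. *)
Lemma cint_K1_tri (F : R -> R -> R[i]) x t : in_tri x t ->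
  (forall t, F t t = 0) ->
  cintegral `[t, x] (fun s => K1 lam x s * (q s)%:C * F s t) =
  vstep (fun s => if in_tri s t then F s t else 0) x.
Proof.
move=> /in_triP[t0 tx xl _] F0; rewrite cintegral_mkcond; apply: eq_cintegral => s _.
case: ifPn => [|/negP].
  rewrite inE/= in_itv/= => /andP[ts sx].
  have xs_tri : in_tri x s by rewrite /in_tri sx xl (le_trans t0 ts).
  have st_tri : in_tri s t by rewrite /in_tri t0 ts (le_trans sx xl).
  rewrite st_tri.
  have [<-|ts'] := eqVneq t s; first by rewrite F0 !mulr0.
  have [->|xs'] := eqVneq x s.
    by rewrite Ktri1_diag /K1 subrr s_quot0// !mul0r.
  rewrite qcutE; last 2 first.
  - by rewrite (le_lt_trans t0)// lt_neqAle ts' ts.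
  - by rewrite (lt_le_trans _ xl)// lt_neqAle eq_sym xs' sx.
  by rewrite /Ktri xs_tri.
rewrite inE/= in_itv/= => nst.
case: ifPn => [/in_triP[_ ts sl _]|_]; last by rewrite mulr0.
rewrite /Ktri; case: ifPn => [/in_triP[_ sx _ _]|_]; last by rewrite !mul0r.
by case: nst; rewrite ts sx.
Qed.

Lemma Ktri_step_aux n x t : (forall t, Kn q lam n.+1 t t = 0) ->
  Ktri n.+2 x t = vstep (fun s => Ktri n.+1 s t) x.
Proof.
move=> Kd; case: (boolP (in_tri x t)) => [xt|xt].
  by rewrite {1}/Ktri xt [LHS]/= cint_K1_tri.
rewrite Ktri_support// /vstep cintegral0// => s _.
have [xs|xs] := boolP (in_tri x s); last by rewrite [Ktri 1 x s]Ktri_support// !mul0r.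
have [st|st] := boolP (in_tri s t); last by rewrite [Ktri _ s t]Ktri_support// !mulr0.
move/in_triP: xs => [? ? ? _]; move/in_triP: st => [? ? ? _].
by case/negP: xt; apply/and3P; split=> //; lra.
Qed.

Lemma Kn_diag n t : Kn q lam n t t = 0.
Proof.
case: n => [|[|n]]//=.
  by rewrite /K1 subrr s_quot0.
apply: complex_ext; rewrite /cintegral/= set_itv1.
  exact: Rintegral_set1.
exact: Rintegral_set1.
Qed.

Lemma Ktri_step n x t : Ktri n.+2 x t = vstep (fun s => Ktri n.+1 s t) x.
Proof. by apply: Ktri_step_aux => s; exact: Kn_diag. Qed.

Lemma vstep_param_cmeas (F : TR * TR -> R[i]) : cmeas setT F ->
  cmeas setT (fun p : TR * TR => vstep (fun s => F (s, p.2)) p.1).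
Proof.
move=> mF; rewrite /vstep.
apply: (cmeas_cintegral_param (f := fun z : (TR * TR) * TR =>
   Ktri 1 z.1.1 z.2 * (qcut z.2)%:C * F (z.2, z.1.2))).
have m11 : measurable_fun setT (fun z : (TR * TR) * TR => z.1.1).
  exact: measurableT_comp measurable_fst measurable_fst.
have m12 : measurable_fun setT (fun z : (TR * TR) * TR => z.1.2).
  exact: measurableT_comp measurable_snd measurable_fst.
have m2 : measurable_fun setT (fun z : (TR * TR) * TR => z.2) by exact: measurable_snd.
apply: cmeasM; [apply: cmeasM|].
- apply: (cmeas_comp (h := fun z : (TR * TR) * TR => (z.1.1, z.2)) Ktri1_cmeas).
  exact: measurable_fun_pair.
- exact: (cmeas_comp qcut_cmeas m2).
- apply: (cmeas_comp (h := fun z : (TR * TR) * TR => (z.2, z.1.2)) mF).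
  exact: measurable_fun_pair.
Qed.

Lemma Ktri_cmeas n : cmeas setT (fun p : TR * TR => Ktri n.+1 p.1 p.2).
Proof.
elim: n => [|n IH]; first exact: Ktri1_cmeas.
have := vstep_param_cmeas IH; apply: eq_cmeas => p _ /=.
by rewrite Ktri_step.
Qed.

Lemma Ktri_sec_cmeas n t : cmeas setT (fun s : TR => Ktri n.+1 s t).
Proof. by apply: (cmeas_comp (h := pair^~ t) (Ktri_cmeas n)); exact: measurable_pair2. Qed.

Lemma Ktri_le n x t :
  cmod (Ktri n.+1 x t) <= C * (C * Q) ^+ n / (n.+1)`!%:R ^+ 2 * (x - t) ^+ n.+1.*2.
Proof.
elim: n x t => [|n IH] x t.
  by rewrite expr0 mulr1 (_ : 1`! = 1%N)// expr1n divr1.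
have c0 : 0 <= C * (C * Q) ^+ n / (n.+1)`!%:R ^+ 2.
  by rewrite !mulr_ge0 ?invr_ge0 ?exprn_ge0// ?mulr_ge0// Q_ge0.
have := @vstep_le x t _ n.+1 (fun s => Ktri n.+1 s t) c0 (Ktri_sec_cmeas n t).
rewrite -Ktri_step => /(_ _ _)/le_trans -> //.
- by move=> s st; rewrite Ktri_support// /in_tri [t <= s]leNgt st/= andbF.
- have f0 : (n.+1)`!%:R != 0 :> R by rewrite pnatr_eq0 -lt0n fact_gt0.
  have n0 : n.+2%:R != 0 :> R by rewrite pnatr_eq0.
  have -> : (n.+2)`!%:R = n.+2%:R * (n.+1)`!%:R :> R by rewrite factS natrM.
  rewrite (exprS (C * Q) n) le_eqVlt; apply/orP; left; apply/eqP.
  by move: f0 n0; move: (n.+1)`!%:R n.+2%:R ((C * Q) ^+ n) (_ ^+ n.+2.*2) => a b c d f0 n0;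
    field; rewrite f0 n0.
Qed.

(** The bounds (x-t)^(2n) <= l^(2n) and n! <= ((n+1)!)^2 weaken [Ktri_le] to the exponential series
    at M. One factor (x-t)^2 is kept for the behaviour at the diagonal. *)
Lemma Ktri_le_exp n x t :
  cmod (Ktri n.+1 x t) <= C * (x - t) ^+ 2 * exp_coeff M n.
Proof.
case: (boolP (in_tri x t)) => [/in_triP[_ _ _ /andP[xt0 xtl]]|/Ktri_support ->]; last first.
  rewrite cmod0; apply: mulr_ge0; first by apply: mulr_ge0 => //; exact: sqr_ge0.
  by apply: divr_ge0 => //; exact/exprn_ge0/M_ge0.
apply: (le_trans (Ktri_le _ _ _)).
have CQ0 : 0 <= (C * Q) ^+ n by rewrite exprn_ge0// mulr_ge0// Q_ge0.
have -> : (x - t) ^+ n.+1.*2 = (x - t) ^+ 2 * (x - t) ^+ n.*2.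
  by rewrite doubleS -addn2 addnC exprD.
rewrite /exp_coeff/= (exprMn n (C * Q) (l ^+ 2)).
rewrite [leRHS](_ : _ = C * (C * Q) ^+ n * (x - t) ^+ 2 * ((l ^+ 2) ^+ n / n`!%:R)); last first.
  by move: n`!%:R^-1 ((C * Q) ^+ n) ((l ^+ 2) ^+ n) => a b c; ring.
rewrite [leLHS](_ : _ = C * (C * Q) ^+ n * (x - t) ^+ 2 *
    ((x - t) ^+ n.*2 / (n.+1)`!%:R ^+ 2)); last first.
  by move: ((n.+1)`!%:R ^+ 2)^-1 ((C * Q) ^+ n) ((x - t) ^+ n.*2) => a b c; ring.
rewrite ler_wpM2l ?mulr_ge0 ?sqr_ge0//.
rewrite ler_pM ?invr_ge0 ?exprn_ge0//.
  by rewrite -exprM mul2n lerXn2r ?nnegrE// ltW.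
rewrite lef_pV2 ?posrE ?exprn_gt0 ?ltr0n ?fact_gt0//.
rewrite -natrX ler_nat (@leq_trans (n.+1)`!)// ?leq_pexp2l ?fact_gt0//.
  by rewrite factS leq_pmull.
by rewrite expnS expn1 leq_pmull// fact_gt0.
Qed.

(** Shifted index: term n carries i^(n+1) K_(n+1), so that the sum of the first m terms is [Nseries]
    at m on the triangle. *)
Definition Nterm n x t : R[i] := 'i%C ^+ n.+1 * Ktri n.+1 x t.
Definition Npart m x t : R[i] := \sum_(0 <= n < m) Nterm n x t.

Lemma Nterm_le n x t : cmod (Nterm n x t) <= C * (x - t) ^+ 2 * exp_coeff M n.
Proof. by rewrite cmodM cmodX cmod_i expr1n mul1r; exact: Ktri_le_exp. Qed.

Lemma C_sqr_ge0 x t : 0 <= C * (x - t) ^+ 2.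
Proof. by apply: mulr_ge0 => //; exact: sqr_ge0. Qed.

Lemma NseriesE x t : in_tri x t -> Nseries q lam x t = (fun m => Npart m x t).
Proof.
move=> xt; apply/funext => m; rewrite /Nseries /Npart big_add1/=.
by apply: eq_bigr => n _; rewrite /Nterm /Ktri xt.
Qed.

Lemma Npart_cvg x t : exists2 z : R[i]^o,
  (fun m => Npart m x t : R[i]^o) @ \oo --> z &
  forall m, cmod (z - Npart m x t) <=
    C * (x - t) ^+ 2 * (expR M - series (exp_coeff M) m).
Proof. by apply: cseries_cvg; [exact: C_sqr_ge0|exact: M_ge0|move=> n; exact: Nterm_le]. Qed.

Lemma Nseries_cvg x t : in_tri x t -> cvg (Nseries q lam x t @ \oo).
Proof. by move=> xt; rewrite NseriesE//; have [z cz _] := Npart_cvg x t; apply/cvg_ex; exists z. Qed.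

Lemma Npart0 m x t : ~~ in_tri x t -> Npart m x t = 0.
Proof.
by move=> xt; rewrite /Npart big1// => n _; rewrite /Nterm Ktri_support// mulr0.
Qed.

Lemma Ntri_lim x t : (fun m => Npart m x t : R[i]^o) @ \oo --> (Ntri x t : R[i]^o).
Proof.
rewrite /Ntri; case: ifPn => xt.
  by have := Nseries_cvg xt; rewrite /Nker NseriesE.
by rewrite (_ : (fun m => _) = fun=> 0); [exact: cvg_cst|apply/funext => m; rewrite Npart0].
Qed.

Lemma Ntri_tail x t m : cmod (Ntri x t - Npart m x t) <=
  C * (x - t) ^+ 2 * (expR M - series (exp_coeff M) m).
Proof. by have [z cz zle] := Npart_cvg x t; rewrite (cvg_unique_C (@Ntri_lim x t) cz). Qed.

Lemma Ntri_support x t : ~~ in_tri x t -> Ntri x t = 0.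
Proof. by rewrite /Ntri => /negbTE->. Qed.

Lemma Npart_cmeas m : cmeas setT (fun p : TR * TR => Npart m p.1 p.2).
Proof.
elim: m => [|m IH].
  by rewrite /Npart; under eq_fun do rewrite big_nil; exact: cmeas_cst.
rewrite /Npart; under eq_fun do rewrite big_nat_recr//=.
apply: cmeasD; first exact: IH.
by apply: cmeasZ; exact: Ktri_cmeas.
Qed.

Lemma Ntri_cmeas : cmeas setT (fun p : TR * TR => Ntri p.1 p.2).
Proof.
apply: (cmeas_cvg (h := fun m (p : TR * TR) => Npart m p.1 p.2)) => //.
  by move=> m; exact: Npart_cmeas.
by move=> p _; exact: Ntri_lim.
Qed.

Lemma Ntri_sec_cmeas t : cmeas setT (fun s : TR => Ntri s t).
Proof. by apply: (cmeas_comp (h := pair^~ t) Ntri_cmeas); exact: measurable_pair2. Qed.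

Lemma Ntri_sec1_cmeas x : cmeas setT (fun s : TR => Ntri x s).
Proof. by apply: (cmeas_comp (h := pair x) Ntri_cmeas); exact: measurable_pair1. Qed.

Lemma Npart_sec_cmeas m t : cmeas setT (fun s : TR => Npart m s t).
Proof. by apply: (cmeas_comp (h := pair^~ t) (Npart_cmeas m)); exact: measurable_pair2. Qed.

Definition CN : R := C * expR M.

Lemma CN_ge0 : 0 <= CN.
Proof. by rewrite mulr_ge0// expR_ge0. Qed.

Lemma Ntri_le x t : cmod (Ntri x t) <= CN * (x - t) ^+ 2.
Proof.
(* For m = 0 the remainder is N itself, and the remainder of the exponential series is its full
   sum. *)
have := Ntri_tail x t 0; rewrite /Npart big_nil subr0 /series/= big_nil subr0.
by rewrite mulrAC.
Qed.

Lemma tri_sqr_le (A : R) x t : 0 <= A -> in_tri x t -> A * (x - t) ^+ 2 <= A * l ^+ 2.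
Proof.
move=> A0 /in_triP[_ _ _ /andP[xt0 xtl]].
by rewrite ler_wpM2l// ler_pXn2r ?nnegrE// ltW.
Qed.

Lemma Ntri_bnd x t : cmod (Ntri x t) <= CN * l ^+ 2.
Proof.
case: (boolP (in_tri x t)) => xt.
  by rewrite (le_trans (Ntri_le _ _))// tri_sqr_le// CN_ge0.
rewrite Ntri_support// cmod0; apply: mulr_ge0; [exact: CN_ge0|exact: sqr_ge0].
Qed.

Lemma Npart_bnd m x t : cmod (Npart m x t) <= (CN + CN) * l ^+ 2.
Proof.
have -> : Npart m x t = Ntri x t - (Ntri x t - Npart m x t) by rewrite opprB addrC subrK.
rewrite (le_trans (cmodB _ _))// mulrDl lerD ?Ntri_bnd//.
case: (boolP (in_tri x t)) => xt; last first.
  rewrite Ntri_support// Npart0// subrr cmod0.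
  by apply: mulr_ge0; [exact: CN_ge0|exact: sqr_ge0].
rewrite (le_trans (Ntri_tail _ _ _))//.
apply: (@le_trans _ _ (CN * (x - t) ^+ 2)); last by rewrite tri_sqr_le// CN_ge0.
rewrite /CN [leRHS]mulrAC; apply: ler_wpM2l; [exact: C_sqr_ge0|rewrite gerBl].
by apply: sumr_ge0 => n _; apply: exp_coeff_ge0; exact: M_ge0.
Qed.

(** The finite form of the integral equation for N: the recursion for K_(m+2) adds one term on each
    side. *)
Lemma Npart_step m x t :
  Npart m.+1 x t = 'i%C * Ktri 1 x t + 'i%C * vstep (fun s => Npart m s t) x.
Proof.
have b0 : 0 <= (CN + CN) * l ^+ 2.
  by apply: mulr_ge0; [rewrite addr_ge0 ?CN_ge0|exact: sqr_ge0].
elim: m => [|m IH].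
  rewrite {1}/Npart big_nat1 /Nterm expr1 /vstep cintegral0 ?mulr0 ?addr0// => s _.
  by rewrite /Npart big_nil mulr0.
have -> : Npart m.+2 x t = Npart m.+1 x t + Nterm m.+1 x t.
  by rewrite /Npart big_nat_recr.
rewrite IH -[LHS]addrA; congr +%R.
rewrite /Nterm exprS -mulrA -mulrDr; congr *%R.
have cp k : cint setT (fun s : TR => Ktri 1 x s * (qcut s)%:C * Npart k s t).
  by apply: (vstep_cint_bnd x b0); [exact: Npart_sec_cmeas|move=> s; exact: Npart_bnd].
(* Integrability of a single term is read off from two consecutive partial sums, for which a bound
   is at hand. *)
have ck : cint setT (fun s : TR => Ktri 1 x s * (qcut s)%:C * Nterm m s t).
  have := cintB measurableT (cp m.+1) (cp m); apply: eq_cint => // s _.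
  by rewrite -mulrBr /Npart big_nat_recr//= addrAC subrr add0r.
have cK : cint setT (fun s : TR => Ktri 1 x s * (qcut s)%:C * Ktri m.+1 s t).
  have := cintZ ('i%C ^- m.+1) measurableT ck; apply: eq_cint => // s _.
  rewrite /Nterm mulrCA mulKf// expf_neq0//.
  by rewrite -cmod_eq0 cmod_i oner_eq0.
rewrite Ktri_step /vstep -cintegralZ// -cintegralD//; last exact: cintZ.
apply: eq_cintegral => s _.
by rewrite [Npart m.+1 s t]/Npart big_nat_recr//= mulrDr -/(Npart m s t) /Nterm mulrCA.
Qed.

(** Both sides differ from the finite form by remainders of the exponential series, at m+1 and at m.
    Their difference z does not depend on m, hence is 0. *)
Lemma Ntri_eq x t :
  Ntri x t = 'i%C * Ktri 1 x t + 'i%C * vstep (fun s => Ntri s t) x.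
Proof.
have b0 : 0 <= (CN + CN) * l ^+ 2.
  by apply: mulr_ge0; [rewrite addr_ge0 ?CN_ge0|exact: sqr_ge0].
have n0 : 0 <= CN * l ^+ 2 by apply: mulr_ge0; [exact: CN_ge0|exact: sqr_ge0].
case: (boolP (in_tri x t)) => xt; last first.
  rewrite Ntri_support// Ktri_support// mulr0 add0r /vstep cintegral0 ?mulr0// => s _.
  have [xs|xs] := boolP (in_tri x s); last by rewrite [Ktri 1 x s]Ktri_support// !mul0r.
  have [st|st] := boolP (in_tri s t); last by rewrite Ntri_support// !mulr0.
  move/in_triP: xs => [? ? ? _]; move/in_triP: st => [? ? ? _].
  by case/negP: xt; apply/and3P; split=> //; lra.
apply/eqP; rewrite -subr_eq0 -cmod_le0.
set z := _ - _.
pose e m := expR M - series (exp_coeff M) m.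
have e0 m : 0 <= e m by rewrite subr_ge0; apply: series_exp_le; exact: M_ge0.
have ecv : e @ \oo --> 0.
  rewrite -(subrr (expR M)); apply: cvgB; first exact: cvg_cst.
  exact: is_cvg_series_exp_coeff.
have zle m : cmod z <= C * l ^+ 2 * e m.+1 + C * Q * (C * l ^+ 2) * l ^+ 2 * e m.
  have -> : z = (Ntri x t - Npart m.+1 x t) - 'i%C * (vstep (fun s => Ntri s t) x - vstep (fun s => Npart m s t) x).
    by rewrite Npart_step /z; ring.
  rewrite (le_trans (cmodB _ _))// lerD//.
    rewrite (le_trans (Ntri_tail _ _ _))// ler_wpM2r ?e0//.
    exact: tri_sqr_le.
  rewrite cmodM cmod_i mul1r /vstep -cintegralB//; last 2 first.
  - by apply: (vstep_cint_bnd x n0); [exact: Ntri_sec_cmeas|move=> s; exact: Ntri_bnd].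
  - by apply: (vstep_cint_bnd x b0); [exact: Npart_sec_cmeas|move=> s; exact: Npart_bnd].
  have -> : C * Q * (C * l ^+ 2) * l ^+ 2 * e m = C * l ^+ 2 * (C * l ^+ 2 * e m) * Q by ring.
  rewrite -Rintegral_qcut_abs; apply: cmod_cintegral_le => //.
  - apply: cmeasB; apply: vstep_cmeas; [exact: Ntri_sec_cmeas|exact: Npart_sec_cmeas].
  - exact: qcut_abs_int.
  - move=> s _; rewrite -mulrBr cmodM cmodM cmodC mulrAC ler_wpM2r//.
    rewrite ler_pM ?cmod_ge0//.
      case: (boolP (in_tri x s)) => xs.
        by rewrite (le_trans (Ktri1_le _ _))// tri_sqr_le.
      by rewrite Ktri_support// cmod0; apply: mulr_ge0 => //; exact: sqr_ge0.
    case: (boolP (in_tri s t)) => st.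
      by rewrite (le_trans (Ntri_tail _ _ _))// ler_wpM2r ?e0// tri_sqr_le.
    rewrite Ntri_support// Npart0// subrr cmod0; apply: mulr_ge0; last exact: e0.
    by apply: mulr_ge0 => //; exact: sqr_ge0.
have cv : (fun m => C * l ^+ 2 * e m.+1 + C * Q * (C * l ^+ 2) * l ^+ 2 * e m) @ \oo --> 0.
  rewrite -[0](_ : C * l ^+ 2 * 0 + C * Q * (C * l ^+ 2) * l ^+ 2 * 0 = 0); last by ring.
  apply: cvgD; apply: cvgMr => //; first by rewrite (cvg_shiftS e).
rewrite -(cvg_lim (@Rhausdorff R) cv).
apply: limr_ge; first by apply/cvg_ex; exists 0.
by apply: nearW => m; exact: zle.
Qed.

(** N - i K_1 is i times one more step applied to N, and N is of order (x-t)^2; the denominator 4 is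
    (n+1)^2 at n = 1. *)
Lemma Ntri_K1_le x t : cmod (Ntri x t - 'i%C * Ktri 1 x t) <=
  C * Q * CN * (x - t) ^+ 4 / 4.
Proof.
rewrite Ntri_eq addrC addKr cmodM cmod_i mul1r.
have := @vstep_le x t CN 1 (fun s => Ntri s t) CN_ge0 (Ntri_sec_cmeas t).
rewrite (_ : 2 ^+ 2 = 4 :> R); last by ring.
apply.
  by move=> s st; rewrite Ntri_support// /in_tri [t <= s]leNgt st/= andbF.
by move=> s _ _; exact: Ntri_le.
Qed.

(** After n iterations u carries a factor (c C Q)^n (s-t)^(2n)/(n!)^2, which tends to 0. The
    constant c is free because the lemma serves twice: with c = 1 for the null space of I - iK, and
    with c = |w|^3, q = 1, lam = 0 for the Cauchy problem. *)
Lemma vstep_unique (c : R) (t : R) (u : R -> R[i]) (A : R) : 0 <= c -> 0 <= A ->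
  cmeas setT (u : TR -> _) -> (forall s, s < t -> u s = 0) ->
  (forall s, t <= s -> s <= l -> cmod (u s) <= A) ->
  (forall s, t <= s -> s <= l -> cmod (u s) <= c * cmod (vstep u s)) ->
  forall s, t <= s -> s <= l -> u s = 0.
Proof.
move=> c0 A0 mu_ u0 uA uv.
have cC0 : 0 <= c * (C * Q) by rewrite !mulr_ge0// Q_ge0.
have H n s : t <= s -> s <= l ->
    cmod (u s) <= A * (c * (C * Q)) ^+ n / n`!%:R ^+ 2 * (s - t) ^+ n.*2.
  elim: n s => [|n IH] s ts sl; first by rewrite expr0 !mulr1 fact0 expr1n divr1 uA.
  apply: (le_trans (uv _ ts sl)).
  have a0 : 0 <= A * (c * (C * Q)) ^+ n / n`!%:R ^+ 2.
    by rewrite !mulr_ge0 ?invr_ge0 ?exprn_ge0.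
  rewrite (le_trans (ler_wpM2l c0 (@vstep_le s t _ n u a0 mu_ u0 IH)))//.
  have f0 : n`!%:R != 0 :> R by rewrite pnatr_eq0 -lt0n fact_gt0.
  have n0 : n.+1%:R != 0 :> R by rewrite pnatr_eq0.
  have -> : (n.+1)`!%:R = n.+1%:R * n`!%:R :> R by rewrite factS natrM.
  rewrite (exprS (c * (C * Q)) n) le_eqVlt; apply/orP; left; apply/eqP.
  by move: f0 n0; move: n`!%:R n.+1%:R ((c * (C * Q)) ^+ n) (_ ^+ n.+1.*2) => x y z v f0 n0;
    field; rewrite f0 n0.
move=> s ts sl; apply/eqP; rewrite -cmod_le0.
pose L := c * (C * Q) * (s - t) ^+ 2.
have L0 : 0 <= L by apply: mulr_ge0 => //; exact: sqr_ge0.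
have ule n : cmod (u s) <= A * exp_coeff L n.
  apply: (le_trans (H n s ts sl)); rewrite /exp_coeff/= -!mulrA ler_wpM2l//.
  rewrite /L (exprMn n (c * (C * Q)) ((s - t) ^+ 2)) -(exprM (s - t)) mul2n.
  rewrite -mulrA ler_wpM2l ?exprn_ge0// mulrC ler_wpM2l//.
    by rewrite exprn_ge0// subr_ge0.
  rewrite lef_pV2 ?posrE ?exprn_gt0 ?ltr0n ?fact_gt0//.
  by rewrite -natrX ler_nat expnS expn1 leq_pmull// fact_gt0.
have cv : (fun n => A * exp_coeff L n) @ \oo --> 0.
  rewrite -[0](mulr0 A); apply: cvgMr => //.
  by apply: cvg_series_cvg_0; exact: is_cvg_series_exp_coeff.
rewrite -(cvg_lim (@Rhausdorff R) cv).
apply: limr_ge; first by apply/cvg_ex; exists 0.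
by apply: nearW => m; exact: ule.
Qed.

(** The operator K with the multiplication by q moved into the argument: g will be q f, and the
    kernel that remains is bounded. The same holds for [tT] and T. *)
Definition tK (g : R -> R[i]) (x : R) : R[i] := cintegral setT (fun t : TR => Ktri 1 x t * g t).
Definition tT (g : R -> R[i]) (x : R) : R[i] := cintegral setT (fun t : TR => Ntri x t * g t).

Lemma Ktri1_bnd x t : cmod (Ktri 1 x t) <= C * l ^+ 2.
Proof.
case: (boolP (in_tri x t)) => xt.
  by rewrite (le_trans (Ktri1_le _ _))// tri_sqr_le.
by rewrite Ktri_support// cmod0; apply: mulr_ge0 => //; exact: sqr_ge0.
Qed.

(** * Bounded kernels acting on integrable functions *)

Section BoundedKernel.
Variables (G : R -> R -> R[i]) (B : R).
Hypothesis mG : cmeas setT (fun p : TR * TR => G p.1 p.2).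
Hypothesis GB : forall x t, cmod (G x t) <= B.

Lemma bounded_kernel_pt (g : TR -> R[i]) x t :
  cmod (G x t * g t) <= B * cmod (g t).
Proof. by rewrite cmodM ler_wpM2r ?cmod_ge0. Qed.

Lemma bounded_kernel_cmeas (g : TR -> R[i]) x : cmeas setT g ->
  cmeas setT (fun t : TR => G x t * g t).
Proof.
move=> mg; apply: cmeasM => //.
by apply: (cmeas_comp (h := pair x) mG); exact: measurable_pair1.
Qed.

Lemma abs_int_scale (g : TR -> R[i]) (A : R) : cint setT g ->
  mu.-integrable setT (EFin \o (fun t : TR => A * cmod (g t))).
Proof.
move=> ig; have := integrableZl measurableT A (cint_cmod measurableT ig).
by apply: eq_integrable => // x _ /=; rewrite EFinM.
Qed.

Lemma bounded_kernel_cint (g : TR -> R[i]) x : cint setT g ->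
  cint setT (fun t : TR => G x t * g t).
Proof.
move=> ig; apply: (cint_le _ _ (abs_int_scale B ig)) => //.
  exact/bounded_kernel_cmeas/cint_meas.
by move=> t _; exact: bounded_kernel_pt.
Qed.

Lemma bounded_kernel_le (g : TR -> R[i]) x : cint setT g ->
  cmod (cintegral setT (fun t : TR => G x t * g t)) <=
  B * Rintegral mu setT (fun t : TR => cmod (g t)).
Proof.
move=> ig; rewrite -RintegralZl//; last exact: cint_cmod.
apply: cmod_cintegral_le => //.
- exact/bounded_kernel_cmeas/cint_meas.
- exact: abs_int_scale.
- by move=> t _; exact: bounded_kernel_pt.
Qed.

Lemma bounded_kernel_op_cmeas (g : TR -> R[i]) : cmeas setT g ->
  cmeas setT (fun x : TR => cintegral setT (fun t : TR => G x t * g t)).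
Proof.
move=> mg.
apply: (cmeas_cintegral_param (f := fun z : TR * TR => G z.1 z.2 * g z.2)).
by apply: cmeasM => //; exact: (cmeas_comp mg measurable_snd).
Qed.

End BoundedKernel.

Lemma tK_le (g : TR -> R[i]) x : cint setT g ->
  cmod (tK g x) <= C * l ^+ 2 * Rintegral mu setT (fun t : TR => cmod (g t)).
Proof. by apply: bounded_kernel_le; [exact: Ktri1_cmeas|exact: Ktri1_bnd]. Qed.

(** The integral equation for N, multiplied by g(t) and integrated in t; Fubini moves the t-integral
    inside the factor K_1 q. *)
Lemma resolvent_identity (g : TR -> R[i]) x : cint setT g ->
  tT g x = 'i%C * tK g x + 'i%C * tK (fun s => (qcut s)%:C * tT g s) x.
Proof.
move=> ig; have mg := cint_meas ig.
have n0 : 0 <= CN * l ^+ 2 by apply: mulr_ge0; [exact: CN_ge0|exact: sqr_ge0].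
have Cl0 : 0 <= C * l ^+ 2 by apply: mulr_ge0 => //; exact: sqr_ge0.
pose F (p : TR * TR) := Ktri 1 x p.2 * (qcut p.2)%:C * Ntri p.2 p.1 * g p.1.
have mF : cmeas setT F.
  apply: cmeasM; [apply: cmeasM; [apply: cmeasM|]|].
  - exact: (cmeas_comp (Ktri1_sec_cmeas x) measurable_snd).
  - exact: (cmeas_comp qcut_cmeas measurable_snd).
  - apply: (cmeas_comp (h := fun p : TR * TR => (p.2, p.1)) Ntri_cmeas).
    by apply: measurable_fun_pair; [exact: measurable_snd|exact: measurable_fst].
  - exact: (cmeas_comp mg measurable_fst).
have FB t s : cmod (F (t, s)) <= cmod (g t) * (C * l ^+ 2 * (CN * l ^+ 2) * `|qcut s|).
  rewrite /F/= !cmodM cmodC mulrC ler_wpM2l ?cmod_ge0// mulrAC ler_wpM2r//.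
  by rewrite ler_pM ?cmod_ge0// ?Ktri1_bnd// Ntri_bnd.
have Fub := cFubini mF (cint_cmod measurableT ig) (qcut_abs_int (C * l ^+ 2 * (CN * l ^+ 2))) FB.
have cV t : cint setT (fun s : TR => Ktri 1 x s * (qcut s)%:C * Ntri s t).
  by apply: (vstep_cint_bnd x n0); [exact: Ntri_sec_cmeas|move=> s; exact: Ntri_bnd].
have E1 : cintegral setT (fun t => cintegral setT (fun s => F (t, s))) =
    cintegral setT (fun t : TR => vstep (fun s => Ntri s t) x * g t).
  apply: eq_cintegral => t _.
  rewrite [RHS]mulrC -(cintegralZ (g t) measurableT (cV t)).
  by apply: eq_cintegral => s _; rewrite /F/= mulrC.
have E2 : cintegral setT (fun s => cintegral setT (fun t => F (t, s))) =
    tK (fun s => (qcut s)%:C * tT g s) x.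
  apply: eq_cintegral => s _.
  have iN := bounded_kernel_cint Ntri_cmeas Ntri_bnd s ig.
  rewrite mulrA -(cintegralZ (Ktri 1 x s * (qcut s)%:C) measurableT iN).
  by apply: eq_cintegral => t _; rewrite /F/= !mulrA.
rewrite -E2 -Fub E1.
have iV : cint setT (fun t : TR => vstep (fun s => Ntri s t) x * g t).
  have mV : cmeas setT (fun t : TR => vstep (fun s => Ntri s t) x).
    apply: (cmeas_comp (h := pair x)
      (f := fun p : TR * TR => vstep (fun s => Ntri s p.2) p.1)); last exact: measurable_pair1.
    exact: (vstep_param_cmeas Ntri_cmeas).
  have VB t : cmod (vstep (fun s => Ntri s t) x) <= (CN + C) * l ^+ 2.
    (* The integral equation expresses the step through N and K_1, both already bounded. *)
    have -> : vstep (fun s => Ntri s t) x = - 'i%C * (Ntri x t - 'i%C * Ktri 1 x t).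
      by rewrite [Ntri x t]Ntri_eq addrC addKr mulNr mulrA -expr2 sqr_i mulN1r opprK.
    rewrite cmodM cmodN cmod_i mul1r mulrDl; apply: (le_trans (cmodB _ _)).
    apply: lerD; first exact: Ntri_bnd.
    by rewrite cmodM cmod_i mul1r; exact: Ktri1_bnd.
  apply: (cint_le measurableT (cmeasM mV mg) (abs_int_scale ((CN + C) * l ^+ 2) ig)).
  by move=> t _; rewrite cmodM; apply: ler_wpM2r; [exact: cmod_ge0|exact: VB].
have iK : cint setT (fun t : TR => Ktri 1 x t * g t).
  exact: (bounded_kernel_cint Ktri1_cmeas Ktri1_bnd x ig).
rewrite -(cintegralZ 'i%C measurableT iK) -(cintegralZ 'i%C measurableT iV).
rewrite -(cintegralD measurableT (cintZ 'i%C measurableT iK) (cintZ 'i%C measurableT iV)).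
by apply: eq_cintegral => t _; rewrite {1}Ntri_eq mulrDl !mulrA.
Qed.

End VolterraKernels.

(** * Operators on L^2 *)

Section SquareIntegrable.
Variables (R : realType).
Local Notation mu := (@lebesgue_measure R).
Local Notation TR := (measurableTypeR R).

(** From 2P <= s A + B/s for all s > 0. The optimal s is the ratio of the square roots of B and A;
    both roots are shifted by e > 0, so that A = 0 and B = 0 are no special cases, and e is then
    made small. *)
Lemma Rintegral_cauchy_schwarz (D : set TR) (a b : TR -> R) : measurable D ->
  mu.-integrable D (EFin \o (fun x => a x ^+ 2)) ->
  mu.-integrable D (EFin \o (fun x => b x ^+ 2)) ->
  mu.-integrable D (EFin \o (fun x => a x * b x)) ->
  Rintegral mu D (fun x => a x * b x) <=
  Num.sqrt (Rintegral mu D (fun x => a x ^+ 2)) *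
  Num.sqrt (Rintegral mu D (fun x => b x ^+ 2)).
Proof.
move=> mD ia ib iab.
set A := Rintegral mu D (fun x => a x ^+ 2); set B := Rintegral mu D (fun x => b x ^+ 2).
set P := Rintegral mu D _.
have A0 : 0 <= A by apply: Rintegral_ge0 => x _; exact: sqr_ge0.
have B0 : 0 <= B by apply: Rintegral_ge0 => x _; exact: sqr_ge0.
have iZ (r : R) (h : TR -> R) : mu.-integrable D (EFin \o h) ->
    mu.-integrable D (EFin \o (fun x => r * h x)).
  move=> ih; have := integrableZl mD r ih.
  by apply: eq_integrable => // x _ /=; rewrite EFinM.
have PS s : 0 < s -> 2 * P <= s * A + s^-1 * B.
  move=> s0; rewrite /P /A /B -!RintegralZl// -RintegralD//; [|exact: iZ..].
  apply: le_Rintegral => //; first exact: iZ.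
    have := integrableD mD (iZ s _ ia) (iZ s^-1 _ ib).
    by apply: eq_integrable => // x _ /=; rewrite EFinD.
  move=> x _; rewrite -subr_ge0.
  have -> : s * a x ^+ 2 + s^-1 * b x ^+ 2 - 2 * (a x * b x) = s^-1 * (s * a x - b x) ^+ 2.
    by field; rewrite gt_eqF.
  by rewrite mulr_ge0 ?sqr_ge0// invr_ge0 ltW.
have := sqr_sqrtr A0; have := sqr_sqrtr B0.
have := sqrtr_ge0 A; have := sqrtr_ge0 B.
move: (Num.sqrt A) (Num.sqrt B) => x y y0 x0 By Ax.
have PE e : 0 < e -> P <= (x + e) * (y + e).
  move=> e0; have xe : 0 < x + e by lra.
  have ye : 0 < y + e by lra.
  have := PS ((y + e) / (x + e)) (divr_gt0 ye xe).
  have h1 : (y + e) / (x + e) * A <= (y + e) * x.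
    rewrite mulrAC ler_pdivrMr// -mulrA ler_wpM2l ?(ltW ye)// -Ax; nra.
  have h2 : ((y + e) / (x + e))^-1 * B <= (x + e) * y.
    rewrite invf_div mulrAC ler_pdivrMr// -mulrA ler_wpM2l ?(ltW xe)// -By; nra.
  nra.
apply/ler_addgt0Pl => d d0.
have c0 : 0 < x + y + 1 by lra.
(* (x+e)(y+e) exceeds x y by e (x+y+e), which is at most e (x+y+1) <= d. *)
pose e := Num.min 1 (d / (x + y + 1)).
have e0 : 0 < e by rewrite lt_min ltr01 divr_gt0.
have e1 : e <= 1 by rewrite ge_min lexx.
have ed : e * (x + y + 1) <= d.
  by rewrite -ler_pdivlMr// ge_min lexx orbT.
apply: (le_trans (PE e e0)); nra.
Qed.

Lemma L2P (a b : R) (f : R -> R[i]) : L2 a b f <->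
  cmeas `]a, b[%classic (f : TR -> _) /\
  mu.-integrable `]a, b[ (EFin \o (fun x : TR => cmod (f x) ^+ 2)).
Proof.
split=> [[m1 m2 f2]|[[m1 m2] /integrableP[_ f2]]].
  have mf : cmeas `]a, b[%classic (f : TR -> _) by split.
  split=> //; apply/integrableP; split.
    by apply/measurable_EFinP; apply: measurable_funX; exact: measurable_cmod.
  under eq_integral do rewrite /= ger0_norm ?sqr_ge0//.
  exact: f2.
split => //; move: f2; under eq_integral do rewrite /= ger0_norm ?sqr_ge0//.
exact.
Qed.

Lemma itv_mu_lty (a b : R) : (mu `]a, b[%classic < +oo)%E.
Proof. by rewrite lebesgue_measure_itv; case: ifP => _; rewrite ?ltry// -EFinB ltry. Qed.

Lemma integrable_cst_itv (a b A : R) :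
  mu.-integrable `]a, b[ (EFin \o (fun _ : TR => A)).
Proof.
apply: measurable_bounded_integrable => //.
- exact: itv_mu_lty.
- exact: bounded_cst.
Qed.

Lemma L2_bounded (a b : R) (f : R -> R[i]) (A : R) :
  cmeas `]a, b[%classic (f : TR -> _) ->
  (forall x, a < x -> x < b -> cmod (f x) <= A) -> L2 a b f.
Proof.
move=> mf fA; apply/L2P; split=> //.
apply: (le_integrable _ _ _ (integrable_cst_itv a b (A ^+ 2))) => //.
  by apply/measurable_EFinP; apply: measurable_funX; exact: measurable_cmod.
move=> x /=; rewrite in_itv/= => /andP[ax xb]; rewrite lee_fin !normrX ler_sqr ?nnegrE//.
by rewrite ger0_norm ?cmod_ge0// (le_trans (fA _ ax xb))// ler_norm.
Qed.

Lemma cmod_add_sqr (x y : R[i]) :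
  cmod (x + y) ^+ 2 <= 2 * cmod x ^+ 2 + 2 * cmod y ^+ 2.
Proof.
have := cmodD x y; have := cmod_ge0 (x + y); have := cmod_ge0 x; have := cmod_ge0 y.
move: (cmod _) (cmod x) (cmod y) => u v w w0 v0 u0 h.
apply: (@le_trans _ _ ((v + w) ^+ 2)); first by rewrite ler_sqr ?nnegrE// addr_ge0.
rewrite -subr_ge0 (_ : _ - _ = (v - w) ^+ 2); last by ring.
exact: sqr_ge0.
Qed.

Lemma integrable_scale (D : set TR) (r : R) (h : TR -> R) : measurable D ->
  mu.-integrable D (EFin \o h) -> mu.-integrable D (EFin \o (fun x => r * h x)).
Proof.
move=> mD ih; have := integrableZl mD r ih.
by apply: eq_integrable => // x _ /=; rewrite EFinM.
Qed.

Lemma integrable_add (D : set TR) (g h : TR -> R) : measurable D ->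
  mu.-integrable D (EFin \o g) -> mu.-integrable D (EFin \o h) ->
  mu.-integrable D (EFin \o (fun x => g x + h x)).
Proof.
move=> mD ig ih; have := integrableD mD ig ih.
by apply: eq_integrable => // x _ /=; rewrite EFinD.
Qed.

Lemma L2D (a b : R) (f g : R -> R[i]) : L2 a b f -> L2 a b g ->
  L2 a b (fun x => f x + g x).
Proof.
move=> /L2P[mf i_f] /L2P[mg ig]; apply/L2P; split; first exact: cmeasD.
have mD : measurable (`]a, b[%classic : set TR) by exact: measurable_itv.
apply: (le_integrable mD _ _ (integrable_add mD (integrable_scale 2 mD i_f) (integrable_scale 2 mD ig))).
  by apply/measurable_EFinP; apply: measurable_funX; apply: measurable_cmod; exact: cmeasD.
move=> x _ /=; rewrite lee_fin ger0_norm ?sqr_ge0// (le_trans (cmod_add_sqr _ _))//.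
exact: ler_norm.
Qed.

Lemma L2Z (a b : R) (c : R[i]) (f : R -> R[i]) : L2 a b f -> L2 a b (fun x => c * f x).
Proof.
move=> /L2P[mf i_f]; apply/L2P; split; first exact: cmeasZ.
have mD : measurable (`]a, b[%classic : set TR) by exact: measurable_itv.
have := integrable_scale (cmod c ^+ 2) mD i_f; apply: eq_integrable => // x _ /=.
by rewrite cmodM exprMn.
Qed.

Lemma L2B (a b : R) (f g : R -> R[i]) : L2 a b f -> L2 a b g ->
  L2 a b (fun x => f x - g x).
Proof.
move=> f2 g2; have := L2D f2 (L2Z (-1) g2); congr (L2 a b _).
by apply/funext => x; rewrite mulN1r.
Qed.

Lemma L2norm_ge0 (a b : R) f : 0 <= L2norm a b f.
Proof. exact: sqrtr_ge0. Qed.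

(** A triangle inequality with a lossy factor, from |x+y|^2 <= 2|x|^2 + 2|y|^2; it suffices for the
    boundedness of I + T. *)
Lemma L2norm_add (a b : R) (f g : R -> R[i]) : L2 a b f -> L2 a b g ->
  L2norm a b (fun x => f x + g x) <= 2 * (L2norm a b f + L2norm a b g).
Proof.
move=> f2 g2; have /L2P[_ ifg] := L2D f2 g2.
move/L2P : f2 => [mf i_f]; move/L2P : g2 => [mg ig].
have mD : measurable (`]a, b[%classic : set TR) by exact: measurable_itv.
have h : Rintegral mu `]a, b[ (fun x : TR => cmod (f x + g x) ^+ 2) <=
   2 * Rintegral mu `]a, b[ (fun x : TR => cmod (f x) ^+ 2) +
   2 * Rintegral mu `]a, b[ (fun x : TR => cmod (g x) ^+ 2).
  rewrite -(RintegralZl 2 mD i_f) -(RintegralZl 2 mD ig).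
  rewrite -(RintegralD mD (integrable_scale 2 mD i_f) (integrable_scale 2 mD ig)).
  apply: le_Rintegral => //.
    by apply: integrable_add => //; exact: integrable_scale.
  by move=> x _; exact: cmod_add_sqr.
have Fx (k : TR -> R) : 0 <= Rintegral mu `]a, b[ (fun x : TR => k x ^+ 2).
  by apply: Rintegral_ge0 => x _; exact: sqr_ge0.
have := Fx (fun x => cmod (f x)); have := Fx (fun x => cmod (g x)).
rewrite /L2norm; move: h.
move: (Rintegral _ _ _) (Rintegral _ _ _) (Rintegral _ _ _) => A B G h G0 B0.
rewrite -[leRHS]ger0_norm; last by rewrite mulr_ge0// addr_ge0// sqrtr_ge0.
rewrite -sqrtr_sqr ler_wsqrtr// (le_trans h)//.
have := sqr_sqrtr G0; have := sqr_sqrtr B0; have := sqrtr_ge0 A; have := sqrtr_ge0 B.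
by move: (Num.sqrt A) (Num.sqrt B) => u v u0 v0 <- <-; nra.
Qed.

Lemma ae_equal_pt (l : R) (f g : R -> R[i]) :
  (forall x, 0 < x -> x < l -> f x = g x) -> ae_equal 0 l f g.
Proof.
by move=> fg; apply: aeW => x; rewrite in_itv/= => /andP[x0 xl]; exact: fg.
Qed.

Lemma ae_equal_trans (l : R) (f g h : R -> R[i]) :
  ae_equal 0 l f g -> ae_equal 0 l g h -> ae_equal 0 l f h.
Proof.
have FF := ae_filter_ringOfSetsType mu.
by apply: filterS2 => x fg gh xl; rewrite fg// gh.
Qed.

Lemma ae_equal_sym (l : R) (f g : R -> R[i]) : ae_equal 0 l f g -> ae_equal 0 l g f.
Proof.
have FF := ae_filter_ringOfSetsType mu.
by apply: filterS => x fg xl; rewrite fg.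
Qed.

End SquareIntegrable.

(** * K and T as bounded operators on L^2(0,l), and the inverse of I - iK *)

Section VolterraOperators.
Variables (R : realType) (l : R) (q : R -> R) (lam : R[i]).
Local Notation mu := (@lebesgue_measure R).
Local Notation TR := (measurableTypeR R).
Hypothesis l0 : 0 < l.
Hypothesis qL2 : L2 0 l (fun x => (q x)%:C).

Definition fcut (f : R -> R[i]) (x : R) : R[i] := if (0 < x) && (x < l) then f x else 0.
Local Notation qc := (qcut l q).

Lemma fcut_mem (f : R -> R[i]) : fcut f = (fun x => if x \in (`]0, l[%classic : set TR) then f x else 0).
Proof. by apply/funext => x; rewrite /fcut mem_setE in_itv. Qed.

Lemma fcutE f x : 0 < x -> x < l -> fcut f x = f x.
Proof. by rewrite /fcut => -> ->. Qed.

Lemma itv_meas (a b : R) : measurable (`]a, b[%classic : set TR).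
Proof. exact: measurable_itv. Qed.

Lemma fcut_cmeas (f : R -> R[i]) : cmeas `]0, l[%classic (f : TR -> _) -> cmeas setT (fcut f : TR -> _).
Proof. move=> mf; rewrite fcut_mem; exact: ((cmeas_mkcond f (itv_meas 0 l)).1 mf). Qed.

Lemma fcut_sqr_int f : L2 0 l f ->
  mu.-integrable setT (EFin \o (fun x : TR => cmod (fcut f x) ^+ 2)).
Proof.
move=> /L2P[_]; rewrite (integrable_mkcond _ (itv_meas 0 l)).
apply: eq_integrable => // x _ /=; rewrite fcut_mem patchE /=.
by case: ifP => //; rewrite cmod0 expr0n.
Qed.

Lemma Rintegral_fcut_sqr f : Rintegral mu setT (fun x : TR => cmod (fcut f x) ^+ 2) = L2norm 0 l f ^+ 2.
Proof.
rewrite /L2norm sqr_sqrtr; last by apply: Rintegral_ge0 => x _; exact: sqr_ge0.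
rewrite [RHS]Rintegral_mkcond; apply: eq_Rintegral => x _; rewrite fcut_mem patchE /=.
by case: ifP => //; rewrite cmod0 expr0n.
Qed.

Lemma qcut_fcut x : (qc x)%:C = fcut (fun x => (q x)%:C) x.
Proof. by rewrite /qcut /fcut; case: ifP. Qed.

Definition qf (f : R -> R[i]) (x : R) : R[i] := (qc x)%:C * fcut f x.

Lemma qf_cmeas f : cmeas `]0, l[%classic (f : TR -> _) -> cmeas setT (qf f : TR -> _).
Proof.
move=> mf; apply: cmeasM; last exact: fcut_cmeas.
under eq_fun do rewrite qcut_fcut.
by apply: fcut_cmeas; have /L2P[] := qL2.
Qed.

Lemma qf_cint f : L2 0 l f -> cint setT (qf f : TR -> _).
Proof.
move=> f2.
have h := integrable_add measurableT (fcut_sqr_int qL2) (fcut_sqr_int f2).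
apply: (cint_le measurableT _ h).
  by apply: qf_cmeas; move/L2P : f2 => [].
move=> x _; rewrite /qf cmodM qcut_fcut.
move: (cmod _) (cmod _) => u v.
have : 0 <= (u - v) ^+ 2 by exact: sqr_ge0.
have : 0 <= (u + v) ^+ 2 by exact: sqr_ge0.
by rewrite !expr2; nra.
Qed.

Lemma one_L2 : L2 0 l (fun=> 1).
Proof. by apply: (@L2_bounded _ _ _ _ 1); [exact: cmeas_cst|move=> x _ _; rewrite cmod1]. Qed.

Lemma qcut_int : mu.-integrable setT (EFin \o (qc : TR -> R)).
Proof.
(* The interval is bounded, so f = 1 lies in L^2 and q = q f is integrable. *)
have [+ _] := qf_cint one_L2; apply: eq_integrable => // x _ /=.
by rewrite /qf /fcut /qcut; case: ifP; rewrite ?mulr1 ?mul0r.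
Qed.

Lemma qf_norm_le f : L2 0 l f ->
  Rintegral mu setT (fun x : TR => cmod (qf f x)) <=
  L2norm 0 l (fun x => (q x)%:C) * L2norm 0 l f.
Proof.
move=> f2.
have e x : cmod (qf f x) = cmod (fcut (fun x => (q x)%:C) x) * cmod (fcut f x).
  by rewrite /qf cmodM qcut_fcut.
have := @Rintegral_cauchy_schwarz R setT (fun x => cmod (fcut (fun x => (q x)%:C) x))
  (fun x => cmod (fcut f x)) measurableT (fcut_sqr_int qL2) (fcut_sqr_int f2).
rewrite !Rintegral_fcut_sqr !sqrtr_sqr !ger0_norm ?L2norm_ge0//.
under [in X in _ -> X]eq_Rintegral do rewrite e.
apply; have := cint_cmod measurableT (qf_cint f2).
by apply: eq_integrable => // x _ /=; rewrite e.
Qed.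

(** Such operators map L^2 into bounded functions: |A f| <= B ||q|| ||f|| by Cauchy-Schwarz. The
    finite length of the interval then gives the L^2 bound, with the factor sqrt l. *)
Lemma kernel_op_L2_bounded (A : (R -> R[i]) -> R -> R[i]) (G : R -> R -> R[i]) (B : R) :
  cmeas setT (fun p : TR * TR => G p.1 p.2) ->
  (forall x t, cmod (G x t) <= B) ->
  (forall f, L2 0 l f -> forall x, 0 < x -> x < l ->
     A f x = cintegral setT (fun t : TR => G x t * qf f t)) ->
  L2_bounded_operator l A.
Proof.
move=> mG GB AG.
have B0 : 0 <= B by rewrite (le_trans _ (GB 0 0))// cmod_ge0.
have mA f : L2 0 l f -> cmeas `]0, l[%classic (A f : TR -> _).
  move=> f2; apply: (@eq_cmeas _ _ _ _ (fun x : TR => cintegral setT (fun t : TR => G x t * qf f t))).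
    by move=> x; rewrite inE/= in_itv/= => /andP[x0 xl]; rewrite AG.
  apply: (@cmeasS _ _ _ setT) => //.
  by apply: bounded_kernel_op_cmeas => //; apply: cint_meas; exact: qf_cint.
have Ale f : L2 0 l f -> forall x, 0 < x -> x < l ->
    cmod (A f x) <= B * (L2norm 0 l (fun x => (q x)%:C) * L2norm 0 l f).
  move=> f2 x x0 xl; rewrite AG//.
  apply: (le_trans (bounded_kernel_le mG GB x (qf_cint f2))).
  by rewrite ler_wpM2l// qf_norm_le.
split.
- by move=> f f2; apply: (L2_bounded (mA f f2)); exact: Ale.
- move=> a f g f2 g2; apply: ae_equal_pt => x x0 xl.
  have fg2 : L2 0 l (fun x => a * f x + g x) by apply: L2D => //; exact: L2Z.
  rewrite !AG//.
  have i1 := bounded_kernel_cint mG GB x (qf_cint f2).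
  have i2 := bounded_kernel_cint mG GB x (qf_cint g2).
  rewrite -(cintegralZ a measurableT i1) -(cintegralD measurableT (cintZ a measurableT i1) i2).
  apply: eq_cintegral => t _; rewrite /qf /fcut; case: ifP => _; first by ring.
  by rewrite !mulr0 add0r.
- exists (Num.sqrt l * (B * L2norm 0 l (fun x => (q x)%:C))) => f f2.
  set S := L2norm 0 l (fun x => (q x)%:C); set T := L2norm 0 l f.
  have S0 : 0 <= S by exact: L2norm_ge0.
  have T0 : 0 <= T by exact: L2norm_ge0.
  rewrite /L2norm.
  have K0 : 0 <= B * (S * T) by rewrite !mulr_ge0.
  apply: (@le_trans _ _ (Num.sqrt (l * (B * (S * T)) ^+ 2))); last first.
    by rewrite sqrtrM ?(ltW l0)// sqrtr_sqr ger0_norm// !mulrA.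
  rewrite ler_wsqrtr//.
  have -> : l * (B * (S * T)) ^+ 2 = Rintegral mu `]0, l[ (fun _ : TR => (B * (S * T)) ^+ 2).
    rewrite Rintegral_cst//.
    rewrite mulrC; congr *%R; rewrite -[LHS]/(fine l%:E); congr fine.
    have := lebesgue_measure_itv (Interval (BRight 0) (BLeft l)).
    by rewrite /= lte_fin l0 -EFinB subr0.
  apply: le_Rintegral => //.
  + have /L2P[] := L2_bounded (mA f f2) (Ale f f2) => //.
  + exact: integrable_cst_itv.
  + move=> x; rewrite /= in_itv/= => /andP[x0 xl].
    by rewrite ler_sqr ?nnegrE ?cmod_ge0// Ale.
Qed.

(* The endpoints 0 and x of the integral are negligible, which is why values of
   q and f outside the open interval do not matter. *)
Lemma Volterra_opE (F : R -> R -> R[i]) f x : 0 <= x -> x <= l ->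
  cmeas `]0, l[%classic (f : TR -> _) ->
  cmeas setT (fun t : TR => if in_tri l x t then F x t else 0) -> F x x = 0 ->
  Volterra_op (fun x t => F x t * (q t)%:C) f x =
  cintegral setT (fun t : TR => (if in_tri l x t then F x t else 0) * qf f t).
Proof.
move=> x0 xl mf mF Fx; rewrite /Volterra_op.
have E t : 0 < t -> t < x -> F x t * (q t)%:C * f t =
    (if in_tri l x t then F x t else 0) * qf f t.
  move=> t0 tx; have tl := lt_le_trans tx xl.
  by rewrite /in_tri (ltW t0) (ltW tx) xl/= /qf qcutE// fcutE// mulrA.
have mG : cmeas setT (fun t : TR => (if in_tri l x t then F x t else 0) * qf f t).
  by apply: cmeasM => //; exact: qf_cmeas.
have meq : cmeas `]0, x[%classic (fun t : TR => F x t * (q t)%:C * f t).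
  apply: (@eq_cmeas _ _ _ _ (fun t : TR => (if in_tri l x t then F x t else 0) * qf f t)).
    by move=> t; rewrite inE/= in_itv/= => /andP[t0 tx]; rewrite E.
  exact: (@cmeasS _ _ _ setT).
rewrite (cintegral_itv_cc_oo meq) cintegral_mkcond; apply: eq_cintegral => t _.
rewrite mem_setE in_itv/=; case: ifPn => [/andP[t0 tx]|]; first exact: E.
rewrite negb_and -!leNgt => /orP[t0|xt].
  by rewrite /qf /qcut ltNge t0/= mul0r mulr0.
have [<-|xt'] := eqVneq x t; first by rewrite Fx if_same mul0r.
by rewrite /in_tri ifF ?mul0r// [t <= x]leNgt lt_neqAle xt' xt/= andbF.
Qed.

Local Notation Kt1 := (Ktri l q lam 1).
Local Notation tK' := (tK l q lam).
Local Notation tT' := (tT l q lam).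

Lemma Ktri1_bound_ex : exists2 C : R, 0 <= C & (forall x t, cmod (Kt1 x t) <= C * (x - t) ^+ 2) /\
  (forall x t, in_tri l x t -> cmod (Kt1 x t - ((x - t) ^+ 2 / 2)%:C) <= C * (x - t) ^+ 3).
Proof.
have [C C0 [_ _ hT h3]] := s_quot_bounds ('i%C * lam) (ltW l0).
exists C => //; split=> x t.
- case: (boolP (in_tri l x t)) => [xt|/Ktri_support ->]; last first.
    by rewrite cmod0; apply: mulr_ge0 => //; exact: sqr_ge0.
  have [t0 tx xl /andP[xt0 xtl]] := in_triP xt.
  (* k_2 and its derivative k_1 both vanish at 0, so the second-order remainder at 0 is k_2
     itself. *)
  have := hT 2%N 0 (x - t) isT; rewrite normr0 ger0_norm// (ltW l0) => /(_ isT xtl).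
  by rewrite /Ktri xt /= /K1 !s_quot0// mulr0 !subr0 ger0_norm.
- move=> xt; have [t0 tx xl /andP[xt0 xtl]] := in_triP xt.
  by have := h3 (x - t); rewrite ger0_norm// => /(_ xtl); rewrite /Ktri xt.
Qed.

Lemma Kop_tK f x : 0 <= x -> x <= l -> L2 0 l f -> Kop q lam f x = tK' (qf f) x.
Proof.
move=> x0 xl f2; have [C C0 [KC _]] := Ktri1_bound_ex.
rewrite /Kop Volterra_opE//.
- by move/L2P : f2 => [].
- exact: (Ktri1_sec_cmeas l q lam x).
- by rewrite /K1 subrr s_quot0.
Qed.

Lemma Nker_diag x : 0 <= x -> x <= l -> Nker q lam x x = 0.
Proof.
move=> x0 xl; have [C C0 [KC _]] := Ktri1_bound_ex.
have := Ntri_le l0 qcut_int C0 KC x x.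
by rewrite subrr expr0n/= mulr0 cmod_le0 /Ntri /in_tri x0 lexx xl => /eqP.
Qed.

Lemma Top_tT f x : 0 <= x -> x <= l -> L2 0 l f -> Top q lam f x = tT' (qf f) x.
Proof.
move=> x0 xl f2; have [C C0 [KC _]] := Ktri1_bound_ex.
rewrite /Top /Tker Volterra_opE//.
- by move/L2P : f2 => [].
- exact: (Ntri_sec1_cmeas l0 qcut_int C0 KC).
- exact: Nker_diag.
Qed.

Lemma Kop_bounded : L2_bounded_operator l (Kop q lam).
Proof.
have [C C0 [KC _]] := Ktri1_bound_ex.
apply: (kernel_op_L2_bounded (Ktri1_cmeas l q lam) (Ktri1_bnd l0 C0 KC)).
by move=> f f2 x x0 xl; rewrite Kop_tK// ltW.
Qed.

Lemma Top_bounded : L2_bounded_operator l (Top q lam).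
Proof.
have [C C0 [KC _]] := Ktri1_bound_ex.
apply: (kernel_op_L2_bounded (Ntri_cmeas l0 qcut_int C0 KC) (Ntri_bnd l0 qcut_int C0 KC)).
by move=> f f2 x x0 xl; rewrite Top_tT// ltW.
Qed.

Lemma Kop_L2 f : L2 0 l f -> L2 0 l (Kop q lam f).
Proof. by have [] := Kop_bounded => h _ _; exact: h. Qed.

Lemma Top_L2 f : L2 0 l f -> L2 0 l (Top q lam f).
Proof. by have [] := Top_bounded => h _ _; exact: h. Qed.

Lemma iKop_L2 f : L2 0 l f -> L2 0 l (iKop q lam f).
Proof. by move=> f2; apply: L2Z; exact: Kop_L2. Qed.

(** Stated at every point of [0,l] rather than almost everywhere, because the Cauchy problem is
    posed pointwise. *)
Lemma Top_resolvent f x : 0 <= x -> x <= l -> L2 0 l f ->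
  Top q lam f x = iKop q lam f x + iKop q lam (Top q lam f) x.
Proof.
move=> x0 xl f2; have [C C0 [KC _]] := Ktri1_bound_ex.
rewrite /iKop (Kop_tK x0 xl (Top_L2 f2)) (Kop_tK x0 xl f2) (Top_tT x0 xl f2).
rewrite (resolvent_identity l0 qcut_int C0 KC x (qf_cint f2)).
congr (_ + _ * _); apply: eq_cintegral => s _; congr *%R.
rewrite /qf /qcut /fcut; case: ifPn => [/andP[s0 sl]|]; last by rewrite !mul0r.
by rewrite Top_tT// ltW.
Qed.

Lemma Kop_linear f g (a : R[i]) x : 0 <= x -> x <= l -> L2 0 l f -> L2 0 l g ->
  Kop q lam (fun x => a * f x + g x) x = a * Kop q lam f x + Kop q lam g x.
Proof.
move=> x0 xl f2 g2; have [C C0 [KC _]] := Ktri1_bound_ex.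
rewrite !Kop_tK//; last by apply: L2D => //; exact: L2Z.
have i1 := bounded_kernel_cint (Ktri1_cmeas l q lam) (Ktri1_bnd l0 C0 KC) x (qf_cint f2).
have i2 := bounded_kernel_cint (Ktri1_cmeas l q lam) (Ktri1_bnd l0 C0 KC) x (qf_cint g2).
rewrite /tK -(cintegralZ a measurableT i1) -(cintegralD measurableT (cintZ a measurableT i1) i2).
apply: eq_cintegral => t _; rewrite /qf /fcut; case: ifP => _; first by ring.
by rewrite !mulr0 add0r.
Qed.

(** The integral does not see null sets, so K turns an a.e. identity into one at every point. This
    links classes in L^2 to solutions defined pointwise. *)
Lemma Kop_eq_ae f g x : 0 <= x -> x <= l -> L2 0 l f -> L2 0 l g ->
  ae_equal 0 l f g -> Kop q lam f x = Kop q lam g x.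
Proof.
move=> x0 xl f2 g2 fg; rewrite !Kop_tK//.
apply: eq_ae_cintegral => //.
- apply: bounded_kernel_cmeas; [exact: Ktri1_cmeas|].
  exact/cint_meas/qf_cint.
- apply: bounded_kernel_cmeas; [exact: Ktri1_cmeas|].
  exact/cint_meas/qf_cint.
have FF := ae_filter_ringOfSetsType mu.
move: fg; apply: filterS => t fg _; congr *%R; rewrite /qf /fcut.
case: ifPn => [t0l|]; last by rewrite !mulr0.
by rewrite fg// in_itv.
Qed.

(** The iteration requires a bounded function satisfying the equation everywhere. Both are gained by
    passing from u to v = iK u, which agrees with u almost everywhere. *)
Lemma Kop_kernel_trivial u : L2 0 l u -> ae_equal 0 l u (iKop q lam u) ->
  ae_equal 0 l u (fun=> 0).
Proof.
move=> u2 uK; have [C C0 [KC _]] := Ktri1_bound_ex.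
pose v := iKop q lam u.
have v2 : L2 0 l v by exact: iKop_L2.
have vK x : 0 <= x -> x <= l -> v x = iKop q lam v x.
  by move=> x0 xl; rewrite /v /iKop (Kop_eq_ae x0 xl u2 v2 uK).
apply: ae_equal_trans uK _; apply: ae_equal_pt => x x0 xl.
rewrite -[LHS]/(v x).
pose A := C * l ^+ 2 * Rintegral mu setT (fun t : TR => cmod (qf u t)).
have A0 : 0 <= A.
  apply: mulr_ge0; first by apply: mulr_ge0 => //; exact: sqr_ge0.
  by apply: Rintegral_ge0 => t _; exact: cmod_ge0.
have vA s : 0 <= s -> s <= l -> cmod (v s) <= A.
  move=> s0 sl; rewrite /v /iKop cmodM cmod_i mul1r Kop_tK//.
  exact: (tK_le l0 C0 KC s (qf_cint u2)).
have := @vstep_unique R l q lam qcut_int C C0 KC 1 0 (fcut v) A ler01 A0.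
rewrite -(fcutE v x0 xl); apply; rewrite ?(ltW x0) ?(ltW xl)//.
- by apply: fcut_cmeas; move/L2P : v2 => [].
- by move=> s s0; rewrite /fcut ltNge (ltW s0).
- by move=> s s0 sl; rewrite /fcut; case: ifP => _; [exact: vA|rewrite cmod0].
- move=> s s0 sl; rewrite mul1r {1}/fcut; case: ifP => _; last by rewrite cmod0 cmod_ge0.
  rewrite vK// /iKop cmodM cmod_i mul1r Kop_tK//.
  rewrite le_eqVlt; apply/orP; left; apply/eqP; congr cmod.
  by apply: eq_cintegral => t _; rewrite /qf mulrA.
Qed.

Lemma ImiKop_sub f g x : 0 <= x -> x <= l -> L2 0 l f -> L2 0 l g ->
  f x - g x - iKop q lam (fun x => f x - g x) x = ImiKop q lam f x - ImiKop q lam g x.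
Proof.
move=> x0 xl f2 g2; rewrite /ImiKop /iKop.
have -> : (fun x => f x - g x) = (fun x => -1 * g x + f x).
  by apply/funext => s; rewrite mulN1r addrC.
by rewrite Kop_linear//; ring.
Qed.

Lemma ImiKop_inj f g : L2 0 l f -> L2 0 l g ->
  ae_equal 0 l (ImiKop q lam f) (ImiKop q lam g) -> ae_equal 0 l f g.
Proof.
move=> f2 g2 fg.
have d2 : L2 0 l (fun x => f x - g x) by exact: L2B.
have FF := ae_filter_ringOfSetsType mu.
have : ae_equal 0 l (fun x => f x - g x) (fun=> 0).
  apply: Kop_kernel_trivial => //; move: fg; apply: filterS => x fg xl.
  apply/eqP; rewrite -subr_eq0 ImiKop_sub ?fg ?subrr//.
    by move: xl; rewrite in_itv/= => /andP[/ltW].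
  by move: xl; rewrite in_itv/= => /andP[_ /ltW].
by apply: filterS => x h xl; apply/eqP; rewrite -subr_eq0 h.
Qed.

Lemma ImiKop_IpT f x : 0 <= x -> x <= l -> L2 0 l f ->
  ImiKop q lam (fun x => f x + Top q lam f x) x = f x.
Proof.
move=> x0 xl f2; rewrite /ImiKop /iKop.
have -> : (fun x => f x + Top q lam f x) = (fun x => 1 * f x + Top q lam f x).
  by apply/funext => s; rewrite mul1r.
rewrite Kop_linear//; last exact: Top_L2.
by have := Top_resolvent x0 xl f2; rewrite /iKop => ->; ring.
Qed.

Lemma ImiKop_Top f x : 0 <= x -> x <= l -> L2 0 l f ->
  ImiKop q lam (Top q lam f) x = iKop q lam f x.
Proof.
by move=> x0 xl f2; rewrite /ImiKop {1}Top_resolvent// addrK.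
Qed.

Lemma ImiKop_L2 f : L2 0 l f -> L2 0 l (ImiKop q lam f).
Proof. by move=> f2; apply: L2B => //; exact: iKop_L2. Qed.

(** The resolvent identity makes I + T a right inverse. It is a left inverse by injectivity, since
    (I - iK)(I + T)(I - iK) f = (I - iK) f. *)
Lemma ImiKop_invertible : L2_invertible l (ImiKop q lam).
Proof.
exists (fun f x => f x + Top q lam f x).
have I2 f : L2 0 l f -> L2 0 l (fun x => f x + Top q lam f x).
  by move=> f2; apply: L2D => //; exact: Top_L2.
have AB f : L2 0 l f -> ae_equal 0 l (ImiKop q lam (fun x => f x + Top q lam f x)) f.
  by move=> f2; apply: ae_equal_pt => x x0 xl; rewrite ImiKop_IpT// ltW.
split=> //.
- have [T1 T2 [M TM]] := Top_bounded; split=> //.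
    move=> a f g f2 g2; have FF := ae_filter_ringOfSetsType mu.
    by apply: filterS (T2 a f g f2 g2) => x h xl; rewrite h//; ring.
  exists (2 * (1 + M)) => f f2.
  apply: (le_trans (L2norm_add f2 (Top_L2 f2))).
  by rewrite -mulrA ler_wpM2l// mulrDl mul1r lerD2l; exact: TM.
- move=> f f2; apply: ImiKop_inj => //; first by apply: I2; exact: ImiKop_L2.
  by apply: AB; exact: ImiKop_L2.
Qed.

(** [L2_inv] chooses some solution g of the equation; injectivity makes it agree almost everywhere
    with the solution v at hand. *)
Lemma L2_inv_ImiKop f v : L2 0 l f -> L2 0 l v ->
  ae_equal 0 l (ImiKop q lam v) f -> ae_equal 0 l v (L2_inv l (ImiKop q lam) f).
Proof.
move=> f2 v2 vf; rewrite /L2_inv; case: xgetP => [g _ [g2 gf]|/(_ v)]; last first.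
  by move=> /= []; split.
apply: ImiKop_inj => //; apply: (ae_equal_trans vf); exact: ae_equal_sym.
Qed.

Lemma operator_identities f : L2 0 l f ->
  [/\ ae_equal 0 l (Top q lam f) (L2_inv l (ImiKop q lam) (iKop q lam f)),
      ae_equal 0 l (Top q lam f) (fun x => L2_inv l (ImiKop q lam) f x - f x) &
      ae_equal 0 l (fun x => f x + Top q lam f x) (L2_inv l (ImiKop q lam) f)].
Proof.
move=> f2; have T2 := Top_L2 f2.
have h3 : ae_equal 0 l (fun x => f x + Top q lam f x) (L2_inv l (ImiKop q lam) f).
  apply: L2_inv_ImiKop => //; first exact: L2D.
  by apply: ae_equal_pt => x x0 xl; rewrite ImiKop_IpT// ltW.
split=> //.
- apply: L2_inv_ImiKop => //; first exact: iKop_L2.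
  by apply: ae_equal_pt => x x0 xl; rewrite ImiKop_Top// ltW.
- have FF := ae_filter_ringOfSetsType mu.
  by apply: filterS h3 => x h xl; rewrite -h// addrC addKr.
Qed.

End VolterraOperators.

(** * One-sided derivatives and absolute continuity *)

Section RealInduction.
Variable R : realType.

(** A supremum argument. The step carries P across s, from a point just before it to a point just
    after it; a derivative at s controls such increments when they are split at s. *)
Lemma real_induction (c : R) (P : R -> Prop) : 0 <= c -> P 0 ->
  (forall s, 0 <= s -> s <= c -> exists2 d, 0 < d & forall x y,
     0 <= x -> s - d < x -> x <= s -> s <= y -> y < s + d -> y <= c -> P x -> P y) ->
  P c.
Proof.
move=> c0 P0 step.
pose S := [set x | [/\ 0 <= x, x <= c & P x]].
have S0 : S 0 by split.
have hS : has_sup S by split; [exists 0|exists c => x []].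
have s0 : 0 <= sup S by apply: ub_le_sup => //; case: hS.
have sc : sup S <= c by apply: ge_sup; [exists 0|move=> x []].
have [d d0 hd] := step _ s0 sc.
have [x [x0 xc Px] sx] := sup_adherent d0 hS.
have xs : x <= sup S by apply: ub_le_sup; [case: hS|split].
pose y := Num.min c (sup S + d / 2).
have sy : sup S <= y by rewrite le_min sc lerDl divr_ge0// ltW.
have yd : y < sup S + d by rewrite gt_min; apply/orP; right; lra.
have yc : y <= c by rewrite ge_min lexx.
have Py : P y by exact: (hd x y).
have ys : y <= sup S.
  by apply: ub_le_sup; [case: hS|split => //; exact: le_trans sy].
have [cd|dc] := leP c (sup S + d / 2).
  by move: Py; rewrite /y (min_idPl cd).
by move: ys; rewrite /y (min_idPr (ltW dc)); lra.
Qed.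

End RealInduction.

Section OneSidedDerivative.
Variables (R : realType) (l : R).
Implicit Types (f g : R -> R[i]).

(** A form without quotients, in which u = x is allowed. *)
Lemma has_derivP f x d : has_deriv l f x d <->
  forall e, 0 < e -> exists2 r, 0 < r & forall u, 0 <= u -> u <= l -> `|u - x| < r ->
    cmod (f u - f x - (u - x)%:C * d) <= e * `|u - x|.
Proof.
have key u : u != x -> (f u - f x - (u - x)%:C * d) =
    ((f u - f x) / (u - x)%:C - d) * (u - x)%:C.
  move=> ux; have ux0 : (u - x)%:C != 0.
    by rewrite -cmod_eq0 cmodC normr_eq0 subr_eq0.
  by rewrite mulrBl divfK// [d * _]mulrC.
split=> [/cvg_cmodP H e e0|H].
  have /nbhs_ballP[r/= r0 hr] : nbhs x [set u | u != x -> `[0, l]%classic u ->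
      cmod ((f u - f x) / (u - x)%:C - d) < e] := H e e0.
  exists r => // u u0 ul ur.
  have [->|ux] := eqVneq u x.
    by rewrite !subrr mul0r subrr cmod0 normr0 mulr0.
  rewrite key// cmodM cmodC ler_wpM2r// ltW//.
  apply: (hr u) => //; last by rewrite /= in_itv/= u0.
  by rewrite /ball/= distrC.
apply/cvg_cmodP => e e0.
have [r r0 hr] := H _ (divr_gt0 e0 (ltr0Sn _ 1)).
suff : nbhs x [set u | u != x -> `[0, l]%classic u ->
      cmod ((f u - f x) / (u - x)%:C - d) < e] by [].
apply/nbhs_ballP; exists r => //= u; rewrite /ball/= distrC => ur ux.
rewrite in_itv/= => /andP[u0 ul].
have ux0 : 0 < `|u - x| by rewrite normr_gt0 subr_eq0.
have := hr u u0 ul ur; rewrite key// cmodM cmodC ler_pM2r// => h.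
by rewrite (le_lt_trans h)// ltr_pdivrMr// ltr_pMr// ltr1n.
Qed.

Lemma has_derivD f g x a b : has_deriv l f x a -> has_deriv l g x b ->
  has_deriv l (fun t => f t + g t) x (a + b).
Proof.
move=> /has_derivP fa /has_derivP gb; apply/has_derivP => e e0.
have e2 : 0 < e / 2 by rewrite divr_gt0.
have [r1 r10 h1] := fa _ e2; have [r2 r20 h2] := gb _ e2.
exists (Num.min r1 r2) => [|u u0 ul]; first by rewrite lt_min r10.
rewrite lt_min => /andP[ur1 ur2].
rewrite (_ : _ - _ = (f u - f x - (u - x)%:C * a) + (g u - g x - (u - x)%:C * b)); last by ring.
rewrite (le_trans (cmodD _ _))// (splitr e) mulrDl lerD//; [exact: h1|exact: h2].
Qed.

Lemma has_derivZ f x a (c : R[i]) : has_deriv l f x a ->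
  has_deriv l (fun t => c * f t) x (c * a).
Proof.
move=> /has_derivP fa; apply/has_derivP => e e0.
have c1 : 0 < cmod c + 1 by rewrite ltr_wpDl ?cmod_ge0.
have [r r0 h] := fa _ (divr_gt0 e0 c1).
exists r => // u u0 ul ur.
rewrite (_ : _ - _ = c * (f u - f x - (u - x)%:C * a)); last by ring.
rewrite cmodM (le_trans (ler_wpM2l (cmod_ge0 _) (h u u0 ul ur)))//.
rewrite mulrA ler_wpM2r// mulrCA -[leRHS]mulr1 ler_wpM2l ?(ltW e0)//.
by rewrite ler_pdivrMr// mul1r lerDl.
Qed.

Lemma has_derivB f g x a b : has_deriv l f x a -> has_deriv l g x b ->
  has_deriv l (fun t => f t - g t) x (a - b).
Proof.
move=> fa gb; have := has_derivD fa (has_derivZ (c := -1) gb).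
by rewrite mulN1r; under eq_fun do rewrite mulN1r.
Qed.

Lemma eq_has_deriv f g x a : 0 <= x -> x <= l ->
  (forall t, 0 <= t -> t <= l -> f t = g t) ->
  has_deriv l f x a -> has_deriv l g x a.
Proof.
move=> x0 xl fg /has_derivP fa; apply/has_derivP => e e0.
have [r r0 h] := fa e e0; exists r => // u u0 ul ur.
by rewrite -!fg// h.
Qed.

Lemma derivable_little_o (h : R -> R) (x c : R) : derivable h x 1 -> derive1 h x = c ->
  forall e, 0 < e -> exists2 r, 0 < r &
    forall u, `|u - x| < r -> `|h u - h x - (u - x) * c| <= e * `|u - x|.
Proof.
move=> dh hc e e0.
have : (k^-1 *: ((h \o shift x) (k *: 1) - h x))%R @[k --> 0^'] --> c.
  by rewrite -hc derive1E; exact: dh.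
move=> /cvgrPdist_lt/(_ e e0) H.
have /nbhs_ballP[r/= r0 hr] : nbhs (0 : R) [set k | k != 0 ->
    `|c - k^-1 *: ((h \o shift x) (k *: 1) - h x)| < e] := H.
exists r => // u ur; have [->|ux] := eqVneq u x.
  by rewrite !subrr mul0r subrr normr0 mulr0.
have k0 : u - x != 0 by rewrite subr_eq0.
have := hr (u - x); rewrite /ball/= sub0r normrN => /(_ ur k0).
rewrite /shift /= /GRing.scale/= mulr1 subrK => hlt.
rewrite (_ : h u - h x - _ = (u - x) * ((u - x)^-1 * (h u - h x) - c)); last first.
  by rewrite mulrBr mulrA mulfV// mul1r.
by rewrite normrM mulrC ler_wpM2r// distrC ltW.
Qed.

Lemma has_deriv_ReIm f x (a b : R) :
  derivable (fun y => complex.Re (f y)) x 1 -> derive1 (fun y => complex.Re (f y)) x = a ->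
  derivable (fun y => complex.Im (f y)) x 1 -> derive1 (fun y => complex.Im (f y)) x = b ->
  has_deriv l f x (a +i* b).
Proof.
move=> d1 e1 d2 e2; apply/has_derivP => e e0.
have e20 : 0 < e / 2 by rewrite divr_gt0.
have [r1 r10 h1] := derivable_little_o d1 e1 e20.
have [r2 r20 h2] := derivable_little_o d2 e2 e20.
exists (Num.min r1 r2) => [|u u0 ul]; first by rewrite lt_min r10.
rewrite lt_min => /andP[ur1 ur2].
rewrite (le_trans (cmod_le_ReIm _))// (splitr e) mulrDl !ReImE/= !mul0r subr0 addr0.
by rewrite lerD//; [exact: h1|exact: h2].
Qed.

(** Real induction on |f(x) - f(0)| <= e' x takes the place of the mean value theorem for complex
    values and covers the one-sided derivatives at the endpoints. *)
Lemma has_deriv0_const f : (forall x, 0 <= x -> x <= l -> has_deriv l f x 0) ->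
  forall c, 0 <= c -> c <= l -> f c = f 0.
Proof.
move=> f0 c c0 cl; apply/eqP; rewrite -subr_eq0 -cmod_le0.
apply/ler_addgt0Pl => e e0; rewrite addr0.
have c1 : 0 < c + 1 by rewrite ltr_wpDl.
suff : cmod (f c - f 0) <= e / (c + 1) * c.
  move=> /le_trans; apply; rewrite mulrAC ler_pdivrMr// ler_wpM2l ?(ltW e0)//.
  by rewrite lerDl.
have e1 : 0 < e / (c + 1) by rewrite divr_gt0.
move: (e / (c + 1)) e1 => e' e'0.
apply: (real_induction (P := fun x => cmod (f x - f 0) <= e' * x)) => //.
  by rewrite subrr cmod0 mulr0.
move=> s s0 sc; have /has_derivP/(_ _ e'0)[r r0 hr] := f0 s s0 (le_trans sc cl).
exists r => // x y x0 sx xs sy ys yc Px.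
have yl := le_trans yc cl.
have hx := hr x x0 (le_trans xs (le_trans sc cl)).
have hy := hr y (le_trans s0 sy) yl.
rewrite (ler0_norm (_ : x - s <= 0)) ?subr_le0// in hx.
rewrite (ger0_norm (_ : 0 <= y - s)) ?subr_ge0// in hy.
rewrite mulr0 subr0 in hx; rewrite mulr0 subr0 in hy.
have hx' : cmod (f x - f s) <= e' * - (x - s) by apply: hx; lra.
have hy' : cmod (f y - f s) <= e' * (y - s) by apply: hy; lra.
have -> : f y - f 0 = (f y - f s) - (f x - f s) + (f x - f 0) by ring.
apply: (le_trans (cmodD _ _)); have := cmodB (f y - f s) (f x - f s).
by move: Px hx' hy'; lra.
Qed.

(** Real induction on boundedness over [0,c]: the linear estimate at s extends a bound past s. It is
    what makes solutions of the Cauchy problem square integrable. *)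
Lemma has_deriv_bounded f f' : 0 <= l -> (forall x, 0 <= x -> x <= l -> has_deriv l f x (f' x)) ->
  exists2 B, 0 <= B & forall x, 0 <= x -> x <= l -> cmod (f x) <= B.
Proof.
move=> l0 df.
suff [B hB] : exists B, forall x, 0 <= x -> x <= l -> cmod (f x) <= B.
  exists B => //; apply: le_trans (hB 0 _ _) => //; exact: cmod_ge0.
apply: (real_induction (P := fun c => exists B, forall x, 0 <= x -> x <= c -> cmod (f x) <= B)) => //.
  exists (cmod (f 0)) => x x0 x0'; have -> : x = 0 by apply/eqP; rewrite eq_le x0 x0'.
  by [].
move=> s s0 sl; have /has_derivP/(_ _ ltr01)[r r0 hr] := df s s0 sl.
exists r => // x y x0 sx xs sy ys yl [B hB].
pose B' := cmod (f s) + (1 + cmod (f' s)) * r.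
exists (Num.max B B') => u u0 uy; rewrite le_max.
have [ux|xu] := leP u x; first by rewrite hB.
apply/orP; right.
have us : `|u - s| < r by rewrite ltr_norml; apply/andP; split; lra.
have := hr u u0 (le_trans uy yl) us; rewrite mul1r => h.
have -> : f u = f s + ((f u - f s - (u - s)%:C * f' s) + (u - s)%:C * f' s) by ring.
apply: (le_trans (cmodD _ _)); rewrite lerD2l.
apply: (le_trans (cmodD _ _)); rewrite mulrDl mul1r lerD//.
  by rewrite (le_trans h)// ltW.
by rewrite cmodM cmodC mulrC ler_wpM2l ?cmod_ge0// ltW.
Qed.

Lemma has_deriv_cmeas f f' : (forall x, 0 <= x -> x <= l -> has_deriv l f x (f' x)) ->
  cmeas (`]0, l[%classic : set (measurableTypeR R)) (f : measurableTypeR R -> _).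
Proof.
move=> df.
have ct x e : 0 < x -> x < l -> 0 < e -> exists2 r, 0 < r &
    forall u, `|x - u| < r -> cmod (f u - f x) < e.
  move=> x0 xl e0; have /has_derivP/(_ _ ltr01)[r r0 hr] := df x (ltW x0) (ltW xl).
  have c1 : 0 < 1 + cmod (f' x) by rewrite ltr_wpDr ?cmod_ge0.
  exists (Num.min (Num.min x (l - x)) (Num.min r (e / (1 + cmod (f' x))))).
    by rewrite !lt_min x0 subr_gt0 xl r0 divr_gt0.
  move=> u; rewrite distrC !lt_min => /andP[/andP[ux ulx] /andP[ur ue]].
  move: ux ulx; rewrite !ltr_norml => /andP[ux _] /andP[_ ulx].
  have := hr u _ _ ur; rewrite mul1r => h.
  have -> : f u - f x = (f u - f x - (u - x)%:C * f' x) + (u - x)%:C * f' x by ring.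
  apply: (le_lt_trans (cmodD _ _)).
  apply: (@le_lt_trans _ _ ((1 + cmod (f' x)) * `|u - x|)); last first.
    by rewrite mulrC -ltr_pdivlMr.
  rewrite mulrDl mul1r lerD//; last by rewrite cmodM cmodC mulrC.
  by apply: h; lra.
split.
- apply: open_continuous_measurable_fun; first exact: itv_open.
  move=> x; rewrite inE/= in_itv/= => /andP[x0 xl].
  apply/cvgrPdist_lt => e e0; have [r r0 hr] := ct x e x0 xl e0.
  apply/nbhs_ballP; exists r => //= u; rewrite /ball/= => xu.
  by rewrite distrC -ReN -ReD (le_lt_trans (cmod_ge_Re _))// hr.
- apply: open_continuous_measurable_fun; first exact: itv_open.
  move=> x; rewrite inE/= in_itv/= => /andP[x0 xl].
  apply/cvgrPdist_lt => e e0; have [r r0 hr] := ct x e x0 xl e0.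
  apply/nbhs_ballP; exists r => //= u; rewrite /ball/= => xu.
  by rewrite distrC -ImN -ImD (le_lt_trans (cmod_ge_Im _))// hr.
Qed.

End OneSidedDerivative.

(** * Absolutely continuous functions *)

Section AbsoluteContinuity.
Variables (R : realType) (l : R).
Local Notation mu := (@lebesgue_measure R).
Local Notation TR := (measurableTypeR R).
Implicit Types f g : R -> R[i].

Lemma mu_itv_oo (a b : R) : a <= b -> mu `]a, b[%classic = (b - a)%:E.
Proof.
move=> ab; rewrite lebesgue_measure_itv/= lte_fin.
case: ltP => [_|ba]; first by rewrite -EFinB.
by have -> : a = b; [apply/eqP; rewrite eq_le ab ba|rewrite subrr].
Qed.

Lemma abs_contD f g : abs_cont 0 l f -> abs_cont 0 l g -> abs_cont 0 l (fun x => f x + g x).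
Proof.
move=> af ag e e0; have e2 : 0 < e / 2 by rewrite divr_gt0.
have [d1 d10 h1] := af _ e2; have [d2 d20 h2] := ag _ e2.
exists (Num.min d1 d2) => [|n u v uv tr]; first by rewrite lt_min d10.
rewrite lt_min => /andP[s1 s2].
have := h1 n u v uv tr s1; have := h2 n u v uv tr s2 => a b.
apply: le_lt_trans (_ : _ <= \sum_(i < n) (cmod (f (v i) - f (u i)) + cmod (g (v i) - g (u i)))) _.
  apply: ler_sum => i _; rewrite (_ : _ - _ = f (v i) - f (u i) + (g (v i) - g (u i))); last by ring.
  exact: cmodD.
by rewrite big_split/= (splitr e) ltrD.
Qed.

Lemma abs_contZ f (c : R[i]) : abs_cont 0 l f -> abs_cont 0 l (fun x => c * f x).
Proof.
move=> af e e0; have c1 : 0 < cmod c + 1 by rewrite ltr_wpDl ?cmod_ge0.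
have [d d0 h] := af _ (divr_gt0 e0 c1).
exists d => // n u v uv tr s; have := h n u v uv tr s; rewrite ltr_pdivlMr// => hlt.
apply: le_lt_trans hlt; rewrite mulr_suml; apply: ler_sum => i _.
by rewrite -mulrBr cmodM mulrC ler_wpM2l ?cmod_ge0// lerDl.
Qed.

(* Along a real induction the oscillation of f is controlled by e times the
   length outside the exceptional null set, and by the oscillation over finitely
   many disjoint intervals of a small open neighbourhood of that set. *)
Lemma abs_cont_deriv0_const f : 0 < l -> abs_cont 0 l f ->
  {ae mu, forall x, x \in `]0, l[ -> has_deriv l f x 0} ->
  forall c, 0 <= c -> c <= l -> f c = f 0.
Proof.
move=> l0 af [A [mA A0 hA]] c c0 cl; apply/eqP; rewrite -subr_eq0 -cmod_le0.
apply/ler_addgt0Pl => e e0; rewrite addr0.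
have c2 : 0 < 2 * (c + 1) by rewrite mulr_gt0// ltr_wpDl.
(* The slope e1 accounts for e1 c <= e/2; the other e/2 is left to the exceptional intervals. *)
pose e1 := e / (2 * (c + 1)); have e10 : 0 < e1 by rewrite divr_gt0.
have e2 : 0 < e / 2 by rewrite divr_gt0.
have [d d0 hd] := af _ e2.
(* The endpoints are added, so that a point of [0,l] outside E is interior and f has derivative 0
   there. *)
pose E : set TR := A `|` ([set 0] `|` [set l]).
have mE : measurable E by apply: measurableU => //; exact: measurableU.
have E0 : mu E = 0%E.
  have z0 : mu ([set 0] `|` [set l] : set TR) = 0%E.
    by rewrite measureU0//; exact: lebesgue_measure_set1.
  by rewrite /E measureU0//; exact: measurableU.
have [V [oV EV VE]] : exists U : set R, [/\ open U, E `<=` U & (mu (U `\` E) < d%:E)%E].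
  have E1 : (mu E < +oo)%E by rewrite E0 ltry.
  exact: (lebesgue_regularity_outer mE E1 d0).
have mV : measurable (V : set TR) by exact: open_measurable.
have muV : (mu V < d%:E)%E.
  apply: le_lt_trans VE; rewrite -[X in (_ <= X)%E]adde0 -E0.
  rewrite -measureU//; [|exact: measurableD|by rewrite setIC setDIK].
  apply: le_measure; rewrite ?inE//; first by apply: measurableU => //; exact: measurableD.
  by move=> z Vz; have [Ez|nEz] := pselect (E z); [right|left].
(* The intervals chosen so far end at or before x, hence are disjoint from any interval added
   later. *)
pose P x := exists n (u v : nat -> R), [/\
  forall i, (i < n)%N -> 0 <= u i /\ u i <= v i /\ v i <= x,
  trivIset `I_n (fun i => [set` `]u i, v i[]),
  forall i, (i < n)%N -> [set` `]u i, v i[] `<=` V &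
  cmod (f x - f 0) <= e1 * x + \sum_(i < n) cmod (f (v i) - f (u i))].
suff [n [u [v [uv tr uvV]]]] : P c.
  move=> /le_trans; apply.
  have e1c : e1 * c <= e / 2.
    rewrite /e1 mulrAC ler_pdivrMr// (_ : e / 2 * (2 * (c + 1)) = e * c + e).
      by rewrite lerDl ltW.
    by field.
  (* Disjoint intervals inside V have total length at most the measure of V, which is below d. *)
  rewrite (splitr e) lerD//; apply: ltW; apply: (hd n u v) => //.
    by move=> i /uv[? [? vc]]; split=> //; split=> //; exact: le_trans cl.
  pose F i : set TR := if (i < n)%N then `]u i, v i[%classic else set0.
  have mF i : measurable (F i) by rewrite /F; case: ifP.
  have tF : trivIset setT F.
    move=> i j _ _; rewrite /F; case: ifP => ni; case: ifP => nj; rewrite ?set0I ?setI0;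
      try by case=> ?.
    by apply: tr.
  rewrite -lte_fin -sumEFin.
  apply: le_lt_trans muV.
  rewrite (eq_bigr (fun i : 'I_n => mu (F i))); last first.
    move=> i _; rewrite /F ltn_ord; have [_ [uvi _]] := uv i (ltn_ord i).
    by rewrite mu_itv_oo.
  have <- := measure_bigsetU mu mF tF n.
  apply: le_measure; rewrite ?inE//; first exact: bigsetU_measurable.
  rewrite -bigcup_mkord => x [i /= ni]; rewrite /F ni; exact: uvV.
apply: (real_induction (P := P)) => //.
  exists 0%N, (fun=> 0), (fun=> 0); split=> //.
  by rewrite subrr cmod0 mulr0 big_ord0 addr0.
move=> s s0 sc.
have [sE|sE] := pselect (E s).
  have /nbhs_ballP[r/= r0 hr] : nbhs s V by apply: open_nbhs_nbhs; split=> //; exact: EV.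
  exists r => // x y x0 sx xs sy ys yc [n [u [v [uv tr uvV le]]]].
  have xy := le_trans xs sy.
  exists n.+1, (fun i => if (i < n)%N then u i else x), (fun i => if (i < n)%N then v i else y).
  split.
  - move=> i; case: ifP => ni _; last by [].
    by have [u0 [uv' vx]] := uv i ni; split=> //; split=> //; exact: le_trans xy.
  - move=> i j /= ni nj; case: ifPn => [in1|in1]; case: ifPn => [jn1|jn1].
    + exact: (tr i j in1 jn1).
    + move=> [z [/=]]; rewrite !in_itv/= => /andP[_ zv] /andP[xz _].
      have [_ [_ vx]] := uv i in1.
      by have := lt_le_trans zv vx; rewrite ltNge (ltW xz).
    + move=> [z [/=]]; rewrite !in_itv/= => /andP[xz _] /andP[_ zv].
      have [_ [_ vx]] := uv j jn1.
      by have := lt_le_trans zv vx; rewrite ltNge (ltW xz).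
    + move=> _; apply/eqP; rewrite eqn_leq; rewrite -!leqNgt in in1 jn1.
      by rewrite (leq_trans _ jn1) ?(leq_trans _ in1).
  - move=> i; case: ifP => ni _; first exact: uvV.
    move=> z /=; rewrite in_itv/= => /andP[xz zy]; apply: hr.
    by rewrite /ball/= ltr_distlC; apply/andP; split; lra.
  - rewrite big_ord_recr/= ltnn.
    rewrite (eq_bigr (fun i : 'I_n => cmod (f (v i) - f (u i)))); last first.
      by move=> i _; rewrite /= ltn_ord.
    have -> : f y - f 0 = (f x - f 0) + (f y - f x) by ring.
    apply: (le_trans (cmodD _ _)); rewrite addrA lerD2r (le_trans le)// lerD2r.
    by rewrite ler_wpM2l// ltW.
have sl : s <= l := le_trans sc cl.
have sitv : s \in `]0, l[.
  rewrite in_itv/= !lt_neqAle s0 sl !andbT; apply/andP; split; apply/eqP => h.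
    by apply: sE; right; left; rewrite -h.
  by apply: sE; right; right.
have ds : has_deriv l f s 0.
  by apply: contrapT => nd; apply: sE; left; apply: hA => /= /(_ sitv).
have /has_derivP/(_ _ e10)[r r0 hr] := ds.
exists r => // x y x0 sx xs sy ys yc [n [u [v [uv tr uvV le]]]].
have xy := le_trans xs sy.
exists n, u, v; split=> //.
  by move=> i /uv[? [? vx]]; split=> //; split=> //; exact: le_trans xy.
have yl := le_trans yc cl.
have hx := hr x x0 (le_trans xs sl).
have hy := hr y (le_trans s0 sy) yl.
rewrite (ler0_norm (_ : x - s <= 0)) ?subr_le0// in hx.
rewrite (ger0_norm (_ : 0 <= y - s)) ?subr_ge0// in hy.
rewrite mulr0 subr0 in hx; rewrite mulr0 subr0 in hy.
have hx' : cmod (f x - f s) <= e1 * - (x - s) by apply: hx; lra.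
have hy' : cmod (f y - f s) <= e1 * (y - s) by apply: hy; lra.
have -> : f y - f 0 = (f y - f s) - (f x - f s) + (f x - f 0) by ring.
apply: (le_trans (cmodD _ _)); have := cmodB (f y - f s) (f x - f s).
by move: le hx' hy'; move: (\sum_(i < n) _) => S; lra.
Qed.

(** The sum splits into a Lipschitz part and the integral of |g| over the union of the intervals,
    which is small by absolute continuity of the integral. *)
Lemma abs_cont_bound f (K : R) (g : TR -> R[i]) : 0 <= K -> cint setT g ->
  (forall a b, 0 <= a -> a <= b -> b <= l ->
     cmod (f b - f a) <= K * (b - a) + Rintegral mu `]a, b[ (fun t : TR => cmod (g t))) ->
  abs_cont 0 l f.
Proof.
move=> K0 ig hf e e0.
have e2 : 0 < e / 2 by rewrite divr_gt0.
have icg := cint_cmod measurableT ig.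
have [d1 [d10 h1]] := integral_normr_continuous icg e2.
have K1 : 0 < K + 1 by rewrite ltr_wpDl.
exists (Num.min d1 (e / 2 / (K + 1))); first by rewrite lt_min d10 divr_gt0.
move=> n u v uv tr; rewrite lt_min => /andP[s1 s2].
pose F i : set TR := if (i < n)%N then `]u i, v i[%classic else set0.
have mF i : measurable (F i) by rewrite /F; case: ifP.
have tF : trivIset setT F.
  move=> i j _ _; rewrite /F; case: ifP => ni; case: ifP => nj; rewrite ?set0I ?setI0;
    try by case=> ?.
  by apply: tr.
have muF : mu (\big[setU/set0]_(i < n) F i) = (\sum_(i < n) (v i - u i))%:E.
  rewrite (measure_bigsetU mu mF tF n) -sumEFin; apply: eq_bigr => i _.
  rewrite /F ltn_ord; have [_ [uvi _]] := uv i (ltn_ord i).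
  exact: mu_itv_oo.
have Isum m : Rintegral mu (\big[setU/set0]_(i < m) F i) (fun t : TR => cmod (g t)) =
    \sum_(i < m) Rintegral mu (F i) (fun t : TR => cmod (g t)).
  elim: m => [|m IH]; first by rewrite !big_ord0 Rintegral_set0.
  rewrite !big_ord_recr/= -IH Rintegral_setU//; [exact: bigsetU_measurable| |].
    by apply: integrableS icg => //; apply: measurableU => //; exact: bigsetU_measurable.
  apply/disj_setPS => z [] /=; rewrite -bigcup_mkord => -[i /= im zi] zm.
  have h : i = m by apply: (tF i m I I); exists z.
  by move: im; rewrite h ltnn.
have hle : \sum_(i < n) Rintegral mu (F i) (fun t : TR => cmod (g t)) < e / 2.
  have mU : measurable (\big[setU/set0]_(i < n) F i) by exact: bigsetU_measurable.
  have muU : (mu (\big[setU/set0]_(i < n) F i) < d1%:E)%E by rewrite muF lte_fin.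
  rewrite -Isum; apply: (le_lt_trans _ (h1 _ mU muU)).
  apply: le_Rintegral => //.
  - exact: integrableS icg.
  - exact: integrableS (integrable_norm icg).
  - by move=> t _; rewrite ler_norm.
apply: (@le_lt_trans _ _ (K * \sum_(i < n) (v i - u i) +
   \sum_(i < n) Rintegral mu (F i) (fun t : TR => cmod (g t)))).
  rewrite mulr_sumr -big_split/=; apply: ler_sum => i _.
  have [u0 [uvi vl]] := uv i (ltn_ord i).
  by rewrite /F ltn_ord; exact: hf.
rewrite (splitr e); apply: ler_ltD hle.
have S0 : 0 <= \sum_(i < n) (v i - u i).
  by apply: sumr_ge0 => i _; rewrite subr_ge0; have [_ []] := uv i (ltn_ord i).
move: s2; rewrite ltr_pdivlMr// => s2; move: S0 s2 K0.
by move: (\sum_(i < n) _) => S; nra.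
Qed.

End AbsoluteContinuity.

(** * Convolution with s_p *)

Section Convolution.
Variables (R : realType) (l : R) (w : R[i]).
Local Notation mu := (@lebesgue_measure R).
Local Notation TR := (measurableTypeR R).
Local Notation Re := complex.Re.
Local Notation Im := complex.Im.
Hypothesis l0 : 0 < l.

Definition indefinite (g : R -> R[i]) (x : R) : R[i] :=
  cintegral setT (fun t : TR => if t <= x then g t else 0).

(** Cutting the kernel at r < 0 lets the convolution be taken over the line although only t <= x
    contributes. *)
Definition causal (k : R -> R[i]) (r : R) : R[i] := if 0 <= r then k r else 0.

Definition conv (k : R -> R[i]) (g : R -> R[i]) (x : R) : R[i] :=
  cintegral setT (fun t : TR => causal k (x - t) * g t).

Lemma half_line_meas (x : R) : measurable [set t : TR | t <= x].
Proof. by rewrite (_ : [set t | _] = `]-oo, x]%classic)//; apply/seteqP; split=> t; rewrite /= in_itv. Qed.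

Lemma indefinite_deriv (g : TR -> R[i]) : cint setT g ->
  {ae mu, forall x, has_deriv l (indefinite g) x (g x)}.
Proof.
move=> ig; have [i1 i2] := ig.
have F (h : TR -> R) : mu.-integrable setT (EFin \o h) ->
    {ae mu, forall x : R, derivable (fun x : R => Rintegral mu setT (fun t : TR => if t <= x then h t else 0)) x 1 /\
      derive1 (fun x : R => Rintegral mu setT (fun t : TR => if t <= x then h t else 0)) x = h x}.
  move=> ih.
  have ihy (y : R) : mu.-integrable `]-oo, y] (EFin \o h) by apply: integrableS ih.
  have lh : locally_integrable [set: R] h.
    by have := integrable_locally measurableT ih; rewrite patch_setT.
  have FE : (fun x : R => Rintegral mu setT (fun t : TR => if t <= x then h t else 0)) =
      (fun x : R => Rintegral mu `]-oo, x] h).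
    apply/funext => x; rewrite [RHS]Rintegral_mkcond; apply: eq_Rintegral => t _.
    by rewrite patchE mem_setE in_itv.
  by rewrite FE; exact: (FTC1Ny ihy lh).
have FF := ae_filter_ringOfSetsType mu.
apply: filterS2 (F _ i1) (F _ i2) => x [d1 e1] [d2 e2].
have -> : g x = Re (g x) +i* Im (g x) by case: (g x).
have eR : (fun y => Re (indefinite g y)) =
    (fun y : R => Rintegral mu setT (fun t : TR => if t <= y then Re (g t) else 0)).
  by apply/funext => y; apply: eq_Rintegral => t _; case: ifP.
have eI : (fun y => Im (indefinite g y)) =
    (fun y : R => Rintegral mu setT (fun t : TR => if t <= y then Im (g t) else 0)).
  by apply/funext => y; apply: eq_Rintegral => t _; case: ifP.
apply: has_deriv_ReIm.
- by rewrite eR; exact: d1.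
- by rewrite eR; exact: e1.
- by rewrite eI; exact: d2.
- by rewrite eI; exact: e2.
Qed.

Lemma half_line_cmeas (g : TR -> R[i]) x : cmeas setT g ->
  cmeas setT (fun t : TR => if t <= x then g t else 0).
Proof.
move=> mg; apply: (cmeas_if (b := fun t : TR => t <= x)) => //.
exact: half_line_meas.
Qed.

Lemma half_line_cint (g : TR -> R[i]) x : cint setT g ->
  cint setT (fun t : TR => if t <= x then g t else 0).
Proof.
move=> ig; apply: (cint_le measurableT _ (cint_cmod measurableT ig)).
  exact/half_line_cmeas/cint_meas.
by move=> t _; case: ifP => _ //; rewrite cmod0 cmod_ge0.
Qed.

Lemma causal_cmeas (k : R -> R[i]) x : cmeas setT (k : TR -> _) ->
  cmeas setT (fun t : TR => causal k (x - t)).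
Proof.
move=> mk; rewrite /causal; under eq_fun do rewrite subr_ge0.
apply: (cmeas_if (b := fun t : TR => t <= x)); [exact: half_line_meas| |exact: cmeas_cst].
apply: (cmeas_comp (f := (k : TR -> R[i])) (h := fun t : TR => x - t)) => //.
by apply: measurable_funB => //; exact: measurable_cst.
Qed.

Lemma s_quot_deriv_cmeas p : cmeas setT (s_quot_deriv w p : TR -> _).
Proof. by case: p => [|p]; [apply: cmeasZ|]; exact: s_quot_cmeas. Qed.

Section ConvolutionEstimate.
Variable C : R.
Hypothesis C0 : 0 <= C.
Hypothesis h1 : forall p r, (p < 3)%N -> `|r| <= l -> cmod (s_quot p w r) <= C.
Hypothesis h2 : forall p r, (p < 3)%N -> `|r| <= l -> cmod (s_quot_deriv w p r) <= C.
Hypothesis h3 : forall p a b, (p < 3)%N -> `|a| <= l -> `|b| <= l ->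
    cmod (s_quot p w b - s_quot p w a - (b - a)%:C * s_quot_deriv w p a)
      <= C * `|b - a| ^+ 2.
Local Notation C1 := (C * (1 + l)).

Lemma C1_ge : C <= C1.
Proof. by rewrite ler_peMr// lerDl ltW. Qed.

(** The first-order expansion at 0 gives C r^2 + C r <= C (1 + l) r; this is the origin of [C1]. *)
Lemma s_quot_near0 p r : (p < 3)%N -> 0 <= r -> r <= l ->
  cmod (s_quot p w r - (p == 0%N)%:R) <= C1 * r.
Proof.
move=> p3 r0 rl; have ll := ltW l0.
have := h3 (a := 0) (b := r) p3; rewrite normr0 ger0_norm// => /(_ ll rl).
rewrite s_quot0// subr0 ger0_norm// => h.
have hd := h2 (r := 0) p3; rewrite normr0 in hd.
have -> : s_quot p w r - (p == 0%N)%:R =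
  (s_quot p w r - (p == 0%N)%:R - r%:C * s_quot_deriv w p 0) + r%:C * s_quot_deriv w p 0 by ring.
apply: (le_trans (cmodD _ _)); rewrite cmodM cmodC ger0_norm//.
have := hd ll; move: (cmod _) (cmod _) h => A B hA hB.
have rr : r ^+ 2 <= l * r by rewrite expr2 ler_wpM2r.
have := ler_wpM2l C0 rr; have := ler_wpM2l r0 hB; lra.
Qed.

(* [1_(t <= u)] times the kernel, minus its first-order expansion in u; for p = 0
   the kernel jumps by 1 at t = u, which is what the last term removes. *)
Lemma causal_taylor p x u t : (p < 3)%N -> 0 <= x -> x <= l -> 0 <= u -> u <= l ->
  0 <= t -> t <= l ->
  cmod (causal (s_quot p w) (u - t) - causal (s_quot p w) (x - t)
    - (u - x)%:C * causal (s_quot_deriv w p) (x - t)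
    - (p == 0%N)%:R * ((t <= u)%R%:R - (t <= x)%R%:R)) <=
  C1 * `|u - x| ^+ 2 +
    2 * C1 * `|u - x| * ((Num.min x u <= t) && (t <= Num.max x u))%R%:R.
Proof.
move=> p3 x0 xl u0 ul t0 tl; rewrite /causal !subr_ge0.
have C10 : 0 <= C1 by rewrite mulr_ge0// addr_ge0// ltW.
have nn : 0 <= C1 * `|u - x| ^+ 2 by rewrite mulr_ge0// exprn_ge0.
have nn2 : 0 <= 2 * C1 * `|u - x| by rewrite mulr_ge0// mulr_ge0.
have [tu|ut] := leP t u; have [tx|xt] := leP t x.
- rewrite subrr mulr0 subr0.
  have nx : `|x - t| <= l by rewrite ger0_norm ?subr_ge0//; lra.
  have nu : `|u - t| <= l by rewrite ger0_norm ?subr_ge0//; lra.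
  have := h3 p3 nx nu; have -> : u - t - (x - t) = u - x by ring.
  move=> /le_trans; apply.
  apply: (@le_trans _ _ (C1 * `|u - x| ^+ 2)); first by rewrite ler_wpM2r ?exprn_ge0// C1_ge.
  by rewrite lerDl mulr_ge0.
(* Here x < t <= u: only the kernel at u survives, and u - t <= u - x makes it close to its value at
   0. *)
- rewrite mulr0 !subr0 mulr1.
  have xu := lt_le_trans xt tu.
  rewrite (min_idPl (ltW xu)) (max_idPr (ltW xu)) (ltW xt) tu/= mulr1.
  rewrite ger0_norm ?subr_ge0 ?(ltW xu)// in nn nn2 *.
  have := @s_quot_near0 p (u - t) p3; rewrite subr_ge0 => /(_ tu) h.
  have {}h := h ltac:(lra).
  apply: (le_trans h).
  have : C1 * (u - t) <= C1 * (u - x) by rewrite ler_wpM2l//; lra.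
  have : 0 <= C1 * (u - x) by rewrite mulr_ge0// subr_ge0 ltW.
  rewrite -(mulrA 2); move: nn.
  by move: (C1 * (u - t)) (C1 * (u - x)) (C1 * (u - x) ^+ 2) => a b c; lra.
(* Here u < t <= x: the kernel at x less its jump and the linear term are each at most C1 |u-x|,
   hence the factor 2 in front of the indicator. *)
- have ux := lt_le_trans ut tx.
  rewrite (min_idPr (ltW ux)) (max_idPl (ltW ux)) (ltW ut) tx/= mulr1.
  rewrite ler0_norm ?subr_le0 ?(ltW ux)// in nn nn2 *.
  have := @s_quot_near0 p (x - t) p3; rewrite subr_ge0 => /(_ tx) h.
  have {}h := h ltac:(lra).
  have hd := h2 (r := x - t) p3; rewrite ger0_norm ?subr_ge0// in hd.
  have {}hd := hd ltac:(lra).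
  have -> : 0 - s_quot p w (x - t) - (u - x)%:C * s_quot_deriv w p (x - t) -
    (p == 0%N)%:R * (0 - 1) = - (s_quot p w (x - t) - (p == 0%N)%:R) - (u - x)%:C * s_quot_deriv w p (x - t) by ring.
  apply: (le_trans (cmodB _ _)); rewrite cmodN cmodM cmodC.
  rewrite ler0_norm ?subr_le0 ?(ltW ux)//.
  have a1 : C1 * (x - t) <= C1 * - (u - x) by rewrite ler_wpM2l//; lra.
  have a2 : - (u - x) * cmod (s_quot_deriv w p (x - t)) <= - (u - x) * C1.
    by apply: ler_wpM2l; [lra|apply: le_trans hd C1_ge].
  move: nn h a1 a2; move: (cmod _) (_ * cmod _) => A B.
  rewrite (mulrC (- (u - x)) C1) -(mulrA 2).
  by move: (C1 * (x - t)) (C1 * - (u - x)) (C1 * (- (u - x)) ^+ 2) => a b c; lra.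
- by rewrite !(mulr0, subrr, subr0) cmod0 addr_ge0// mulr_ge0.
Qed.

Variable g : TR -> R[i].
Hypothesis ig : cint setT g.
Hypothesis g0 : forall t, ~~ ((0 < t) && (t < l)) -> g t = 0.
Local Notation J := (Rintegral mu setT (fun t : TR => cmod (g t))).

Lemma conv_cint p x : (p < 3)%N -> 0 <= x -> x <= l ->
  cint setT (fun t : TR => causal (s_quot p w) (x - t) * g t) /\
  cint setT (fun t : TR => causal (s_quot_deriv w p) (x - t) * g t).
Proof.
move=> p3 x0 xl.
have H (k : R -> R[i]) : cmeas setT (k : TR -> _) ->
    (forall r, `|r| <= l -> cmod (k r) <= C) ->
    cint setT (fun t : TR => causal k (x - t) * g t).
  move=> mk kC; apply: (cint_le measurableT _ (abs_int_scale C ig)).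
    by apply: cmeasM; [exact: causal_cmeas|exact: cint_meas].
  move=> t _; have [/andP[t0 tl]|/g0 ->] := boolP ((0 < t) && (t < l)); last first.
    by rewrite mulr0 cmod0 mulr0.
  rewrite cmodM ler_wpM2r ?cmod_ge0// /causal; case: ifP => xt; last by rewrite cmod0.
  by apply: kC; rewrite ger0_norm//; lra.
split; apply: H; [exact: s_quot_cmeas|by move=> r; exact: h1| |by move=> r; exact: h2].
exact: s_quot_deriv_cmeas.
Qed.

(** [causal_taylor] integrated against |g|. The integral of |g| over the strip between x and u tends
    to 0 with its width, so the remainder is o(|u-x|). *)
Lemma conv_taylor p x u : (p < 3)%N -> 0 <= x -> x <= l -> 0 <= u -> u <= l ->
  cmod (conv (s_quot p w) g u - conv (s_quot p w) g x
    - (u - x)%:C * conv (s_quot_deriv w p) g x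
    - (p == 0%N)%:R * (indefinite g u - indefinite g x)) <=
  C1 * J * `|u - x| ^+ 2 + 2 * C1 * `|u - x| *
    Rintegral mu `[Num.min x u, Num.max x u] (fun t : TR => cmod (g t)).
Proof.
move=> p3 x0 xl u0 ul.
have [iu _] := conv_cint p3 u0 ul; have [ix idx] := conv_cint p3 x0 xl.
have hu := half_line_cint u ig; have hx := half_line_cint x ig.
have mT := @measurableT _ TR.
have iZ := cintZ (u - x)%:C mT idx.
have iP := cintZ ((p == 0%N)%:R : R[i]) mT (cintB mT hu hx).
have i1 := cintB mT iu ix.
have i2 := cintB mT i1 iZ.
rewrite /conv /indefinite -(cintegralB mT hu hx).
rewrite -(cintegralZ _ mT (cintB mT hu hx)) -(cintegralZ _ mT idx).
rewrite -(cintegralB mT iu ix) -(cintegralB mT i1 iZ) -(cintegralB mT i2 iP).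
have icg := cint_cmod mT ig.
pose I0 (t : TR) : R := ((Num.min x u <= t) && (t <= Num.max x u))%R%:R.
have mI : measurable (`[Num.min x u, Num.max x u]%classic : set TR) by exact: measurable_itv.
have eI : (fun t : TR => I0 t * cmod (g t)) =
   ((fun t : TR => cmod (g t)) \_ `[Num.min x u, Num.max x u]).
  apply/funext => t; rewrite patchE mem_setE in_itv/= /I0.
  by case: ifP => _; rewrite ?mul1r ?mul0r.
have iI : mu.-integrable setT (EFin \o (fun t : TR => I0 t * cmod (g t))).
  rewrite eI; have := (integrable_mkcond (EFin \o (fun t : TR => cmod (g t))) mI).1.
  rewrite restrict_EFin; apply.
  exact: integrableS icg.
have -> : C1 * J * `|u - x| ^+ 2 + 2 * C1 * `|u - x| *
    Rintegral mu `[Num.min x u, Num.max x u] (fun t : TR => cmod (g t)) =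
    Rintegral mu setT (fun t : TR => C1 * `|u - x| ^+ 2 * cmod (g t) +
       2 * C1 * `|u - x| * (I0 t * cmod (g t))).
  rewrite RintegralD//; [|exact: integrable_scale..].
  rewrite !RintegralZl// eI -Rintegral_mkcond; ring.
apply: cmod_cintegral_le => //.
- by apply: cint_meas; exact: cintB.
- by apply: integrable_add => //; exact: integrable_scale.
- move=> t _; have [/andP[t0 tl]|tn] := boolP ((0 < t) && (t < l)); last first.
    by rewrite g0// !if_same !(mulr0, subrr, cmod0, addr0).
  have -> : causal (s_quot p w) (u - t) * g t - causal (s_quot p w) (x - t) * g t -
     (u - x)%:C * (causal (s_quot_deriv w p) (x - t) * g t) -
     (p == 0%N)%:R * ((if t <= u then g t else 0) - (if t <= x then g t else 0)) =
     (causal (s_quot p w) (u - t) - causal (s_quot p w) (x - t)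
    - (u - x)%:C * causal (s_quot_deriv w p) (x - t)
    - (p == 0%N)%:R * ((t <= u)%R%:R - (t <= x)%R%:R)) * g t.
    by case: (t <= u); case: (t <= x); rewrite /= ?mulr1n ?mulr0n; ring.
  rewrite cmodM mulrA -mulrDl ler_wpM2r ?cmod_ge0//.
  exact: (causal_taylor p3 x0 xl u0 ul (ltW t0) (ltW tl)).
Qed.

Lemma cmod_int_sub (D : set TR) : measurable D ->
  Rintegral mu D (fun t : TR => cmod (g t)) <= J.
Proof.
move=> mD; have icg := cint_cmod measurableT ig.
rewrite Rintegral_mkcond; apply: le_Rintegral => //.
  have := (integrable_mkcond (EFin \o (fun t : TR => cmod (g t))) mD).1.
  by rewrite restrict_EFin; apply; exact: integrableS icg.
by move=> t _; rewrite patchE; case: ifP => // _; exact: cmod_ge0.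
Qed.

Lemma J_ge0 : 0 <= J.
Proof. by apply: Rintegral_ge0 => t _; exact: cmod_ge0. Qed.

Lemma C1_ge0 : 0 <= C1.
Proof. by apply: le_trans C0 C1_ge. Qed.

Lemma small_mass e : 0 < e -> exists2 r, 0 < r & forall x u : R, `|u - x| < r ->
  Rintegral mu `[Num.min x u, Num.max x u] (fun t : TR => cmod (g t)) < e.
Proof.
move=> e0; have icg := cint_cmod measurableT ig.
have [d [d0 hd]] := integral_normr_continuous icg e0.
exists d => // x u ux.
have mI : measurable (`[Num.min x u, Num.max x u]%classic : set TR) by exact: measurable_itv.
have muI : (mu `[Num.min x u, Num.max x u]%classic < d%:E)%E.
  rewrite lebesgue_measure_itv/= lte_fin; case: ifP => _; last by rewrite lte_fin.
  rewrite -EFinB lte_fin; apply: le_lt_trans ux.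
  have [xu|xu] := leP x u; first exact: ler_norm.
  by rewrite distrC ler_norm.
apply: le_lt_trans (hd _ mI muI); apply: le_Rintegral => //.
- exact: integrableS icg.
- exact: integrableS (integrable_norm icg).
- by move=> t _; rewrite ler_norm.
Qed.

Lemma conv_taylor_small p x : (p < 3)%N -> 0 <= x -> x <= l ->
  forall e, 0 < e -> exists2 r, 0 < r & forall u, 0 <= u -> u <= l -> `|u - x| < r ->
  cmod (conv (s_quot p w) g u - conv (s_quot p w) g x
    - (u - x)%:C * conv (s_quot_deriv w p) g x
    - (p == 0%N)%:R * (indefinite g u - indefinite g x)) <= e * `|u - x|.
Proof.
move=> p3 x0 xl e e0.
have c1 : 0 < 2 * C1 + 1 by rewrite ltr_wpDl// mulr_ge0// C1_ge0.
have c2 : 0 < C1 * J + 1 by rewrite ltr_wpDl// mulr_ge0 ?C1_ge0 ?J_ge0.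
have e2 : 0 < e / 2 by rewrite divr_gt0.
have [r r0 hr] := small_mass (divr_gt0 e2 c1).
exists (Num.min r (e / 2 / (C1 * J + 1))).
  by rewrite lt_min r0 divr_gt0.
move=> u u0 ul; rewrite lt_min => /andP[ur ue].
apply: (le_trans (conv_taylor p3 x0 xl u0 ul)).
have := hr x u ur; rewrite ltr_pdivlMr//; move: ue; rewrite ltr_pdivlMr//.
have := C1_ge0; have := J_ge0.
have : 0 <= Rintegral mu `[Num.min x u, Num.max x u] (fun t : TR => cmod (g t)).
  by apply: Rintegral_ge0 => t _; exact: cmod_ge0.
have := normr_ge0 (u - x).
move: (Rintegral _ _ _) => m; move: J C1 `|u - x| => j c d d0 m0 j0 c0 hd hm.
have cj : 0 <= c * j by rewrite mulr_ge0.
rewrite (_ : c * j * d ^+ 2 + 2 * c * d * m = (c * j * d + 2 * c * m) * d); last by ring.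
rewrite ler_wpM2r// (splitr e) lerD//; apply: ltW.
  by apply: le_lt_trans hd; rewrite mulrC ler_wpM2l// lerDl.
by apply: le_lt_trans hm; rewrite mulrC ler_wpM2l// lerDl.
Qed.

Lemma conv_deriv_le x : 0 <= x -> x <= l ->
  cmod (conv (s_quot_deriv w 0) g x) <= C * J.
Proof.
move=> x0 xl; rewrite -RintegralZl//; last exact: cint_cmod.
have [_ i0] := conv_cint (isT : (0 < 3)%N) x0 xl.
apply: cmod_cintegral_le => //; [exact: cint_meas|exact: abs_int_scale|].
move=> t _; have [/andP[t0 tl]|/g0 ->] := boolP ((0 < t) && (t < l)); last first.
  by rewrite mulr0 cmod0 mulr0.
rewrite cmodM ler_wpM2r ?cmod_ge0// /causal; case: ifP => xt; last by rewrite cmod0.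
by apply: h2 => //; rewrite ger0_norm//; lra.
Qed.

Lemma indefinite_sub_le a b : a <= b ->
  cmod (indefinite g b - indefinite g a) <= Rintegral mu `]a, b[ (fun t : TR => cmod (g t)).
Proof.
move=> ab; have icg := cint_cmod measurableT ig.
have mI : measurable (`]a, b]%classic : set TR) by exact: measurable_itv.
have hb := half_line_cint b ig; have ha := half_line_cint a ig.
rewrite Rintegral_itv_bndo_bndc; last by apply: integrableS icg.
rewrite /indefinite -(cintegralB measurableT hb ha) Rintegral_mkcond.
apply: cmod_cintegral_le => //.
- by apply: cmeasB; exact: cint_meas.
- have := (integrable_mkcond (EFin \o (fun t : TR => cmod (g t))) mI).1.
  by rewrite restrict_EFin; apply; exact: integrableS icg.
- move=> t _; rewrite patchE mem_setE in_itv/=.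
  have [ta|at_] := leP t a; first by rewrite (le_trans ta ab) subrr cmod0.
  by case: ifP => _; rewrite subr0 ?cmod0.
Qed.

(** All contributions but the increment of the indefinite integral are Lipschitz. The constant
    collects the derivative (C J), the quadratic remainder with b - a <= l, and the strip, whose
    integral is bounded by J. *)
Lemma conv0_abs_cont_aux : abs_cont 0 l (conv (s_quot 0 w) g).
Proof.
have j0 := J_ge0; have c10 := C1_ge0.
have K0 : 0 <= C * J + C1 * J * l + 2 * C1 * J.
  have l0' := ltW l0; have cj := mulr_ge0 c10 j0.
  by have := mulr_ge0 C0 j0; have := mulr_ge0 cj l0'; lra.
apply: (abs_cont_bound K0 ig) => a b a0 ab bl.
have al := le_trans ab bl; have b0 := le_trans a0 ab.
have := conv_taylor (isT : (0 < 3)%N) a0 al b0 bl.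
rewrite mul1r ger0_norm ?subr_ge0//.
have mI : measurable (`[Num.min a b, Num.max a b]%classic : set TR) by exact: measurable_itv.
have := cmod_int_sub mI; have := conv_deriv_le a0 al; have := indefinite_sub_le ab.
move=> hG hd hI hT.
rewrite -[conv _ g b - _](subrK ((b - a)%:C * conv (s_quot_deriv w 0) g a)).
rewrite -[conv _ g b - _ - _](subrK (indefinite g b - indefinite g a)) addrAC.
apply: (le_trans (cmodD _ _)); apply: lerD hG; apply: (le_trans (cmodD _ _)).
have ba : 0 <= b - a by rewrite subr_ge0.
have bal : b - a <= l by lra.
rewrite cmodM cmodC ger0_norm//.
apply: (@le_trans _ _ ((C1 * J * (b - a) ^+ 2 + 2 * C1 * (b - a) * J) + (b - a) * (C * J))).
  apply: lerD; last by rewrite ler_wpM2l.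
  by apply: (le_trans hT); rewrite lerD2l ler_wpM2l// mulr_ge0// mulr_ge0.
have h : C1 * J * (b - a) ^+ 2 <= C1 * J * (l * (b - a)).
  by rewrite expr2 ler_wpM2l ?(mulr_ge0 c10 j0)// ler_wpM2r.
by move: h; move: (C1) J => c j h; lra.
Qed.

Lemma conv_origin (k : R -> R[i]) : conv k g 0 = 0.
Proof.
rewrite /conv cintegral0// => t _; have [/andP[t0 tl]|/g0 ->] := boolP ((0 < t) && (t < l)).
  by rewrite /causal sub0r oppr_ge0 leNgt t0 mul0r.
by rewrite mulr0.
Qed.

End ConvolutionEstimate.

Variable g : TR -> R[i].
Hypothesis ig : cint setT g.
Hypothesis g0 : forall t, ~~ ((0 < t) && (t < l)) -> g t = 0.

(** The kernel of index p+1 vanishes at 0, so there is no jump term and the derivative exists at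
    every point. *)
Lemma conv_has_deriv p x : (p < 2)%N -> 0 <= x -> x <= l ->
  has_deriv l (conv (s_quot p.+1 w) g) x (conv (s_quot p w) g x).
Proof.
move=> p2 x0 xl; have [C C0 [h1 h2 h3 _]] := s_quot_bounds w (ltW l0).
apply/has_derivP => e e0.
have [r r0 hr] := conv_taylor_small C0 h1 h2 h3 ig g0 (p2 : (p.+1 < 3)%N) x0 xl e0.
exists r => // u u0 ul ur.
by have := hr u u0 ul ur; rewrite mul0r subr0.
Qed.

Lemma conv_deriv0E x : 0 <= x -> x <= l ->
  conv (s_quot_deriv w 0) g x = w ^+ 3 * conv (s_quot 2 w) g x.
Proof.
move=> x0 xl; have [C C0 [h1 h2 h3 _]] := s_quot_bounds w (ltW l0).
have [i2 _] := conv_cint C0 h1 h2 ig g0 (isT : (2 < 3)%N) x0 xl.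
rewrite /conv -(cintegralZ (w ^+ 3) measurableT i2); apply: eq_cintegral => t _.
by rewrite /causal/=; case: ifP => _; ring.
Qed.

(** The indefinite integral of g absorbs the jump: the convolution minus it is differentiable at
    every point, while the indefinite integral has derivative g almost everywhere. *)
Lemma conv0_has_deriv :
  {ae mu, forall x, x \in `]0, l[ ->
    has_deriv l (conv (s_quot 0 w) g) x (w ^+ 3 * conv (s_quot 2 w) g x + g x)}.
Proof.
have FF := ae_filter_ringOfSetsType mu.
apply: filterS (indefinite_deriv ig) => x Gx; rewrite in_itv/= => /andP[/ltW x0 /ltW xl].
have [C C0 [h1 h2 h3 _]] := s_quot_bounds w (ltW l0).
have H : has_deriv l (fun u => conv (s_quot 0 w) g u - indefinite g u) x (w ^+ 3 * conv (s_quot 2 w) g x).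
  apply/has_derivP => e e0.
  have [r r0 hr] := conv_taylor_small C0 h1 h2 h3 ig g0 (isT : (0 < 3)%N) x0 xl e0.
  exists r => // u u0 ul ur.
  have := hr u u0 ul ur; rewrite mul1r conv_deriv0E//.
  set A := conv _ _ u; set B := conv _ _ x; set D := _ * _; set E := indefinite g u.
  set F := indefinite g x; move: A B D E F => A B D E F.
  by rewrite (_ : A - E - (B - F) - D = A - B - D - (E - F)); last by ring.
have := has_derivD H Gx; apply: eq_has_deriv => // t _ _.
by rewrite subrK.
Qed.

Lemma conv0_abs_cont : abs_cont 0 l (conv (s_quot 0 w) g).
Proof.
have [C C0 [h1 h2 h3 _]] := s_quot_bounds w (ltW l0).
exact: (conv0_abs_cont_aux C0 h1 h2 h3 ig g0).
Qed.

Lemma s_quot_has_deriv p x : (p < 3)%N -> 0 <= x -> x <= l ->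
  has_deriv l (s_quot p w) x (s_quot_deriv w p x).
Proof.
move=> p3 x0 xl; have [C C0 [h1 h2 h3 _]] := s_quot_bounds w (ltW l0).
apply/has_derivP => e e0.
have c1 : 0 < C + 1 by rewrite ltr_wpDl.
exists (e / (C + 1)); first by rewrite divr_gt0.
move=> u u0 ul; rewrite ltr_pdivlMr// => ue.
have := h3 p x u p3; rewrite (ger0_norm x0) (ger0_norm u0) => /(_ xl ul)/le_trans; apply.
rewrite expr2 mulrA ler_wpM2r// (le_trans _ (ltW ue))// mulrC ler_wpM2l// lerDl//.
Qed.

Lemma s_quot_abs_cont p : (p < 3)%N -> abs_cont 0 l (s_quot p w).
Proof.
move=> p3; have [C C0 [h1 h2 h3 _]] := s_quot_bounds w (ltW l0).
have K0 : 0 <= C * l + C by rewrite addr_ge0// mulr_ge0// ltW.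
have i0 : cint setT (fun _ : TR => 0 : R[i]) by split; exact: integrable0.
apply: (abs_cont_bound K0 i0) => a b a0 ab bl.
have al := le_trans ab bl; have b0 := le_trans a0 ab.
rewrite ler_wpDr//; first by apply: Rintegral_ge0 => t _; exact: cmod_ge0.
have := h3 p a b p3; rewrite !ger0_norm ?subr_ge0// => /(_ al bl) h.
have := h2 p a p3; rewrite ger0_norm// => /(_ al) hd.
have ba : 0 <= b - a by rewrite subr_ge0.
have -> : s_quot p w b - s_quot p w a = (s_quot p w b - s_quot p w a
  - (b - a)%:C * s_quot_deriv w p a) + (b - a)%:C * s_quot_deriv w p a by ring.
apply: (le_trans (cmodD _ _)); rewrite mulrDl cmodM cmodC (ger0_norm ba) lerD//.
  by apply: (le_trans h); rewrite expr2 mulrA ler_wpM2r// ler_wpM2l//; lra.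
by rewrite mulrC ler_wpM2r.
Qed.

End Convolution.

(** * Functions with a third derivative in the Caratheodory sense *)

Section ThirdOrder.
Variables (R : realType) (l : R).
Local Notation mu := (@lebesgue_measure R).
Local Notation TR := (measurableTypeR R).
Hypothesis l0 : 0 < l.
Local Notation k_ := (fun p => s_quot p (0 : R[i])).

(* Taylor's formula with integral remainder for a Caratheodory third derivative h:
   [s_quot p 0 x] is x^p/p!. *)
Lemma third_order_repr (y dy ddy : R -> R[i]) (h : TR -> R[i]) :
  (forall x, 0 <= x -> x <= l -> has_deriv l y x (dy x)) ->
  (forall x, 0 <= x -> x <= l -> has_deriv l dy x (ddy x)) ->
  abs_cont 0 l ddy -> cint setT h ->
  (forall t, ~~ ((0 < t) && (t < l)) -> h t = 0) ->
  {ae mu, forall x, x \in `]0, l[ -> has_deriv l ddy x (h x)} ->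
  forall x, 0 <= x -> x <= l ->
    y x = y 0 * k_ 0%N x + dy 0 * k_ 1%N x + ddy 0 * k_ 2%N x + conv (k_ 2%N) h x.
Proof.
move=> y1 y2 ac ih h0 y3.
have FF := ae_filter_ringOfSetsType mu.
have d0 x : 0 <= x -> x <= l -> has_deriv l (k_ 0%N) x 0.
  move=> x0 xl; have := s_quot_has_deriv (w := 0) l0 (isT : (0 < 3)%N) x0 xl.
  by rewrite /= expr0n/= mul0r.
have d1 x : 0 <= x -> x <= l -> has_deriv l (k_ 1%N) x (k_ 0%N x).
  by move=> x0 xl; exact: (s_quot_has_deriv (w := 0) l0 (isT : (1 < 3)%N)).
have d2 x : 0 <= x -> x <= l -> has_deriv l (k_ 2%N) x (k_ 1%N x).
  by move=> x0 xl; exact: (s_quot_has_deriv (w := 0) l0 (isT : (2 < 3)%N)).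
have c0 := conv_origin h0.
have z0 : k_ 0%N 0 = 1 by rewrite s_quot0.
have z1 : k_ 1%N 0 = 0 by rewrite s_quot0.
have z2 : k_ 2%N 0 = 0 by rewrite s_quot0.
(* [e2], [e1] and [e] are the remainders of y'', y' and y. First e2 is absolutely continuous with
   e2' = 0 almost everywhere; then e1' = e2 = 0 and e' = e1 = 0 at every point. *)
pose e2 x := ddy x - ddy 0 * k_ 0%N x - conv (k_ 0%N) h x.
have e20 x : 0 <= x -> x <= l -> e2 x = 0.
  move=> x0 xl; have -> : 0 = e2 0 by rewrite /e2 z0 mulr1 subrr c0 subr0.
  apply: (abs_cont_deriv0_const l0) x0 xl.
    have acB f g : abs_cont 0 l f -> abs_cont 0 l g -> abs_cont 0 l (fun x => f x - g x).
      move=> af ag; have := abs_contD af (abs_contZ (-1) ag).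
      by under [X in abs_cont _ _ X -> _]eq_fun do rewrite mulN1r.
    apply: (acB) (conv0_abs_cont _ l0 ih h0); apply: (acB) => //.
    by apply: abs_contZ; exact: s_quot_abs_cont.
  apply: filterS2 y3 (conv0_has_deriv 0 l0 ih h0) => t yt ct tl.
  have := tl; rewrite in_itv/= => /andP[/ltW t0 /ltW tl'].
  have := has_derivB (has_derivB (yt tl) (has_derivZ (c := ddy 0) (d0 t t0 tl'))) (ct tl).
  by rewrite expr0n/= mul0r add0r mulr0 subr0 subrr.
pose e1 x := dy x - dy 0 * k_ 0%N x - ddy 0 * k_ 1%N x - conv (k_ 1%N) h x.
have e10 x : 0 <= x -> x <= l -> e1 x = 0.
  move=> x0 xl; have -> : 0 = e1 0 by rewrite /e1 z0 z1 mulr1 mulr0 subrr c0 !subr0.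
  apply: has_deriv0_const x0 xl => t t0 tl.
  have := has_derivB (has_derivB (has_derivB (y2 t t0 tl) (has_derivZ (c := dy 0) (d0 t t0 tl)))
    (has_derivZ (c := ddy 0) (d1 t t0 tl))) (conv_has_deriv (w := 0) l0 ih h0 (isT : (0 < 2)%N) t0 tl).
  by rewrite mulr0 subr0 -/(e2 t) e20.
pose e x := y x - y 0 * k_ 0%N x - dy 0 * k_ 1%N x - ddy 0 * k_ 2%N x - conv (k_ 2%N) h x.
move=> x x0 xl; suff : e x = 0.
  move/eqP; rewrite /e !subr_eq add0r => /eqP ->; ring.
have -> : 0 = e 0 by rewrite /e z0 z1 z2 mulr1 !mulr0 subrr c0 !subr0.
apply: has_deriv0_const x0 xl => t t0 tl.
have := has_derivB (has_derivB (has_derivB (has_derivB (y1 t t0 tl) (has_derivZ (c := y 0) (d0 t t0 tl)))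
   (has_derivZ (c := dy 0) (d1 t t0 tl)))
    (has_derivZ (c := ddy 0) (d2 t t0 tl))) (conv_has_deriv (w := 0) l0 ih h0 (isT : (1 < 2)%N) t0 tl).
by rewrite mulr0 subr0 -/(e1 t) e10.
Qed.

End ThirdOrder.

(** * The Cauchy problem *)

Section CauchyProblem.
Variables (R : realType) (l : R) (q : R -> R) (lam : R[i]) (y1 y2 : R[i]).
Local Notation mu := (@lebesgue_measure R).
Local Notation TR := (measurableTypeR R).
Hypothesis l0 : 0 < l.
Hypothesis qL2 : L2 0 l (fun x => (q x)%:C).
Local Notation w := ('i%C * lam).
Local Notation y0 := (y0_sol lam y1 y2).

Lemma eq_L2 (f g : R -> R[i]) : (forall x, 0 < x -> x < l -> f x = g x) -> L2 0 l f -> L2 0 l g.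
Proof.
move=> fg /L2P[mf fi]; apply/L2P; split.
  apply: eq_cmeas mf => x; rewrite inE/= in_itv/= => /andP[x0 xl]; exact: fg.
apply: eq_integrable fi => // x; rewrite inE/= in_itv/= => /andP[x0 xl].
by rewrite fg.
Qed.

(** The right-hand side h is kept apart from u, so that two functions can be compared with the same
    g in h = W u + g. *)
Definition third_deriv_problem (u h : R -> R[i]) : Prop := exists du ddu : R -> R[i],
  [/\ forall x, 0 <= x -> x <= l -> has_deriv l u x (du x),
      forall x, 0 <= x -> x <= l -> has_deriv l du x (ddu x),
      abs_cont 0 l ddu,
      {ae mu, forall x, x \in `]0, l[ -> has_deriv l ddu x (h x)} &
      [/\ u 0 = 0, du 0 = y1 & ddu 0 = y2]].

Lemma third_deriv_problem_ext (u v h k : R -> R[i]) :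
  (forall x, 0 <= x -> x <= l -> u x = v x) -> (forall x, 0 < x -> x < l -> h x = k x) ->
  third_deriv_problem u h -> third_deriv_problem v k.
Proof.
move=> uv hk [du [ddu [d1 d2 ac ae [i0 i1 i2]]]]; exists du, ddu; split; [|exact: d2|exact: ac| |].
- by move=> x x0 xl; exact: (eq_has_deriv x0 xl uv (d1 x x0 xl)).
- have FF := ae_filter_ringOfSetsType mu; apply: filterS ae => x hx xl.
  by have := xl; rewrite in_itv/= => /andP[x0 x1]; rewrite -hk//; exact: hx.
- by split=> //; rewrite -uv// ltW.
Qed.

(** The equation multiplied by -i, with w^3 = -i lam^3. *)
Lemma Cauchy_solutionP (y : R -> R[i]) : Cauchy_solution l q lam y1 y2 y <->
  third_deriv_problem y (fun x => w ^+ 3 * y x + 'i%C * (q x)%:C * y x).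
Proof.
have i2 : 'i%C ^+ 2 = -1 :> R[i] by rewrite sqr_i.
have FF := ae_filter_ringOfSetsType mu.
split=> -[dy [ddy [d1 d2 ac ae ini]]]; exists dy, ddy; split=> //.
- by move=> x x0 xl; apply: d1; rewrite in_itv/= x0.
- by move=> x x0 xl; apply: d2; rewrite in_itv/= x0.
- apply: filterS ae => x hx xl; have [d3 hd e3] := hx xl.
  suff <- : d3 = w ^+ 3 * y x + 'i%C * (q x)%:C * y x by [].
  have -> : d3 = - ('i%C ^+ 2) * d3 by rewrite i2 opprK mul1r.
  have -> : - 'i%C ^+ 2 * d3 = - 'i%C * ('i%C * d3 + (q x)%:C * y x) + 'i%C * (q x)%:C * y x by ring.
  rewrite e3 (_ : w ^+ 3 = 'i%C ^+ 2 * 'i%C * lam ^+ 3); last by ring.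
  by rewrite i2; ring.
- by move=> x; rewrite in_itv/= => /andP[]; exact: d1.
- by move=> x; rewrite in_itv/= => /andP[]; exact: d2.
- apply: filterS ae => x hx xl; exists (w ^+ 3 * y x + 'i%C * (q x)%:C * y x); first exact: hx.
  rewrite (_ : w ^+ 3 = 'i%C ^+ 2 * 'i%C * lam ^+ 3); last by ring.
  rewrite (_ : _ + _ = ('i%C ^+ 2 * 'i%C ^+ 2) * lam ^+ 3 * y x + ('i%C ^+ 2 + 1) * (q x)%:C * y x); last by ring.
  by rewrite i2; ring.
Qed.

Lemma conv_problem (g : TR -> R[i]) : cint setT g ->
  (forall t, ~~ ((0 < t) && (t < l)) -> g t = 0) ->
  third_deriv_problem (fun x => y0 x + conv (s_quot 2 w) g x)
    (fun x => w ^+ 3 * (y0 x + conv (s_quot 2 w) g x) + g x).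
Proof.
move=> ig g0; have FF := ae_filter_ringOfSetsType mu.
exists (fun x => y1 * s_quot 0 w x + y2 * s_quot 1 w x + conv (s_quot 1 w) g x).
exists (fun x => y1 * w ^+ 3 * s_quot 2 w x + y2 * s_quot 0 w x + conv (s_quot 0 w) g x).
have s0 x : 0 <= x -> x <= l -> has_deriv l (s_quot 0 w) x (w ^+ 3 * s_quot 2 w x).
  exact: (s_quot_has_deriv l0 (isT : (0 < 3)%N)).
have s1 x : 0 <= x -> x <= l -> has_deriv l (s_quot 1 w) x (s_quot 0 w x).
  exact: (s_quot_has_deriv l0 (isT : (1 < 3)%N)).
have s2 x : 0 <= x -> x <= l -> has_deriv l (s_quot 2 w) x (s_quot 1 w x).
  exact: (s_quot_has_deriv l0 (isT : (2 < 3)%N)).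
have c0 k := conv_origin g0 k.
split.
- move=> x x0 xl; apply: has_derivD; last exact: (conv_has_deriv l0 ig g0 (isT : (1 < 2)%N)).
  by apply: has_derivD; apply: has_derivZ; [exact: s1|exact: s2].
- move=> x x0 xl; apply: has_derivD; last exact: (conv_has_deriv l0 ig g0 (isT : (0 < 2)%N)).
  by rewrite -mulrA; apply: has_derivD; apply: has_derivZ; [exact: s0|exact: s1].
- apply: abs_contD; last exact: conv0_abs_cont.
  by apply: abs_contD; apply: abs_contZ; exact: s_quot_abs_cont.
- apply: filterS (conv0_has_deriv w l0 ig g0) => x hx xl.
  have := xl; rewrite in_itv/= => /andP[/ltW x0 /ltW x1].
  have := has_derivD (has_derivD (has_derivZ (c := y1 * w ^+ 3) (s2 x x0 x1))
    (has_derivZ (c := y2) (s0 x x0 x1))) (hx xl).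
  rewrite (_ : _ + _ + _ = w ^+ 3 * (y0 x + conv (s_quot 2 w) g x) + g x)//.
  by rewrite /y0_sol; ring.
- by rewrite /y0_sol !c0 !s_quot0//= !(mulr0, mulr1, addr0, add0r).
Qed.

(** The polynomial kernels of w = 0 are used whatever h is; a term W u counts as part of h. *)
Lemma third_deriv_repr (u h : R -> R[i]) : third_deriv_problem u h ->
  cint setT (fcut l h : TR -> _) -> forall x, 0 <= x -> x <= l ->
  u x = y1 * s_quot 1 0 x + y2 * s_quot 2 0 x + conv (s_quot 2 0) (fcut l h) x.
Proof.
move=> [du [ddu [d1 d2 ac ae [i0 i1 i2]]]] ih x x0 xl.
have h0 t : ~~ ((0 < t) && (t < l)) -> fcut l h t = 0 by rewrite /fcut => /negbTE ->.
have FF := ae_filter_ringOfSetsType mu.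
have ae' : {ae mu, forall x, x \in `]0, l[ -> has_deriv l ddu x (fcut l h x)}.
  apply: filterS ae => t ht tl; have := tl; rewrite in_itv/= => t0.
  by rewrite /fcut t0; exact: ht.
by rewrite (third_order_repr l0 d1 d2 ac ih h0 ae' x0 xl) i0 i1 i2 mul0r add0r.
Qed.

Lemma third_deriv_L2 (u h : R -> R[i]) : third_deriv_problem u h -> L2 0 l u.
Proof.
move=> [du [ddu [d1 _ _ _ _]]]; have [B B0 hB] := has_deriv_bounded (ltW l0) d1.
apply: (L2_bounded (has_deriv_cmeas d1)) => x x0 xl.
by apply: hB; exact: ltW.
Qed.

Lemma fcut_cint (f : R -> R[i]) : L2 0 l f -> cint setT (fcut l f : TR -> _).
Proof.
(* The case q = 1 of the integrability of q f. *)
move=> f2; have := qf_cint (one_L2 l : L2 0 l (fun x => ((fun=> 1) x : R)%:C)) f2.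
apply: eq_cint => // x _; rewrite /qf /qcut /fcut; case: ifP => _; rewrite ?mul1r ?mulr0//.
Qed.

Lemma tK_conv (g : TR -> R[i]) x : (forall t, ~~ ((0 < t) && (t < l)) -> g t = 0) ->
  0 <= x -> x <= l -> tK l q lam g x = conv (s_quot 2 w) g x.
Proof.
move=> g0 x0 xl; apply: eq_cintegral => t _.
have [/andP[t0 _]|/g0 ->] := boolP ((0 < t) && (t < l)); last by rewrite !mulr0.
by rewrite /Ktri /in_tri (ltW t0) xl andbT/= /causal subr_ge0.
Qed.

End CauchyProblem.

(** * Uniqueness for the Cauchy problem *)

Section CauchyUniqueness.
Variables (R : realType) (l : R) (lam : R[i]) (y1 y2 : R[i]).
Local Notation TR := (measurableTypeR R).
Hypothesis l0 : 0 < l.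

(** In the Taylor formulas for y and z the initial values and g cancel, so d = y - z is W times its
    convolution with x^2/2. This is a step of the iteration for lam = 0 and q = 1, to which
    [vstep_unique] applies. *)
Lemma third_deriv_unique (W : R[i]) (y z g : R -> R[i]) : cint setT (fcut l g : TR -> _) ->
  third_deriv_problem l y1 y2 y (fun x => W * y x + g x) ->
  third_deriv_problem l y1 y2 z (fun x => W * z x + g x) ->
  forall x, 0 <= x -> x <= l -> y x = z x.
Proof.
move=> ig Py Pz.
have y2' := third_deriv_L2 l0 Py; have z2' := third_deriv_L2 l0 Pz.
pose d x := y x - z x.
have d2 : L2 0 l d by exact: L2B.
have id := fcut_cint d2.
have ih u : L2 0 l u -> cint setT (fcut l (fun x => W * u x + g x) : TR -> _).
  move=> u2; apply: (eq_cint measurableT _ (cintD measurableT (cintZ W measurableT (fcut_cint u2)) ig)).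
  by move=> x _; rewrite /fcut; case: ifP => _; rewrite ?mulr0 ?addr0.
have one2 : L2 0 l (fun x => ((fun=> 1) x : R)%:C) := one_L2 l.
have hs0 (f : R -> R[i]) t : ~~ ((0 < t) && (t < l)) -> fcut l f t = 0.
  by rewrite /fcut => /negbTE ->.
have [C C0 [KC _]] := Ktri1_bound_ex (fun=> 1) 0 l0.
have dE x : 0 <= x -> x <= l -> d x = W * vstep l (fun=> 1) 0 (fcut l d) x.
  move=> x0 xl.
  have i1 := ih y y2'; have i2 := ih z z2'.
  rewrite /d (third_deriv_repr l0 Py i1 x0 xl) (third_deriv_repr l0 Pz i2 x0 xl).
  have -> (a b c e : R[i]) : a + b + c - (a + b + e) = c - e by ring.
  have tc (f : R -> R[i]) : conv (s_quot 2 0) (fcut l f) x = tK l (fun=> 1) 0 (fcut l f) x.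
    by rewrite (tK_conv _ _ (hs0 f) x0 xl) mulr0.
  have kc (f : R -> R[i]) := bounded_kernel_cint (Ktri1_cmeas l (fun=> 1) 0) (Ktri1_bnd l0 C0 KC) x (g := fcut l f).
  rewrite !tc /tK -(cintegralB measurableT (kc _ i1) (kc _ i2)).
  have kq : cint setT (fun s : TR => Ktri l (fun=> 1) 0 1 x s * (qcut l (fun=> 1) s)%:C * fcut l d s).
    apply: (eq_cint measurableT _ (kc _ id)) => t _.
    by rewrite /qcut /fcut; case: ifP => _; rewrite ?mulr0 ?mulr1.
  rewrite /vstep -(cintegralZ W measurableT kq); apply: eq_cintegral => t _.
  by rewrite /qcut /fcut /d; case: ifP => _; rewrite ?mulr0 ?subrr// mulr1; ring.
have [B B0 hB] : exists2 B, 0 <= B & forall x, 0 <= x -> x <= l -> cmod (d x) <= B.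
  have [dy [ddy [dy1 _ _ _ _]]] := Py; have [dz [ddz [dz1 _ _ _ _]]] := Pz.
  apply: (has_deriv_bounded (f' := fun x => dy x - dz x) (ltW l0)) => x x0 xl.
  exact: has_derivB (dy1 x x0 xl) (dz1 x x0 xl).
have u0 : forall s, 0 <= s -> s <= l -> fcut l d s = 0.
  apply: (vstep_unique (qcut_int one2) C0 KC (cmod_ge0 W) B0).
  - exact: cint_meas id.
  - by move=> s s0; rewrite /fcut ltNge (ltW s0).
  - by move=> s s0 sl; rewrite /fcut; case: ifP => _; [exact: hB|rewrite cmod0].
  - move=> s s0 sl; rewrite {1}/fcut; case: ifP => _; last first.
      by rewrite cmod0; apply: mulr_ge0; exact: cmod_ge0.
    by rewrite dE// cmodM.
(* [u0] gives d = 0 inside (0,l) only; the integral equation for d carries this to the endpoints. *)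
move=> x x0 xl; apply/eqP; rewrite -subr_eq0 -/(d x) dE//.
rewrite /vstep cintegral0 ?mulr0// => s _.
have [/andP[/ltW s0 /ltW sl]|/(hs0 d) ->] := boolP ((0 < s) && (s < l)); last by rewrite mulr0.
by rewrite u0// mulr0.
Qed.

End CauchyUniqueness.

(** * The Cauchy problem as an integral equation, and its solution by I + T *)

Section CauchySolution.
Variables (R : realType) (l : R) (q : R -> R) (lam : R[i]) (y1 y2 : R[i]).
Local Notation TR := (measurableTypeR R).
Hypothesis l0 : 0 < l.
Hypothesis qL2 : L2 0 l (fun x => (q x)%:C).
Local Notation w := ('i%C * lam).
Local Notation y0 := (y0_sol lam y1 y2).

(** As the case g = 0 of [conv_problem], y0 has derivatives on [0,l], hence is bounded and
    measurable. *)
Lemma y0_L2 : L2 0 l y0.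
Proof.
have i0 : cint setT (fun _ : TR => 0 : R[i]) by split; exact: integrable0.
have P := conv_problem lam y1 y2 l0 i0 (fun _ _ => erefl).
apply: eq_L2 (third_deriv_L2 l0 P) => x _ _.
by rewrite /conv cintegral0 ?addr0// => t _; rewrite mulr0.
Qed.

(** With g = i q y, both y and z = y0 + iK y solve u''' = w^3 u + g with the same initial values, so
    they coincide. Conversely z solves this problem, and y = z turns g into i q z. *)
Lemma Cauchy_solution_integral (y : R -> R[i]) : Cauchy_solution l q lam y1 y2 y <->
  L2 0 l y /\ forall x, 0 <= x -> x <= l -> y x = y0 x + iKop q lam y x.
Proof.
pose g (f : R -> R[i]) x := 'i%C * qf l q f x.
have gE f x : 0 < x -> x < l -> g f x = 'i%C * (q x)%:C * f x.
  by move=> x0 xl; rewrite /g /qf /qcut /fcut x0 xl mulrA.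
have gs f t : ~~ ((0 < t) && (t < l)) -> g f t = 0.
  by rewrite /g /qf /fcut => /negbTE ->; rewrite !mulr0.
have gc f : L2 0 l f -> cint setT (g f : TR -> _).
  by move=> f2; apply: cintZ => //; exact: qf_cint.
have zE f x : L2 0 l f -> 0 <= x -> x <= l ->
    y0 x + conv (s_quot 2 w) (g f) x = y0 x + iKop q lam f x.
  move=> f2 x0 xl; rewrite -(tK_conv q _ (gs f) x0 xl) /iKop (Kop_tK lam l0 qL2 x0 xl f2).
  have [C C0 [KC _]] := Ktri1_bound_ex q lam l0.
  have kc := bounded_kernel_cint (Ktri1_cmeas l q lam) (Ktri1_bnd l0 C0 KC) x (qf_cint qL2 f2).
  rewrite /tK -(cintegralZ 'i%C measurableT kc); congr (_ + _); apply: eq_cintegral => t _.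
  by rewrite /g mulrCA.
split=> [/Cauchy_solutionP Py|[y2' yE]].
  have y2' := third_deriv_L2 l0 Py; split=> // x x0 xl; rewrite -zE//.
  have Pz := conv_problem lam y1 y2 l0 (gc y y2') (gs y).
  have Py' : third_deriv_problem l y1 y2 y (fun x => w ^+ 3 * y x + g y x).
    by apply: third_deriv_problem_ext Py => // t t0 tl; rewrite gE.
  have ig : cint setT (fcut l (g y) : TR -> _).
    apply: (eq_cint measurableT _ (gc y y2')) => t _.
    by rewrite /fcut; case: ifPn => // /gs ->.
  exact: (third_deriv_unique l0 ig Py' Pz).
apply/Cauchy_solutionP; apply: third_deriv_problem_ext (conv_problem lam y1 y2 l0 (gc y y2') (gs y)).
- exact: l0.
- by move=> x x0 xl; rewrite zE// yE.
- by move=> x x0 xl; rewrite zE ?ltW// -yE ?ltW// gE.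
Qed.

(** A solution y and y0 + T y0 both satisfy u - iK u = y0. Injectivity gives equality almost
    everywhere, and [Kop_eq_ae] improves it to every point of [0,l]. *)
Lemma Cauchy_solution_Top (y : R -> R[i]) : Cauchy_solution l q lam y1 y2 y <->
  forall x, x \in `[0, l] -> y x = y0 x + Top q lam y0 x.
Proof.
have z2 : L2 0 l (fun x => y0 x + Top q lam y0 x) by apply: L2D; [exact: y0_L2|exact: Top_L2 y0_L2].
have KE (f : R -> R[i]) x : L2 0 l f -> ae_equal 0 l f (fun x => y0 x + Top q lam y0 x) ->
    0 <= x -> x <= l -> y0 x + iKop q lam f x = y0 x + Top q lam y0 x.
  move=> f2 fy x0 xl; rewrite /iKop (Kop_eq_ae lam l0 qL2 x0 xl f2 z2 fy).
  have := ImiKop_IpT lam l0 qL2 x0 xl y0_L2; rewrite /ImiKop /iKop.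
  by move/eqP; rewrite subr_eq => /eqP.
split=> [/Cauchy_solution_integral[y2' yE] x|yE].
  rewrite in_itv/= => /andP[x0 xl]; rewrite yE// KE//.
  apply: (ImiKop_inj (lam := lam) l0 qL2) => //; apply: ae_equal_pt => t /ltW t0 /ltW tl.
  by rewrite (ImiKop_IpT lam l0 qL2 t0 tl y0_L2) /ImiKop {1}yE// addrK.
have y2' : L2 0 l y.
  by apply: eq_L2 z2 => x /ltW x0 /ltW xl; rewrite yE// in_itv/= x0.
apply/Cauchy_solution_integral; split=> // x x0 xl; rewrite KE//.
  by apply: yE; rewrite in_itv/= x0.
by apply: ae_equal_pt => t /ltW t0 /ltW tl; rewrite yE// in_itv/= t0.
Qed.

End CauchySolution.

(** The case q = 0, in which T vanishes. *)
Lemma Cauchy_solution_free (R : realType) (l : R) (lam y1 y2 : R[i]) (y : R -> R[i]) : 0 < l ->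
  Cauchy_solution l (fun=> 0) lam y1 y2 y <->
  forall x, x \in `[0, l] -> y x = y0_sol lam y1 y2 x.
Proof.
move=> l0.
have q2 : L2 0 l (fun x => ((fun=> 0) x : R)%:C).
  by apply: (L2_bounded (A := 0)) => [|x _ _]; [exact: cmeas_cst|rewrite cmod0].
have T0 f x : L2 0 l f -> 0 <= x -> x <= l -> Top (fun=> 0) lam f x = 0.
  move=> f2 x0 xl; rewrite (Top_tT lam l0 q2 x0 xl f2) /tT cintegral0// => t _.
  by rewrite /qf /qcut if_same mul0r mulr0.
have y2' := y0_L2 lam y1 y2 l0.
split=> [/(Cauchy_solution_Top lam y1 y2 l0 q2) yE x xl|yE].
  by have := xl; rewrite in_itv/= yE// => /andP[x0 x1]; rewrite T0// addr0.
apply/(Cauchy_solution_Top lam y1 y2 l0 q2) => x xl.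
by have := xl; rewrite in_itv/= yE// => /andP[x0 x1]; rewrite T0// addr0.
Qed.

(** * Properties of the kernel T *)

(** Replacing w by w zeta_2 permutes the three exponentials cyclically, and the factor zeta_2^-2
    coming from w^-2 permutes their coefficients zeta_k^-2 in the same way. *)
Lemma s_quot2_zeta (R : realType) (w : R[i]) r : s_quot 2 (w * zeta R 2) r = s_quot 2 w r.
Proof.
have [->|w0] := eqVneq w 0; first by rewrite mul0r.
have z20 : zeta R 2 != 0 by exact: (@zeta_neq0 R 2).
have z23 : zeta R 2 ^+ 3 = 1 by exact: (@zeta_mul R 2).
rewrite (s_quotE 2 r w0) (s_quotE 2 r (mulf_neq0 w0 z20)) -zeta2_sqr.
have -> : w * zeta R 2 * zeta R 2 ^+ 2 = w by rewrite -mulrA -exprS z23 mulr1.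
have -> : w * zeta R 2 * zeta R 2 = w * zeta R 2 ^+ 2 by rewrite -mulrA.
have i2 : zeta R 2 ^- 2 = zeta R 2.
  by apply: (mulfI (expf_neq0 2 z20)); rewrite mulfV ?expf_neq0// -exprSr z23.
have i4 : (zeta R 2 ^+ 2) ^- 2 = zeta R 2 ^+ 2.
  by rewrite -exprVn i2.
rewrite exprMn invfM i2 i4.
move: (cexp _) (cexp _) (cexp _) (w ^- 2) => a b c d.
have -> : 3^-1 * (d * zeta R 2) * (c + zeta R 2 * b + zeta R 2 ^+ 2 * a) =
  3^-1 * d * (zeta R 2 ^+ 3 * a + zeta R 2 * c + zeta R 2 ^+ 2 * b) by ring.
by rewrite z23 mul1r.
Qed.

Lemma K1_zeta (R : realType) (lam : R[i]) : K1 (lam * zeta R 2) = K1 lam.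
Proof. by apply/funext => x; apply/funext => t; rewrite /K1 mulrA s_quot2_zeta. Qed.

Lemma Kn_zeta (R : realType) q (lam : R[i]) n : Kn q (lam * zeta R 2) n = Kn q lam n.
Proof.
elim: n => [//|[_|n IH]]; first exact: K1_zeta.
by apply/funext => x; apply/funext => t; rewrite /= -/(Kn q _ n.+1) IH K1_zeta.
Qed.

Lemma Tker_zeta (R : realType) q (lam : R[i]) x t : Tker q (lam * zeta R 2) x t = Tker q lam x t.
Proof.
rewrite /Tker /Nker (_ : Nseries q (lam * zeta R 2) x t = Nseries q lam x t)//; apply/funext => m.
by apply: eq_bigr => n _; rewrite Kn_zeta.
Qed.

(** The integral of a nonnegative function is a supremum over the simple functions below it, hence
    monotone without measurability. Sections and inner integrals of T can thus be bounded
    directly. *)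
Lemma ge0_le_integral_nonmeas d (T : measurableType d) (R : realType)
    (m : {measure set T -> \bar R}) (D : set T) (f g : T -> \bar R) :
  (forall x, D x -> 0 <= f x)%E -> (forall x, D x -> f x <= g x)%E ->
  (\int[m]_(x in D) f x <= \int[m]_(x in D) g x)%E.
Proof.
move=> f0 fg; rewrite !(integral_mkcond D).
have h x : ((f \_ D) x <= (g \_ D) x)%E by apply: lee_restrict.
have h0 x : (0 <= (f \_ D) x)%E by apply: erestrict_ge0.
rewrite !ge0_integralTE//; last by move=> x; exact: le_trans (h0 x) (h x).
apply: le_ereal_sup => _ [k kf <-]; exists k => // x.
exact: le_trans (kf x) (h x).
Qed.

Section Kernel.
Variables (R : realType) (l : R) (q : R -> R) (lam : R[i]).
Local Notation mu := (@lebesgue_measure R).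
Local Notation TR := (measurableTypeR R).
Hypothesis l0 : 0 < l.
Hypothesis qL2 : L2 0 l (fun x => (q x)%:C).
Local Notation qc := (qcut l q).

Lemma Nseries_cvgn x t : 0 <= t -> t <= x -> x <= l -> cvg (Nseries q lam x t @ \oo).
Proof.
move=> t0 tx xl; have [C C0 [KC _]] := Ktri1_bound_ex q lam l0.
by apply: (Nseries_cvg l0 (qcut_int qL2) C0 KC); apply/and3P.
Qed.

Lemma TkerE x t : 0 <= t -> t <= x -> x <= l -> Tker q lam x t = Ntri l q lam x t * (q t)%:C.
Proof. by move=> t0 tx xl; rewrite /Tker /Ntri /in_tri t0 tx xl. Qed.

(** On the triangle |T(x,t)| is at most a constant times |q(t)|, a square integrable bound free of
    x. *)
Lemma Tker_Volterra : L2_Volterra_kernel l (Tker q lam).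
Proof.
have [C C0 [KC _]] := Ktri1_bound_ex q lam l0.
have mN := Ntri_cmeas l0 (qcut_int qL2) C0 KC.
have mqc := qcut_cmeas (qcut_int qL2).
have mT : cmeas setT (fun p : TR * TR => Ntri l q lam p.1 p.2 * (qc p.2)%:C).
  by apply: cmeasM mN _; exact: (cmeas_comp mqc measurable_snd).
pose D : set (TR * TR) := [set p | 0 < p.2 < p.1 /\ p.1 < l].
have mD : measurable D.
  have m1 := @measurable_fst _ _ TR TR; have m2 := @measurable_snd _ _ TR TR.
  have -> : D = (fun p : TR * TR => (0 < p.2) && (p.2 < p.1) && (p.1 < l)) @^-1` [set true].
    by apply/seteqP; split=> p /=; [case=> -> ->|case/andP].
  rewrite -[X in measurable X]setTI.
  apply: (@measurable_and _ _ _ (fun p : TR * TR => (0 < p.2) && (p.2 < p.1)) (fun p : TR * TR => p.1 < l)) => //.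
    apply: (@measurable_and _ _ _ (fun p : TR * TR => (0 < p.2)) (fun p : TR * TR => p.2 < p.1)) => //.
      by apply: measurable_fun_ltr => //; exact: measurable_cst.
    exact: measurable_fun_ltr.
  by apply: measurable_fun_ltr => //; exact: measurable_cst.
have TE (p : TR * TR) : D p -> Ntri l q lam p.1 p.2 * (qc p.2)%:C = Tker q lam p.1 p.2.
  move=> [/andP[p0 p1] pl]; rewrite TkerE ?ltW// qcutE//.
  exact: lt_trans p1 pl.
have [m1 m2] : cmeas D (fun p : TR * TR => Tker q lam p.1 p.2).
  apply: (@eq_cmeas _ _ _ _ (fun p : TR * TR => Ntri l q lam p.1 p.2 * (qc p.2)%:C)).
    by move=> p; rewrite inE => /TE.
  exact: cmeasS mT.
split; [exact: m1|exact: m2|].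
pose A := (CN l q C * l ^+ 2) ^+ 2.
pose g (t : TR) : \bar R := (A * qc t ^+ 2)%:E.
have ig : mu.-integrable setT g.
  apply: integrable_scale => //.
  have := fcut_sqr_int qL2; apply: eq_integrable => // t _ /=.
  by rewrite -qcut_fcut cmodC real_normK ?num_real.
have mg : measurable_fun setT g by exact: measurable_int ig.
have gg t : (0 <= g t)%E by rewrite lee_fin mulr_ge0// sqr_ge0.
pose M := (\int[mu]_t g t)%E.
have M1 : (M < +oo)%E.
  have /integrableP[_] := ig; rewrite /M; under eq_integral do rewrite gee0_abs//.
  exact.
apply: (@le_lt_trans _ _ (\int[mu]_(x in `]0%R, l[) cst M x)%E).
  apply: ge0_le_integral_nonmeas => x; first by move=> _; apply: integral_ge0 => t _; rewrite lee_fin sqr_ge0.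
  rewrite /= in_itv/= => /andP[x0 xl].
  apply: (@le_trans _ _ (\int[mu]_(t in `]0%R, x[) g t)%E); last first.
    by apply: ge0_subset_integral => //; exact: measurable_itv.
  apply: ge0_le_integral_nonmeas => t; first by move=> _; rewrite lee_fin sqr_ge0.
  rewrite /= in_itv/= => /andP[t0 tx]; rewrite lee_fin.
  rewrite TkerE ?(ltW t0) ?(ltW tx) ?(ltW xl)// qcutE ?(lt_trans tx)//.
  rewrite cmodM cmodC exprMn real_normK ?num_real// ler_wpM2r ?sqr_ge0//.
  rewrite ler_sqr ?nnegrE ?cmod_ge0//.
    exact: (Ntri_bnd l0 (qcut_int qL2) C0 KC).
  by rewrite (le_trans (cmod_ge0 _) (Ntri_bnd l0 (qcut_int qL2) C0 KC x t)).
rewrite integral_cst; last exact: measurable_itv.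
rewrite lte_mul_pinfty//; first by apply: integral_ge0.
- by rewrite ge0_fin_numE//; apply: integral_ge0.
- exact: itv_mu_lty.
Qed.

(** The factor q(t) is constant in the integration variable s: this is the integral equation for N
    times q(t). *)
Lemma Tker_integral_eq x t : 0 <= t -> t <= x -> x <= l ->
  Tker q lam x t - 'i%C * cintegral `[t, x] (fun s => K1 lam x s * (q s)%:C * Tker q lam s t)
  = 'i%C * K1 lam x t * (q t)%:C.
Proof.
move=> t0 tx xl; have [C C0 [KC _]] := Ktri1_bound_ex q lam l0.
have xt : in_tri l x t by apply/and3P.
have -> : cintegral `[t, x] (fun s => K1 lam x s * (q s)%:C * Tker q lam s t) =
    (q t)%:C * vstep l q lam (fun s => Ntri l q lam s t) x.
  pose F s t := Ntri l q lam s t * (q t)%:C.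
  have F0 s : F s s = 0.
    have := Ntri_le l0 (qcut_int qL2) C0 KC s s; rewrite subrr expr0n/= mulr0 cmod_le0 => /eqP e.
    by rewrite /F e mul0r.
  rewrite (_ : cintegral _ _ = cintegral `[t, x] (fun s => K1 lam x s * (q s)%:C * F s t)); last first.
    apply: eq_cintegral => s; rewrite inE/= in_itv/= => /andP[ts sx].
    by rewrite TkerE// (le_trans sx xl).
  rewrite (cint_K1_tri KC xt F0) /vstep.
  have B0 : 0 <= CN l q C * l ^+ 2 by rewrite (le_trans (cmod_ge0 _) (Ntri_bnd l0 (qcut_int qL2) C0 KC x t)).
  have ic := vstep_cint_bnd l0 (qcut_int qL2) C0 KC x B0 (Ntri_sec_cmeas l0 (qcut_int qL2) C0 KC t)
    (fun s => Ntri_bnd l0 (qcut_int qL2) C0 KC s t).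
  rewrite -(cintegralZ _ measurableT ic); apply: eq_cintegral => s _.
  rewrite /F; case: ifPn => [_|/negbTE st]; first by ring.
  by rewrite /Ntri st !mulr0.
rewrite TkerE// (Ntri_eq l0 (qcut_int qL2) C0 KC) {1}/Ktri xt/=.
by move: (vstep _ _ _ _ _) (K1 _ _ _) => a b; ring.
Qed.

Lemma Tker_unique t (U : R -> R[i]) : 0 <= t -> t <= l -> L2 t l U ->
  (forall x : R, t <= x -> x <= l ->
     U x - 'i%C * cintegral `[t, x] (fun s => K1 lam x s * (q s)%:C * U s)
     = 'i%C * K1 lam x t * (q t)%:C) ->
  forall x : R, t <= x -> x <= l -> U x = Tker q lam x t.
Proof.
move=> t0 tl U2 UE; have [C C0 [KC _]] := Ktri1_bound_ex q lam l0.
have qi := qcut_int qL2.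
have K0 : K1 lam t t = 0 by rewrite /K1 subrr s_quot0.
(* The equation at x = t, where the integral is over a point and K_1 vanishes. *)
have Ut : U t = 0.
  have := UE t (lexx _) tl; rewrite cintegral0; first by rewrite K0 !(mulr0, mul0r) subr0.
  by move=> s; rewrite inE/= in_itv/= -eq_le => /eqP <-; rewrite K0 !mul0r.
pose u s := if in_tri l s t then U s else 0.
pose v s := Ntri l q lam s t * (q t)%:C.
pose r s := 'i%C * Ktri l q lam 1 s t * (q t)%:C.
have u2 : L2 0 l u.
  apply: (@eq_L2 _ _ (fun s => if s \in (`]t, l[%classic : set TR) then U s else 0)).
    move=> s s0 sl; rewrite /u /in_tri t0 (ltW sl) andbT/=.
    rewrite mem_setE in_itv/= sl andbT lt_neqAle; have [<-|] //= := eqVneq t s.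
    by rewrite lexx Ut.
  have /L2P[mU iU] := U2; have mI : measurable (`]t, l[%classic : set TR) by exact: measurable_itv.
  apply/L2P; split.
    have mU' := (cmeas_mkcond (U : TR -> _) mI).1 mU.
    by apply: (@cmeasS _ TR _ setT) => //; exact: mU'.
  apply: (@integrableS _ _ _ _ setT) => //.
  have := (integrable_mkcond _ mI).1 iU; apply: eq_integrable => // s _.
  by rewrite patchE /=; case: ifP => //; rewrite cmod0 expr0n.
have mv : cmeas setT (v : TR -> _).
  by apply: cmeasM (cmeas_cst _ _); exact: (Ntri_sec_cmeas l0 qi C0 KC t).
have v2 : L2 0 l v.
  apply: (@L2_bounded _ _ _ _ (CN l q C * l ^+ 2 * `|q t|)); first exact: cmeasS mv.
  by move=> s _ _; rewrite cmodM cmodC ler_wpM2r//; exact: Ntri_bnd.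
have KE f x : L2 0 l f -> 0 <= x -> x <= l ->
    iKop q lam f x = 'i%C * vstep l q lam f x.
  move=> f2 x0 xl; rewrite /iKop (Kop_tK lam l0 qL2 x0 xl f2); congr (_ * _).
  apply: eq_cintegral => s _; rewrite /qf /qcut /fcut; case: ifP => _; rewrite ?mulrA//.
  by rewrite !mulr0 mul0r.
have uK x : 0 <= x -> x <= l -> u x = r x + iKop q lam u x.
  move=> x0 xl; rewrite KE//.
  have [tx|xt] := leP t x; last first.
    have xtF : (t <= x) = false by rewrite leNgt xt.
    rewrite {1}/u /r /Ktri /in_tri xtF !andbF mulr0 mul0r add0r /vstep cintegral0 ?mulr0//.
    move=> s _; rewrite /u /Ktri /in_tri; have [st|st] := leP t s; last by rewrite andbF mulr0.
    have xsF : (s <= x) = false by rewrite leNgt (lt_le_trans xt st).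
    by rewrite xsF /= andbF !mul0r.
  have xt : in_tri l x t by apply/and3P.
  (* [cint_K1_tri] asks for a function of two variables that vanishes on the whole diagonal;
     changing U there is harmless because U(t) = 0. *)
  pose F s t := if s == t then 0 else U s : R[i].
  have F0 s : F s s = 0 by rewrite /F eqxx.
  have := UE x tx xl.
  rewrite (_ : cintegral _ _ = cintegral `[t, x] (fun s => K1 lam x s * (q s)%:C * F s t)); last first.
    by apply: eq_cintegral => s _; rewrite /F; case: eqP => // ->; rewrite Ut.
  rewrite (cint_K1_tri KC xt F0).
  rewrite (_ : (fun s => if in_tri l s t then F s t else 0) = u); last first.
    by apply/funext => s; rewrite /u /F; case: ifP => //; case: eqP => // ->; rewrite Ut.
  have -> : u x = U x by rewrite /u xt.
  by rewrite /r /Ktri xt/= => /eqP; rewrite subr_eq => /eqP.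
have vK x : 0 <= x -> x <= l -> v x = r x + iKop q lam v x.
  move=> x0 xl; rewrite KE// /v /r (Ntri_eq l0 qi C0 KC).
  have B0 : 0 <= CN l q C * l ^+ 2 by rewrite (le_trans (cmod_ge0 _) (Ntri_bnd l0 qi C0 KC x t)).
  have ic := vstep_cint_bnd l0 qi C0 KC x B0 (Ntri_sec_cmeas l0 qi C0 KC t)
    (fun s => Ntri_bnd l0 qi C0 KC s t).
  have -> : vstep l q lam (fun s => Ntri l q lam s t * (q t)%:C) x =
      (q t)%:C * vstep l q lam (fun s => Ntri l q lam s t) x.
    rewrite /vstep -(cintegralZ _ measurableT ic); apply: eq_cintegral => s _; ring.
  by move: (vstep _ _ _ _ _) (Ktri _ _ _ _ _ _) => a b; ring.
have uv : ae_equal 0 l u v.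
  apply: (ImiKop_inj (lam := lam) l0 qL2 u2 v2); apply: ae_equal_pt => s /ltW s0 /ltW sl.
  by rewrite /ImiKop {1}uK// {1}vK// !addrK.
move=> x tx xl; have x0 := le_trans t0 tx.
have : u x = v x.
  by rewrite uK// vK// /iKop (Kop_eq_ae lam l0 qL2 x0 xl u2 v2 uv).
by rewrite {1}/u /in_tri t0 tx xl/= TkerE.
Qed.

End Kernel.

(** * Behaviour of N and T at the diagonal *)

Section Diagonal.
Variables (R : realType) (l : R) (q : R -> R) (lam : R[i]).
Local Notation mu := (@lebesgue_measure R).
Local Notation TR := (measurableTypeR R).
Hypothesis l0 : 0 < l.
Hypothesis qL2 : L2 0 l (fun x => (q x)%:C).
Local Notation qc := (qcut l q).

Lemma Nker_diag_bound : exists2 B : R, 0 <= B & forall x t, 0 <= t -> t < x -> x <= l ->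
  cmod (Nker q lam x t / ((x - t) ^+ 2)%:C - 'i%C / 2) <= B * (x - t).
Proof.
have [C C0 [KC KC2]] := Ktri1_bound_ex q lam l0; have qi := qcut_int qL2.
set A := C * Rintegral mu setT (fun s : TR => `|qc s|) * CN l q C.
have A0 : 0 <= A.
  apply: mulr_ge0; first apply: mulr_ge0 => //; first exact: Rintegral_ge0.
  by apply: mulr_ge0 => //; exact: expR_ge0.
(* After division by d^2, where d = x - t, the quartic bound leaves A/4 d^2 <= A/4 l d and the cubic
   one leaves C d. *)
exists (A / 4 * l + C); first by rewrite addr_ge0// mulr_ge0 ?(ltW l0)// mulr_ge0.
move=> x t t0 tx xl; have xt : in_tri l x t by rewrite /in_tri t0 (ltW tx).
have d0 : 0 < x - t by rewrite subr_gt0.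
have dl : x - t <= l by lra.
have h1 := Ntri_K1_le l0 qi C0 KC x t; have h2 := KC2 x t xt.
rewrite -/A /Ntri xt in h1; move: h1 h2 d0 dl.
move: (Nker _ _ _ _) (Ktri _ _ _ _ _ _) (x - t) => N K d h1 h2 d0 dl.
have dC : (d ^+ 2)%:C != 0 :> R[i].
  by apply/eqP => -[/eqP]; rewrite expf_eq0 (gt_eqF d0).
have -> : N / (d ^+ 2)%:C - 'i%C / 2 =
    ((N - 'i%C * K) + 'i%C * (K - (d ^+ 2 / 2)%:C)) / (d ^+ 2)%:C.
  have -> : (d ^+ 2 / 2)%:C = (d ^+ 2)%:C * 2^-1 :> R[i].
    by rewrite rmorphM/= fmorphV/= rmorph_nat.
  by move: ((d ^+ 2)%:C) dC => D dC; field.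
rewrite cmodM cmodV cmodC ger0_norm ?sqr_ge0// ler_pdivrMr ?exprn_gt0//.
apply: (le_trans (cmodD _ _)); rewrite cmodM cmod_i mul1r.
apply: (le_trans (lerD h1 h2)).
have d3 : 0 <= d ^+ 3 by rewrite exprn_ge0// ltW.
have : A / 4 * d ^+ 3 * d <= A / 4 * d ^+ 3 * l by rewrite ler_wpM2l// mulr_ge0// mulr_ge0.
by rewrite !exprS expr0 !mulr1; lra.
Qed.

Lemma near_left (x : R) (P : R -> Prop) (r : R) : 0 < r ->
  (forall t, t < x -> x - t < r -> P t) -> \forall t \near x^'-, P t.
Proof.
move=> r0 h; near=> t; apply: h; first by near: t; exact: nbhs_left_lt.
rewrite ltrBlDr -ltrBlDl; near: t; apply: nbhs_left_gt; lra.
Unshelve. all: by end_near. Qed.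

Lemma Nker_diag_cvg x : 0 < x -> x <= l ->
  ((fun t : R => Nker q lam x t / ((x - t) ^+ 2)%:C : R[i]^o) @ x^'-) --> ('i%C / 2 : R[i]^o).
Proof.
move=> x0 xl; have [B B0 hB] := Nker_diag_bound.
apply/cvg_cmodP => e e0.
have B1 : 0 < B + 1 by rewrite ltr_wpDl.
apply: (near_left (r := Num.min x (e / (B + 1)))); first by rewrite lt_min x0 divr_gt0.
move=> t tx; rewrite lt_min ltr_pdivlMr// => /andP[t0 te].
apply: (le_lt_trans (hB x t _ tx xl)); first lra.
by apply: le_lt_trans te; rewrite mulrC ler_wpM2l ?subr_ge0 ?(ltW tx)// lerDl.
Qed.

Lemma Tker_diag_cvg x : 0 < x -> x <= l -> q t @[t --> x^'-] --> q x ->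
  ((fun t : R => Tker q lam x t / ((x - t) ^+ 2)%:C : R[i]^o) @ x^'-)
    --> ('i%C / 2 * (q x)%:C : R[i]^o).
Proof.
move=> x0 xl qx.
have qC : (fun t : R => (q t)%:C : R[i]^o) @ x^'- --> ((q x)%:C : R[i]^o).
  apply/cvg_cmodP => e e0; have /cvgrPdist_lt/(_ e e0) := qx.
  by apply: filterS => t; rewrite -rmorphB/= cmodC distrC.
rewrite (_ : (fun t => _) = (fun t => Nker q lam x t / ((x - t) ^+ 2)%:C * (q t)%:C)); last first.
  by apply/funext => t; rewrite /Tker mulrAC.
exact: cvgM (Nker_diag_cvg x0 xl) qC.
Qed.

(** The left-hand side splits into (N/(x-t)^2 - i/2) q(t) and i/2 (q(t) - q(x)); then |q(t)| <=
    |q(t) - q(x)| + |q(x)| leaves only |q(x)| and the quantity controlled at a Lebesgue point. *)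
Lemma Tker_diag_pt : exists2 B : R, 0 <= B & forall x t, 0 < t -> t < x -> x < l ->
  cmod (Tker q lam x t / ((x - t) ^+ 2)%:C - 'i%C / 2 * (q x)%:C) <=
    (B * l + 2^-1) * `|qc t - qc x| + B * `|q x| * (x - t).
Proof.
have [B B0 hB] := Nker_diag_bound; exists B => // x t t0 tx xl.
have x0 := lt_trans t0 tx; rewrite !qcutE//; last exact: lt_trans tx xl.
rewrite /Tker mulrAC.
have -> : Nker q lam x t / ((x - t) ^+ 2)%:C * (q t)%:C - 'i%C / 2 * (q x)%:C =
   (Nker q lam x t / ((x - t) ^+ 2)%:C - 'i%C / 2) * (q t)%:C + 'i%C / 2 * (q t - q x)%:C.
  by rewrite rmorphB/=; move: (_ / _) => N; ring.
apply: (le_trans (cmodD _ _)); rewrite !cmodM cmod_i cmodV !cmodC mul1r.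
have -> : cmod (2 : R[i]) = 2 by rewrite -[2]/(2%:R) -(rmorph_nat (real_complex R)) cmodC normr_nat.
have h := hB x t (ltW t0) tx (ltW xl).
have d0 : 0 <= x - t by rewrite subr_ge0 ltW.
have dl : x - t <= l by lra.
have qt : `|q t| <= `|q t - q x| + `|q x| by rewrite -[X in `|X| <= _](subrK (q x)) ler_normD.
have := normr_ge0 (q t); have := normr_ge0 (q t - q x); move: h d0 dl qt.
move: (x - t) `|q t| `|q t - q x| `|q x| (cmod _) => d a b c n h d0 dl qt b0 a0.
have h1 : n * a <= B * d * a by rewrite ler_wpM2r.
have h2 : B * d * a <= B * d * (b + c) by rewrite ler_wpM2l// mulr_ge0.
have h3 : B * d * b <= B * l * b by rewrite ler_wpM2r// ler_wpM2l.
by move: h1 h2 h3; rewrite !mulrDr !mulrDl; lra.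
Qed.

(** At a Lebesgue point of q the first term of [Tker_diag_pt] has mean tending to 0, and the second
    is at most b h on the interval of length h. *)
Lemma Tker_diag_average : {ae mu, forall x : R, x \in `]0, l[ ->
  (((h^-1)%:E * \int[mu]_(t in `[(x - h)%R, x])
      (cmod (Tker q lam x t / ((x - t) ^+ 2)%:C - 'i%C / 2 * (q x)%:C))%:E)%E
     @[h --> 0^'+]) --> 0%E}.
Proof.
have qi := qcut_int qL2; have [B B0 hB] := Tker_diag_pt.
have lq : locally_integrable [set: R] qc.
  by have := integrable_locally measurableT qi; rewrite patch_setT.
have FF := ae_filter_ringOfSetsType mu.
apply: filterS (lebesgue_differentiation lq) => x xL; rewrite in_itv/= => /andP[x0 xl].
pose a := B * l + 2^-1; pose b := B * `|q x|.
have a0 : 0 <= a by rewrite addr_ge0// mulr_ge0// ltW.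
have b0 : 0 <= b by rewrite mulr_ge0.
pose I h := (\int[mu]_(t in ball x h) `|(qc t - qc x)%:E|)%E.
have mqc : measurable_fun setT (qc : TR -> R).
  by have /integrableP[/measurable_EFinP] := qi.
have mg (D : set TR) : measurable D -> measurable_fun D (fun t : TR => `|(qc t - qc x)%:E|%E).
  move=> mD; apply/measurable_EFinP/measurable_funTS; apply: measurableT_comp => //.
  by apply: measurable_funB => //; exact: measurable_cst.
have le h : 0 < h -> h < x -> (\int[mu]_(t in `[(x - h)%R, x])
      (cmod (Tker q lam x t / ((x - t) ^+ 2)%:C - 'i%C / 2 * (q x)%:C))%:E <=
      a%:E * I h + (b * h * h)%:E)%E.
  move=> h0 hx.
  pose g (t : TR) : \bar R := (a%:E * `|(qc t - qc x)%:E| + (b * h)%:E)%E.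
  have gm (D : set TR) : measurable D -> measurable_fun D g.
    move=> mD; apply: emeasurable_funD; last exact: measurable_cst.
    by apply: measurable_funeM; exact: mg.
  have g0 t : (0 <= g t)%E.
    by rewrite adde_ge0// ?mule_ge0// lee_fin mulr_ge0// ltW.
  (* At t = x the quotient has the default value 0 and the bound does not apply. [G] keeps the
     actual integrand at that point, which is then removed as a null set. *)
  pose G t : \bar R := if t == x then (cmod (Tker q lam x x / ((x - x) ^+ 2)%:C - 'i%C / 2 * (q x)%:C))%:E else g t.
  apply: (@le_trans _ _ (\int[mu]_(t in `[(x - h)%R, x]) G t)%E).
    apply: ge0_le_integral_nonmeas => t; first by rewrite lee_fin cmod_ge0.
    rewrite /= in_itv/= /G => /andP[ht tx]; case: eqP => [->//|/eqP tnx].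
    have {}tx : t < x by rewrite lt_neqAle tnx.
    rewrite /g lee_fin; apply: (le_trans (hB x t _ tx xl)); first lra.
    rewrite lerD2l -/b ler_wpM2l//; lra.
  have eG : {in (`[(x - h)%R, x[%classic : set R), G =1 g}.
    by move=> t; rewrite inE/= in_itv/= /G => /andP[_ tx]; rewrite lt_eqF.
  rewrite -integral_itv_bndo_bndc; last first.
    apply: (@eq_measurable_fun _ _ _ _ _ g); last by apply: gm; exact: measurable_itv.
    by move=> t /eG.
  rewrite (eq_integral g); last exact: eG.
  rewrite -integral_itv_obnd_cbnd; last by apply: gm; exact: measurable_itv.
  have mI : measurable (`](x - h)%R, x[%classic : set TR) by exact: measurable_itv.
  rewrite ge0_integralD//; last 3 first.
  - by move=> t _; rewrite mule_ge0.
  - by apply: measurable_funeM; exact: mg.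
  - by move=> t _; rewrite lee_fin mulr_ge0// ltW.
  rewrite ge0_integralZl//; last exact: mg.
  apply: leeD.
    rewrite lee_wpmul2l// ?lee_fin// /I ball_itv; apply: ge0_subset_integral => //.
    - by apply: mg; exact: measurable_itv.
    - move=> t; rewrite /= !in_itv/= => /andP[-> tx]; lra.
  rewrite (integral_cst _ mI (b * h)%:E).
  have mh : mu `](x - h)%R, x[%classic = h%:E by rewrite mu_itv_oo ?subKr//; lra.
  by rewrite [(b * h * h)%:E]EFinM -mh; exact: lexx.
(* The ball around x has length 2h while the mean divides by h, hence 2 a. *)
apply: (@squeeze_cvge _ _ _ _ (fun=> 0%E) _ (fun h => (2 * a)%:E * davg qc x h + (b * h)%:E)%E).
- near=> h.
  have h0 : 0 < h by near: h; exact: nbhs_right_gt.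
  have hx : h < x by near: h; exact: nbhs_right_lt.
  apply/andP; split.
    apply: mule_ge0; first by rewrite lee_fin invr_ge0 ltW.
    by apply: integral_ge0 => t _; rewrite lee_fin cmod_ge0.
  apply: (@le_trans _ _ ((h^-1)%:E * (a%:E * I h + (b * h * h)%:E))%E).
    by rewrite lee_wpmul2l// ?le// lee_fin invr_ge0 ltW.
  rewrite le_eqVlt; apply/orP; left; apply/eqP.
  have I0 : (0 <= I h)%E by apply: integral_ge0.
  rewrite ge0_muleDr ?mule_ge0// ?lee_fin ?mulr_ge0 ?(ltW h0)//; congr (_ + _)%E.
    rewrite /davg /iavg lebesgue_measure_ball ?(ltW h0)// inver.
    rewrite mulrn_eq0/= gt_eqF//= !muleA -!EFinM; congr (_%:E * _)%E.
    by field; rewrite gt_eqF.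
  rewrite -EFinM; congr EFin; field; by rewrite gt_eqF.
- exact: cvg_cst.
- rewrite -[X in _ --> X]adde0; apply: cvgeD => //.
    by rewrite -(mule0 (2 * a)%:E); apply: cvgeZl => //; exact: xL.
  apply: cvg_EFin; first by near=> h.
  rewrite -[X in _ --> X](mulr0 b); apply: cvgZr.
  by apply: cvg_within_filter; exact: cvg_id.
Unshelve. all: by end_near. Qed.

End Diagonal.

Theorem lemma2p2 (R : realType) (l : R) (q : R -> R) (lam y1 y2 : R[i])
  (l_gt0 : 0 < l) (qL2 : L2 0 l (fun x => (q x)%:C)) :
  (* the series defining N converges *)
  (forall x t : R, 0 <= t -> t <= x -> x <= l ->
     cvg (Nseries q lam x t @ \oo)) /\
  (* y0 is the solution of the Cauchy problem with q = 0 *)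
  (forall y : R -> R[i],
     Cauchy_solution l (fun=> 0) lam y1 y2 y <->
     (forall x, x \in `[0, l] -> y x = y0_sol lam y1 y2 x)) /\
  (* (I + T) y0 is the solution of the Cauchy problem *)
  (forall y : R -> R[i],
     Cauchy_solution l q lam y1 y2 y <->
     (forall x, x \in `[0, l] ->
        y x = y0_sol lam y1 y2 x + Top q lam (y0_sol lam y1 y2) x)) /\
  (* K and T are bounded operators, T is of Volterra type *)
  L2_bounded_operator l (Kop q lam) /\
  L2_bounded_operator l (Top q lam) /\
  L2_Volterra_kernel l (Tker q lam) /\
  (forall x t : R, 0 <= t -> t <= x -> x <= l ->
     Tker q (lam * zeta R 2) x t = Tker q lam x t) /\
  (* operator identities *)
  L2_invertible l (ImiKop q lam) /\
  (forall f : R -> R[i], L2 0 l f ->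
     [/\ ae_equal 0 l (Top q lam f) (L2_inv l (ImiKop q lam) (iKop q lam f)),
         ae_equal 0 l (Top q lam f)
           (fun x => L2_inv l (ImiKop q lam) f x - f x) &
         ae_equal 0 l (fun x => f x + Top q lam f x)
           (L2_inv l (ImiKop q lam) f)]) /\
  (* T satisfies the integral equation, and is its only solution *)
  (forall x t : R, 0 <= t -> t <= x -> x <= l ->
     Tker q lam x t
       - 'i%C * cintegral `[t, x]
                (fun s => K1 lam x s * (q s)%:C * Tker q lam s t)
     = 'i%C * K1 lam x t * (q t)%:C) /\
  (forall (t : R) (U : R -> R[i]), 0 <= t -> t <= l -> L2 t l U ->
     (forall x : R, t <= x -> x <= l ->
        U x - 'i%C * cintegral `[t, x] (fun s => K1 lam x s * (q s)%:C * U s)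
        = 'i%C * K1 lam x t * (q t)%:C) ->
     forall x : R, t <= x -> x <= l -> U x = Tker q lam x t) /\
  (* behaviour of N, hence of T = N q, on the diagonal *)
  (forall x : R, 0 < x -> x <= l ->
     ((fun t : R => Nker q lam x t / ((x - t) ^+ 2)%:C : R[i]^o) @ x^'-)
       --> ('i%C / 2 : R[i]^o)) /\
  (forall x : R, 0 < x -> x <= l -> q t @[t --> x^'-] --> q x ->
     ((fun t : R => Tker q lam x t / ((x - t) ^+ 2)%:C : R[i]^o) @ x^'-)
       --> ('i%C / 2 * (q x)%:C : R[i]^o)) /\
  {ae @lebesgue_measure R, forall x : R, x \in `]0, l[ ->
     (((h^-1)%:E *
        \int[@lebesgue_measure R]_(t in `[(x - h)%R, x])
          (cmod (Tker q lam x t / ((x - t) ^+ 2)%:C - 'i%C / 2 * (q x)%:C))%:E)%E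
        @[h --> 0^'+]) --> 0%E}.
Proof.
split; first by move=> x t; exact: Nseries_cvgn.
split; first by move=> y; exact: Cauchy_solution_free.
split; first exact: Cauchy_solution_Top.
split; first exact: Kop_bounded.
split; first exact: Top_bounded.
split; first exact: Tker_Volterra.
split; first by move=> x t _ _ _; exact: Tker_zeta.
split; first exact: ImiKop_invertible.
split; first by move=> f; exact: operator_identities.
split; first by move=> x t; exact: Tker_integral_eq.
split; first by move=> t U; exact: Tker_unique.
split; first by move=> x; exact: Nker_diag_cvg.
split; first by move=> x; exact: Tker_diag_cvg.
exact: Tker_diag_average.
Qed.
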